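(* Let $A$ be a finite-dimensional power associative $\mathbb{Z}_2$-graded algebra over $K$ which is graded-central-simple and satisfies conditions $(\mathcal{P}_1)$, $(\mathcal{P}_2)$ and $(\mathcal{P}_3)$ below. Let $B$ be a graded algebra with supertrace which belongs to the same variety of graded algebras as $A\otimes E$ and satisfies all supertrace identities of $A\otimes E$. Then there exists a supercommutative (associative) algebra $\Xi$ such that $B$ can be embedded into $A\otimes \Xi$ as a graded $K$-algebra. Moreover, $\rho(B)=(A\otimes\Xi)^{\mathcal{G}}$, where $\mathcal{G}$ is the group of graded automorphisms of $A$ and $(\Xi,\rho)$ is the $A$-universal supermap for $B$.
   Context: $K$ is a field of characteristic $0$. Algebras are unital $K$-algebras, not necessarily associative; homomorphisms are unital. ''Graded'' means $\mathbb{Z}_2$-graded; graded homomorphisms preserve degrees. An embedding is an injective homomorphism. $E=E^{(0)}\oplus E^{(1)}$ is the infinite-dimensional Grassmann algebra with generators $e_1,e_2,\dots$, $e_ie_j=-e_je_i$, graded by parity of length. ''The variety of $A\otimes E$'' is the class $\mathcal V$ of graded algebras satisfying all graded polynomial identities of $A\otimes E$. A graded algebra is graded-simple if it has no proper nonzero graded two-sided ideals. The centroid $C(A)$ is the algebra of linear operators on $A$ commuting with all left and right multiplications; $A$ is graded-central if the degree-$0$ component of $C(A)$ is $K\cdot 1$, and graded-central-simple if it is graded-central and graded-simple. $A$ is power associative if every subalgebra generated by one element is associative. A superring (= supercommutative-associative algebra) is a unital associative graded $K$-algebra with $ab=(-1)^{\deg a\deg b}ba$ for homogeneous $a,b$.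 For a superring $F$, $A\otimes F=A\otimes_K F$ is graded by $(A\otimes F)^{(0)}=A^{(0)}\otimes F^{(0)}+A^{(1)}\otimes F^{(1)}$ and $(A\otimes F)^{(1)}=A^{(0)}\otimes F^{(1)}+A^{(1)}\otimes F^{(0)}$. For a homomorphism $\eta\colon F\to F'$ of superrings, $\eta_A=\mathrm{id}_A\otimes\eta$. For a fixed homogeneous basis $(w_i)$ of $A$, the entries of $\sum_i w_i\otimes f_i\in A\otimes F$ are the $f_i$. Generic trace: if $a_1,\dots,a_n$ is a basis of $A$, $v=\sum\xi_ia_i$ over the field of fractions of $K[\xi_1,\dots,\xi_n]$ has minimal polynomial $t^s-\sigma_1(v)t^{s-1}+\cdots+(-1)^s\sigma_s(v)$ with $\sigma_i(v)\in K[\xi_1,\dots,\xi_n]$; $\mathrm{Trd}(a)$ is the value of $\sigma_1$ at $a$. It is assumed that $\mathrm{Trd}$ is a trace on $A$, i.e. it vanishes on all commutators $[a,b]=ab-ba$ and associators $(a,b,c)=(ab)c-a(bc)$. The supercenter $\mathfrak{Z}(R)$ of a graded algebra $R$ is spanned by the homogeneous elements $z$ with $zb=(-1)^{\deg z\deg b}bz$ for all homogeneous $b$. A supertrace on $R$ is a degree-preserving linear map $\tau\colon R\to\mathfrak{Z}(R)$ with $\tau(\tau(a)b)=\tau(a)\tau(b)$ and $\tau(ab-(-1)^{\deg a\deg b}ba)=\tau((a,b,c))=0$ for homogeneous $a,b,c$; $(R,\tau)$ is then a supertrace algebra. It is a standing convention that for every superring $F$, $A\otimes F$ is considered as a supertrace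 algebra with $\mathrm{Strd}=\mathrm{Trd}\otimes\mathrm{id}$. A supertrace polynomial is a $K$-linear combination of expressions $a_0\,\mathrm{Str}(a_1)\cdots\mathrm{Str}(a_t)$, with $a_i$ monomials in the free graded algebra of $\mathcal V$ in even variables $x_1,x_2,\dots$ and odd variables $y_1,y_2,\dots$ and $\mathrm{Str}$ a formal supertrace. It is a supertrace identity of $(R,\tau)$ if, replacing $\mathrm{Str}$ by $\tau$, it vanishes for all substitutions of $x$'s by elements of $R^{(0)}$ and $y$'s by elements of $R^{(1)}$. Let $\mathcal{G}$ be the group of graded automorphisms of $A$, viewed as an algebraic group. $K[A^k]$ is the algebra of polynomial functions $A^k\to K$ with $\mathcal G$ acting via the diagonal action on $A^k$. $Tr'_k\subseteq K[A^k]$ is the subalgebra generated by the functions $\mathrm{Trd}\circ p$, $p\in K\{x_1,\dots,x_k\}$ (free algebra). Conditions: $(\mathcal{P}_1)$ $Tr'_k=K[A^k]^{\mathcal{G}}$ (for all $k$). $(\mathcal{P}_2)$ $\mathrm{Trd}$ is non-degenerate: $\mathrm{Trd}(uv)=0$ for all $v\in A$ implies $u=0$. $(\mathcal{P}_3)$ $\mathcal{G}$ is linearly reductive. The $A$-universal supermap for a supertrace algebra $B$ is a pair $(\Xi,\rho)$ with $\Xi$ a superring and $\rho\colon B\to A\otimes\Xi$ a supertrace-preserving graded homomorphism such that (a) the entries of the elements $\rho(b)$, $b\in B$, together with $1$, generate $\Xi$; (b) for every superring $F$ and every supertrace-preserving graded homomorphism $\kappa\colon B\to A\otimes F$ there is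 a graded homomorphism $\zeta\colon\Xi\to F$ with $\zeta_A\rho=\kappa$. It is unique up to isomorphism. Action of $\mathcal G$ on $A\otimes\Xi$: for $g\in\mathcal{G}$ let $\Phi_g=g\otimes\mathrm{id}$ and let $\zeta^g\colon\Xi\to\Xi$ be the unique graded homomorphism with $\Phi_g\circ\rho=\zeta^g_A\circ\rho$; $g$ acts by $\xi_g=\Phi_g\circ(\zeta^g_A)^{-1}$, and $(A\otimes\Xi)^{\mathcal G}$ is the set of common fixed points. *)

(* Defs.v *)
From HB Require Import structures.
From mathcomp Require Import all_boot all_order all_algebra.
From mathcomp Require Import finmap.
From mathcomp Require Import monalg.

Set Implicit Arguments.
Unset Strict Implicit.
Unset Printing Implicit Defensive.

Import GRing.Theory.
Local Open Scope ring_scope.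

(* Unital, not necessarily associative, Z/2-graded K-algebras. The degrees are *)
(* the booleans (false = 0, true = 1); the decomposition R = R^(0) (+) R^(1)    *)
(* is given by the two projections [gpart d], so that a is homogeneous of       *)
(* degree d iff [gpart d a = a]. The zero algebra is allowed, which is why      *)
(* [algType] is not used, even for superrings.                                  *)
HB.mixin Record isGradedAlg (K : fieldType) R of GRing.Lmodule K R := {
  gmul : R -> R -> R;
  gone : R;
  gpart : bool -> R -> R;
  gmulDl : left_distributive gmul +%R;
  gmulDr : right_distributive gmul +%R;
  gmulZl : forall (c : K) a b, gmul (c *: a) b = c *: gmul a b;
  gmulZr : forall (c : K) a b, gmul a (c *: b) = c *: gmul a b;
  gmul1l : left_id gone gmul;
  gmul1r : right_id gone gmul;
  gpart_linear : forall d, linear (gpart d);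
  gpart_proj : forall d e a, gpart d (gpart e a) = if d == e then gpart e a else 0;
  gpart_sum : forall a, gpart false a + gpart true a = a;
  gpart_mul : forall d e a b, gpart d a = a -> gpart e b = b ->
    gpart (d (+) e) (gmul a b) = gmul a b;
  gpart_one : gpart false gone = gone
}.

#[short(type="gradedAlgType")]
HB.structure Definition GradedAlg (K : fieldType) :=
  {R of isGradedAlg K R & GRing.Lmodule K R}.

#[short(type="finGradedAlgType")]
HB.structure Definition FinGradedAlg (K : fieldType) :=
  {R of GradedAlg K R & Vector K R}.

Notation "a ** b" := (gmul a b) (at level 40, left associativity) : ring_scope.
Arguments gone {K s}.

HB.instance Definition _ (K : fieldType) (R : gradedAlgType K) d :=
  GRing.isLinear.Build K R R *:%R (@gpart K R d) (gpart_linear d).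

Section Basic.
Variable K : fieldType.

Definition graded_hom (R S : gradedAlgType K) (f : R -> S) : Prop :=
  [/\ linear f, f gone = gone, forall a b, f (a ** b) = f a ** f b
    & forall d a, f (gpart d a) = gpart d (f a)].

Inductive subalg_gen (R : gradedAlgType K) (S : R -> Prop) : R -> Prop :=
| SubalgIn a of S a : subalg_gen S a
| SubalgOne : subalg_gen S gone
| SubalgLin c a b of subalg_gen S a & subalg_gen S b : subalg_gen S (c *: a + b)
| SubalgMul a b of subalg_gen S a & subalg_gen S b : subalg_gen S (a ** b).

Definition power_associative (R : gradedAlgType K) : Prop :=
  forall a x y z : R, subalg_gen (eq a) x -> subalg_gen (eq a) y ->
    subalg_gen (eq a) z -> (x ** y) ** z = x ** (y ** z).

Definition superring (F : gradedAlgType K) : Prop :=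
  associative (@gmul K F) /\
  forall d e (a b : F), gpart d a = a -> gpart e b = b ->
    a ** b = (-1) ^+ (d && e) *: (b ** a).

Definition graded_simple (A : finGradedAlgType K) : Prop :=
  forall U : {vspace A},
    (forall a u, u \in U -> (a ** u \in U) /\ (u ** a \in U)) ->
    (forall d u, u \in U -> gpart d u \in U) ->
    U = 0%VS \/ U = fullv.

Definition in_centroid (A : finGradedAlgType K) (phi : 'End(A)) : Prop :=
  forall a b : A, phi (a ** b) = a ** phi b /\ phi (a ** b) = phi a ** b.

Definition graded_central (A : finGradedAlgType K) : Prop :=
  forall phi : 'End(A), in_centroid phi ->
    (forall d a, phi (gpart d a) = gpart d (phi a)) ->
    exists c : K, forall a, phi a = c *: a.

Definition graded_central_simple (A : finGradedAlgType K) : Prop :=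
  graded_central A /\ graded_simple A.

End Basic.

Section GmulLemmas.
Variables (K : fieldType) (R : gradedAlgType K).
Implicit Types a b : R.

Lemma gmul0l a : 0 ** a = 0.
Proof. by rewrite -[X in X ** _](scale0r 0) gmulZl scale0r. Qed.

Lemma gmul0r a : a ** 0 = 0.
Proof. by rewrite -[X in _ ** X](scale0r 0) gmulZr scale0r. Qed.

Lemma gmul_suml (I : Type) (r : seq I) (G : I -> R) a :
  (\sum_(i <- r) G i) ** a = \sum_(i <- r) G i ** a.
Proof.
by elim/big_rec2: _ => [|i x y _ <-]; rewrite ?gmul0l // gmulDl.
Qed.

Lemma gmul_sumr (I : Type) (r : seq I) (G : I -> R) a :
  a ** (\sum_(i <- r) G i) = \sum_(i <- r) a ** G i.
Proof.
by elim/big_rec2: _ => [|i x y _ <-]; rewrite ?gmul0r // gmulDr.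
Qed.

Lemma assoc_linl (c : K) a a' b d : a ** (b ** d) = a ** b ** d ->
  a' ** (b ** d) = a' ** b ** d ->
  (c *: a + a') ** (b ** d) = (c *: a + a') ** b ** d.
Proof. by move=> E E'; rewrite !gmulDl !gmulZl E E'. Qed.

Lemma assoc_linm (c : K) a a' b d : b ** (a ** d) = b ** a ** d ->
  b ** (a' ** d) = b ** a' ** d ->
  b ** ((c *: a + a') ** d) = b ** (c *: a + a') ** d.
Proof.
by move=> E E'; rewrite gmulDl gmulZl !gmulDr !gmulZr gmulDl gmulZl E E'.
Qed.

Lemma assoc_linr (c : K) a a' b d : d ** (b ** a) = d ** b ** a ->
  d ** (b ** a') = d ** b ** a' ->
  d ** (b ** (c *: a + a')) = d ** b ** (c *: a + a').
Proof. by move=> E E'; rewrite !gmulDr !gmulZr E E'. Qed.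

Lemma comm_lin (c e : K) a a' b : a ** b = e *: (b ** a) -> a' ** b = e *: (b ** a') ->
  (c *: a + a') ** b = e *: (b ** (c *: a + a')).
Proof.
move=> E E'; rewrite gmulDl gmulDr gmulZl gmulZr E E' scalerDr.
by rewrite scalerA mulrC -scalerA.
Qed.

Lemma assoc0l a b : 0 ** (a ** b) = 0 ** a ** b.
Proof. by rewrite !gmul0l. Qed.

Lemma assoc0m a b : a ** (0 ** b) = a ** 0 ** b.
Proof. by rewrite gmul0l gmul0r gmul0l. Qed.

Lemma assoc0r a b : a ** (b ** 0) = a ** b ** 0.
Proof. by rewrite !gmul0r. Qed.

Lemma comm0 (e : K) a : 0 ** a = e *: (a ** 0).
Proof. by rewrite gmul0l gmul0r scaler0. Qed.

End GmulLemmas.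

Section HomogeneousBasis.
Variables (K : fieldType) (A : finGradedAlgType K).

Definition component (d : bool) : {vspace A} := limg (linfun (@gpart K A d)).

Definition hdim := (\dim (component false) + \dim (component true))%N.

Definition hbasis : hdim.-tuple A :=
  cat_tuple (vbasis (component false)) (vbasis (component true)).

Definition hvec (i : 'I_hdim) : A := hbasis`_i.

Definition hdeg (i : 'I_hdim) : bool := (\dim (component false) <= i)%N.

Definition hcoord (i : 'I_hdim) (a : A) : K := coord hbasis i a.

Lemma memv_component d a : (a \in component d) = (gpart d a == a).
Proof.
apply/memv_imgP/eqP => [[b _ ->]|aE]; last by exists a; rewrite ?memvf ?lfunE.
by rewrite lfunE /= gpart_proj eqxx.
Qed.

Lemma hbasis_basis : basis_of fullv hbasis.
Proof.
have dx : (component false :&: component true)%VS = 0%VS.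
  apply/eqP; rewrite -subv0; apply/subvP => a; rewrite memv_cap !memv_component.
  by case/andP=> /eqP a0 /eqP a1; rewrite -a0 -a1 gpart_proj memv0.
have -> : fullv = (component false + component true)%VS :> {vspace A}.
  apply/esym/eqP; rewrite eqEsubv subvf; apply/subvP => a _.
  by rewrite -[a]gpart_sum memv_add // memv_component gpart_proj eqxx.
by apply: cat_basis; rewrite ?vbasisP //; apply/directv_addP.
Qed.

Lemma hcoordE a : a = \sum_i hcoord i a *: hvec i.
Proof. by apply: coord_basis hbasis_basis _; rewrite memvf. Qed.

Lemma hcoord_basis (i j : 'I_hdim) : hcoord i (hvec j) = (i == j)%:R.
Proof. by rewrite /hcoord /hvec coord_free ?(basis_free hbasis_basis) // eq_sym. Qed.

Lemma hbasis_homog (i : 'I_hdim) : gpart (hdeg i) (hvec i) = hvec i.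
Proof.
apply/eqP; rewrite -memv_component /hdeg /hvec /= nth_cat size_tuple.
case: ltnP => ilt; apply: vbasis_mem; rewrite mem_nth ?size_tuple //.
by rewrite ltn_subLR // ltn_ord.
Qed.

Lemma hcoord_part d i a : hcoord i (gpart d a) = if hdeg i == d then hcoord i a else 0.
Proof.
have -> : gpart d a = \sum_(j | hdeg j == d) hcoord j a *: hvec j.
  rewrite {1}[a]hcoordE linear_sum /= [RHS]big_mkcond /=; apply: eq_bigr => j _.
  rewrite linearZ /= -[X in gpart d X]hbasis_homog gpart_proj hbasis_homog.
  by rewrite eq_sym; case: eqP => // _; rewrite scaler0.
rewrite /hcoord linear_sum /= big_mkcond /= (bigD1 i) //= big1 ?addr0.
  case: ifP => // _; rewrite linearZ /= -/(hcoord i (hvec i)) hcoord_basis eqxx.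
  exact: mulr1.
move=> j ji; case: ifP => // _; rewrite linearZ /= -/(hcoord i (hvec j)).
by rewrite hcoord_basis eq_sym (negbTE ji); exact: mulr0.
Qed.

End HomogeneousBasis.

Arguments hbasis {K} A.

(* A (x) F, an element u standing for \sum_i w_i (x) u i, where (w_i) is the    *)
(* homogeneous basis [hbasis A]; the u i are the entries of u.                  *)
Section Tensor.
Variables (K : fieldType) (A : finGradedAlgType K).

Definition tensor (F : lmodType K) : Type := {ffun 'I_(hdim A) -> F}.
HB.instance Definition _ (F : lmodType K) := GRing.Lmodule.on (tensor F).

Definition pure_tensor (F : lmodType K) (a : A) (f : F) : tensor F :=
  [ffun i => hcoord i a *: f].

Section Algebra.
Variable F : gradedAlgType K.
Implicit Types u v : tensor F.

(* (a (x) f)(b (x) g) = ab (x) fg, without sign *)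
Definition tensor_mul u v : tensor F :=
  \sum_i \sum_j pure_tensor (hvec i ** hvec j) (u i ** v j).

Definition tensor_one : tensor F := pure_tensor gone gone.

Definition tensor_part d u : tensor F := [ffun i => gpart (d (+) hdeg i) (u i)].

Lemma sum_tensorE (I : Type) (r : seq I) (P : pred I) (G : I -> tensor F) k :
  (\sum_(i <- r | P i) G i) k = \sum_(i <- r | P i) G i k.
Proof. by rewrite sum_ffunE. Qed.

Lemma tensor_mulE u v k : tensor_mul u v k =
  \sum_i \sum_j hcoord k (hvec i ** hvec j) *: (u i ** v j).
Proof.
rewrite /tensor_mul sum_tensorE; apply: eq_bigr => i _.
by rewrite sum_tensorE; apply: eq_bigr => j _; rewrite ffunE.
Qed.

Lemma tensor_mulDl : left_distributive tensor_mul +%R.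
Proof.
move=> u v x; apply/ffunP => k; rewrite [RHS]ffunE !tensor_mulE -big_split.
apply: eq_bigr => i _; rewrite -big_split; apply: eq_bigr => j _.
by rewrite ffunE gmulDl scalerDr.
Qed.

Lemma tensor_mulDr : right_distributive tensor_mul +%R.
Proof.
move=> u v x; apply/ffunP => k; rewrite [RHS]ffunE !tensor_mulE -big_split.
apply: eq_bigr => i _; rewrite -big_split; apply: eq_bigr => j _.
by rewrite ffunE gmulDr scalerDr.
Qed.

Lemma tensor_mulZl (c : K) u v : tensor_mul (c *: u) v = c *: tensor_mul u v.
Proof.
apply/ffunP => k; rewrite [RHS]ffunE !tensor_mulE scaler_sumr.
apply: eq_bigr => i _; rewrite scaler_sumr; apply: eq_bigr => j _.
by rewrite ffunE gmulZl !scalerA mulrC.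
Qed.

Lemma tensor_mulZr (c : K) u v : tensor_mul u (c *: v) = c *: tensor_mul u v.
Proof.
apply/ffunP => k; rewrite [RHS]ffunE !tensor_mulE scaler_sumr.
apply: eq_bigr => i _; rewrite scaler_sumr; apply: eq_bigr => j _.
by rewrite ffunE gmulZr !scalerA mulrC.
Qed.

Lemma hcoord_sum (k : 'I_(hdim A)) (G : 'I_(hdim A) -> A) :
  hcoord k (\sum_i G i) = \sum_i hcoord k (G i).
Proof. by rewrite /hcoord linear_sum. Qed.

Lemma hcoordZ (k : 'I_(hdim A)) c (a : A) : hcoord k (c *: a) = c * hcoord k a.
Proof. by rewrite /hcoord linearZ. Qed.

Lemma sum_hcoord_basis (k : 'I_(hdim A)) u :
  \sum_j hcoord k (hvec j) *: u j = u k.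
Proof.
rewrite (bigD1 k) //= hcoord_basis eqxx scale1r big1 ?addr0 // => j jk.
by rewrite hcoord_basis eq_sym (negbTE jk) scale0r.
Qed.

Lemma tensor_mul1l : left_id tensor_one tensor_mul.
Proof.
move=> u; apply/ffunP => k; rewrite tensor_mulE exchange_big /=.
rewrite -[RHS]sum_hcoord_basis; apply: eq_bigr => j _.
have wj : hvec j = \sum_i hcoord i gone *: (hvec i ** hvec j).
  by rewrite -[LHS]gmul1l [X in X ** _]hcoordE gmul_suml; under eq_bigr do rewrite gmulZl.
rewrite [in RHS]wj hcoord_sum scaler_suml; apply: eq_bigr => i _.
by rewrite ffunE gmulZl gmul1l hcoordZ scalerA mulrC.
Qed.

Lemma tensor_mul1r : right_id tensor_one tensor_mul.
Proof.
move=> u; apply/ffunP => k; rewrite tensor_mulE.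
rewrite -[RHS]sum_hcoord_basis; apply: eq_bigr => j _.
have wj : hvec j = \sum_i hcoord i gone *: (hvec j ** hvec i).
  by rewrite -[LHS]gmul1r [X in _ ** X]hcoordE gmul_sumr; under eq_bigr do rewrite gmulZr.
rewrite [in RHS]wj hcoord_sum scaler_suml; apply: eq_bigr => i _.
by rewrite ffunE gmulZr gmul1r hcoordZ scalerA mulrC.
Qed.

Lemma tensor_part_linear d : linear (tensor_part d).
Proof. by move=> c u v; apply/ffunP => i; rewrite !ffunE linearP. Qed.

Lemma tensor_part_proj d e u :
  tensor_part d (tensor_part e u) = if d == e then tensor_part e u else 0.
Proof.
apply/ffunP => i; rewrite !ffunE gpart_proj.
have -> : (d (+) hdeg i == e (+) hdeg i) = (d == e) by case: d; case: e; case: hdeg.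
by case: (d == e); rewrite !ffunE.
Qed.

Lemma tensor_part_sum u : tensor_part false u + tensor_part true u = u.
Proof.
apply/ffunP => i; rewrite !ffunE.
by case: (hdeg i) => /=; rewrite ?[_ true _ + _]addrC gpart_sum.
Qed.

Lemma tensor_part_mul d e u v : tensor_part d u = u -> tensor_part e v = v ->
  tensor_part (d (+) e) (tensor_mul u v) = tensor_mul u v.
Proof.
move=> /ffunP uE /ffunP vE; apply/ffunP => k; rewrite ffunE tensor_mulE.
rewrite linear_sum; apply: eq_bigr => i _; rewrite linear_sum.
apply: eq_bigr => j _; rewrite linearZ /=.
have := uE i; have := vE j; rewrite !ffunE => vj ui.
have uv := gpart_mul _ _ _ _ ui vj.
have ww := gpart_mul _ _ _ _ (hbasis_homog i) (hbasis_homog j).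
rewrite -ww hcoord_part; case: eqP => [->|_]; last by rewrite !scale0r.
congr (_ *: _); rewrite -[RHS]uv; congr (gpart _ _).
by case: d {uE ui uv}; case: e {vE vj}; case: (hdeg i); case: (hdeg j).
Qed.

Lemma tensor_part_one : tensor_part false tensor_one = tensor_one.
Proof.
apply/ffunP => i; rewrite !ffunE linearZ /= -(@gpart_one K A) hcoord_part.
case: eqP => [->|_]; last by rewrite !scale0r.
by rewrite gpart_one.
Qed.

HB.instance Definition _ := isGradedAlg.Build K (tensor F)
  tensor_mulDl tensor_mulDr tensor_mulZl tensor_mulZr tensor_mul1l tensor_mul1r
  tensor_part_linear tensor_part_proj tensor_part_sum tensor_part_mul
  tensor_part_one.

End Algebra.

Definition tensor_map (F F' : lmodType K) (eta : F -> F') (u : tensor F) : tensor F' :=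
  [ffun i => eta (u i)].

Definition tensor_act (F : lmodType K) (g : 'End(A)) (u : tensor F) : tensor F :=
  \sum_i pure_tensor (g (hvec i)) (u i).

(* Strd = Trd (x) id, where 1 (x) F is identified with F *)
Definition Strd (Trd : A -> K) (F : gradedAlgType K) (u : tensor F) : tensor F :=
  pure_tensor gone (\sum_i Trd (hvec i) *: u i).

End Tensor.

(* The Grassmann algebra: basis e_S, S a finite set of naturals, where e_S is   *)
(* the product of the generators e_i, i in S, taken in increasing order.        *)
Section Grassmann.
Variable K : fieldType.
Local Open Scope fset_scope.
Local Open Scope ring_scope.

Definition grassmann : Type := {malg K[{fset nat}]}.
HB.instance Definition _ := GRing.Lmodule.on grassmann.
Implicit Types (S T U : {fset nat}) (f g h : grassmann).

Definition gbasis S : grassmann := << S >>.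

Definition inversions S T : nat := (\sum_(i <- S) \sum_(j <- T) (j < i))%N.

Definition wedge S T : grassmann :=
  if fdisjoint S T then (-1) ^+ inversions S T *: gbasis (S `|` T) else 0.

Definition lin_ext (V : lmodType K) (F : {fset nat} -> V) f : V :=
  \sum_(S <- msupp f) f@_S *: F S.

Definition grassmann_mul f g : grassmann := lin_ext (fun S => lin_ext (wedge S) g) f.

Definition grassmann_one : grassmann := gbasis fset0.

Definition grassmann_part d f : grassmann :=
  lin_ext (fun S => if odd #|` S| == d then gbasis S else 0) f.

Lemma lin_extw (V : lmodType K) (F : {fset nat} -> V) f (d : {fset {fset nat}}) :
  msupp f `<=` d -> lin_ext F f = \sum_(S <- d) f@_S *: F S.
Proof.
by move=> fd; apply: big_fset_incl => // S _ /mcoeff_outdom ->; rewrite scale0r.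
Qed.

Lemma lin_ext_linear (V : lmodType K) (F : {fset nat} -> V) : linear (lin_ext F).
Proof.
move=> c f g; pose d := msupp (c *: f + g) `|` (msupp f `|` msupp g).
rewrite (@lin_extw _ _ _ d) ?fsubsetUl // (@lin_extw _ _ f d); last first.
  by apply/fsubsetP => S fS; rewrite !in_fsetU fS orbT.
rewrite (@lin_extw _ _ g d); last first.
  by apply/fsubsetP => S gS; rewrite !in_fsetU gS !orbT.
rewrite scaler_sumr -big_split; apply: eq_bigr => S _.
by rewrite mcoeffD mcoeffZ scalerDl scalerA.
Qed.

HB.instance Definition _ (V : lmodType K) (F : {fset nat} -> V) :=
  GRing.isLinear.Build K grassmann V *:%R (lin_ext F) (lin_ext_linear F).

Lemma lin_extU (V : lmodType K) (F : {fset nat} -> V) S : lin_ext F (gbasis S) = F S.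
Proof. by rewrite (@lin_extw _ _ _ [fset S]) /gbasis ?msuppU_le // big_seq_fset1 mcoeffUU scale1r. Qed.

Lemma grassmannE f : f = \sum_(S <- msupp f) f@_S *: gbasis S.
Proof.
rewrite /gbasis {1}[f]monalgE; apply: eq_bigr => S _.
by apply/malgP => T; rewrite mcoeffZ !mcoeffU mulrnAr mulr1.
Qed.

Lemma wedge0l S : wedge fset0 S = gbasis S.
Proof. by rewrite /wedge fdisjoint0X fset0U /inversions big_seq_fset0 expr0 scale1r. Qed.

Lemma wedge0r S : wedge S fset0 = gbasis S.
Proof.
rewrite /wedge fdisjointX0 fsetU0 /inversions big1 ?expr0 ?scale1r // => i _.
by rewrite big_seq_fset0.
Qed.

Lemma grassmann_mulDl : left_distributive grassmann_mul +%R.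
Proof. by move=> f g h; rewrite /grassmann_mul linearD. Qed.

Lemma grassmann_mulDr : right_distributive grassmann_mul +%R.
Proof.
move=> f g h; rewrite /grassmann_mul -big_split; apply: eq_bigr => S _.
by rewrite linearD scalerDr.
Qed.

Lemma grassmann_mulZl (c : K) f g : grassmann_mul (c *: f) g = c *: grassmann_mul f g.
Proof. by rewrite /grassmann_mul linearZ. Qed.

Lemma grassmann_mulZr (c : K) f g : grassmann_mul f (c *: g) = c *: grassmann_mul f g.
Proof.
rewrite /grassmann_mul [RHS]scaler_sumr; apply: eq_bigr => S _.
by rewrite linearZ !scalerA mulrC.
Qed.

Lemma grassmann_mul1l : left_id grassmann_one grassmann_mul.
Proof.
move=> f; rewrite /grassmann_mul lin_extU [RHS]grassmannE.
by apply: eq_bigr => S _; rewrite wedge0l.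
Qed.

Lemma grassmann_mul1r : right_id grassmann_one grassmann_mul.
Proof.
move=> f; rewrite /grassmann_mul [RHS]grassmannE.
by apply: eq_bigr => S _; rewrite lin_extU wedge0r.
Qed.

Lemma grassmann_part_linear d : linear (grassmann_part d).
Proof. exact: lin_ext_linear. Qed.

Lemma mcoeff_part d f S : (grassmann_part d f)@_S = if odd #|` S| == d then f@_S else 0.
Proof.
rewrite /grassmann_part (@lin_extw _ _ _ (S |` msupp f)) ?fsubsetU1 //.
rewrite raddf_sum (big_fsetD1 S) ?fset1U1 //= big1_fset ?addr0.
  by rewrite mcoeffZ; case: ifP; rewrite ?mcoeff0 ?mulr0 // /gbasis mcoeffUU ?mulr1 ?mulr0.
move=> T; rewrite !inE => /andP[TS _] _; rewrite mcoeffZ.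
by case: ifP; rewrite /gbasis ?mcoeffU ?(negbTE TS) ?mcoeff0 mulr0.
Qed.

Lemma grassmann_part_proj d e f :
  grassmann_part d (grassmann_part e f) = if d == e then grassmann_part e f else 0.
Proof.
apply/malgP => S; rewrite mcoeff_part.
case: (d =P e) => [->|de]; rewrite mcoeff_part; first by case: (odd _ == e).
by rewrite mcoeff0; case: eqP => // ->; case: eqP.
Qed.

Lemma grassmann_part_sum f : grassmann_part false f + grassmann_part true f = f.
Proof.
apply/malgP => S; rewrite mcoeffD !mcoeff_part.
by case: odd; rewrite ?addr0 ?add0r.
Qed.

Lemma homog_supp d f S : grassmann_part d f = f -> S \in msupp f -> odd #|` S| = d.
Proof.
move=> fd; rewrite -mcoeff_neq0 -fd mcoeff_part.
by case: (odd _ =P d) => //; rewrite eqxx.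
Qed.

Lemma grassmann_partU d S : grassmann_part d (gbasis S) = if odd #|` S| == d then gbasis S else 0.
Proof. exact: lin_extU. Qed.

Lemma wedge_part S T :
  grassmann_part (odd #|` S| (+) odd #|` T|) (wedge S T) = wedge S T.
Proof.
rewrite /wedge; case: ifP => [ST|_]; last exact: linear0.
rewrite [LHS]linearZ [X in _ *: X = _]grassmann_partU.
by rewrite cardfsU (eqP (etrans (fsetI_eq0 S T) ST)) cardfs0 subn0 oddD eqxx.
Qed.

Lemma grassmann_part_mul d e f g : grassmann_part d f = f -> grassmann_part e g = g ->
  grassmann_part (d (+) e) (grassmann_mul f g) = grassmann_mul f g.
Proof.
move=> fd ge; rewrite [LHS]linear_sum; apply: eq_big_seq => S fS.
rewrite linearZ; congr (_ *: _); rewrite linear_sum; apply: eq_big_seq => T gT.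
rewrite linearZ; congr (_ *: _).
by rewrite -(homog_supp fd fS) -(homog_supp ge gT); apply: wedge_part.
Qed.

Lemma grassmann_part_one : grassmann_part false grassmann_one = grassmann_one.
Proof. by rewrite /grassmann_one grassmann_partU cardfs0. Qed.

HB.instance Definition _ := isGradedAlg.Build K grassmann
  grassmann_mulDl grassmann_mulDr grassmann_mulZl grassmann_mulZr grassmann_mul1l
  grassmann_mul1r grassmann_part_linear grassmann_part_proj grassmann_part_sum
  grassmann_part_mul grassmann_part_one.

Definition grassmann_gen (i : nat) : grassmann := gbasis [fset i].

Lemma gmulU S T : gbasis S ** gbasis T = wedge S T.
Proof. by rewrite /gmul /= /grassmann_mul !lin_extU. Qed.

Lemma big_disjointU (F : nat -> nat) S T : fdisjoint S T ->
  (\sum_(i <- S `|` T) F i = \sum_(i <- S) F i + \sum_(i <- T) F i)%N.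
Proof.
move=> /fdisjointP ST; rewrite -big_cat; apply/perm_big/uniq_perm => //.
  rewrite cat_uniq !fset_uniq andbT /=; apply/hasPn => i iT.
  by apply/negP => /ST /negP; apply.
by move=> i; rewrite in_fsetU mem_cat.
Qed.

Lemma inversionsU S T U : fdisjoint T U ->
  inversions S (T `|` U) = (inversions S T + inversions S U)%N.
Proof.
move=> TU; rewrite /inversions -big_split; apply: eq_bigr => i _.
by rewrite big_disjointU.
Qed.

Lemma inversionsUl S T U : fdisjoint S T ->
  inversions (S `|` T) U = (inversions S U + inversions T U)%N.
Proof. by move=> ST; rewrite /inversions big_disjointU. Qed.

Lemma wedgeA S T U : wedge S T ** gbasis U = gbasis S ** wedge T U.
Proof.
rewrite /wedge; case ST: (fdisjoint S T); case TU: (fdisjoint T U).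
- rewrite gmulZl gmulZr !gmulU /wedge fdisjointUX fdisjointXU ST TU andbT /=.
  case: (fdisjoint S U); last by rewrite [LHS]scaler0 [RHS]scaler0.
  rewrite [LHS]scalerA [RHS]scalerA fsetUA; congr (_ *: _).
  rewrite -[LHS]exprD -[RHS]exprD; congr (_ ^+ _).
  rewrite inversionsU // inversionsUl //. by rewrite [RHS]addnC -addnA.
- by rewrite gmulZl gmulU /wedge fdisjointUX TU andbF scaler0 gmul0r.
- by rewrite gmulZr gmulU /wedge fdisjointXU ST scaler0 gmul0l.
- by rewrite gmul0l gmul0r.
Qed.

Lemma inversionsC S T : fdisjoint S T ->
  (inversions S T + inversions T S = #|` S| * #|` T|)%N.
Proof.
move=> ST; rewrite /inversions [X in (_ + X)%N]exchange_big -big_split /=.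
rewrite -[#|` S|]sum1_size big_distrl /=; apply: eq_big_seq => i iS.
rewrite mul1n -big_split -sum1_size; apply: eq_big_seq => j jT /=.
case: ltngtP => // ji; move/fdisjointP: ST => /(_ i iS).
by rewrite -ji jT.
Qed.

Lemma wedgeC S T : wedge S T = (-1) ^+ (odd #|` S| && odd #|` T|) *: wedge T S.
Proof.
rewrite /wedge [fdisjoint T S]fdisjoint_sym.
case ST: (fdisjoint S T); last by rewrite [RHS]scaler0.
rewrite [RHS]scalerA [T `|` S]fsetUC; congr (_ *: _).
rewrite -[RHS]exprD -[LHS]signr_odd -[RHS]signr_odd; congr (_ ^+ nat_of_bool _).
rewrite oddD oddb -oddM -inversionsC // oddD.
by case: (odd _); case: (odd _).
Qed.

Lemma grassmann_sum_ind (P : grassmann -> Prop) f : P 0 ->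
  (forall c g h, P g -> P h -> P (c *: g + h)) ->
  (forall S, S \in msupp f -> P (gbasis S)) -> P f.
Proof.
move=> P0 PD PU; rewrite [f]grassmannE big_seq; elim/big_rec: _ => // S g Sf Pg.
by apply: PD => //; apply: PU.
Qed.

Lemma grassmann_superring : superring grassmann.
Proof.
split=> [f g h|d e f g fd ge].
  apply: (@grassmann_sum_ind (fun x => x ** (g ** h) = x ** g ** h)).
  - exact: assoc0l.
  - by move=> c x y; apply: assoc_linl.
  move=> S _; apply: (@grassmann_sum_ind (fun x => gbasis S ** (x ** h) = gbasis S ** x ** h)).
  - exact: assoc0m.
  - by move=> c x y; apply: assoc_linm.
  move=> T _; apply: (@grassmann_sum_ind
    (fun x => gbasis S ** (gbasis T ** x) = gbasis S ** gbasis T ** x)).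
  - exact: assoc0r.
  - by move=> c x y; apply: assoc_linr.
  by move=> U _; rewrite !gmulU wedgeA.
apply: (@grassmann_sum_ind (fun x => x ** g = (-1) ^+ (d && e) *: (g ** x))).
- exact: comm0.
- by move=> c x y; apply: comm_lin.
move=> S fS; have signK : (-1) ^+ (d && e) * (-1) ^+ (d && e) = 1 :> K.
  by rewrite -expr2 sqrr_sign.
suff -> : g ** gbasis S = (-1) ^+ (d && e) *: (gbasis S ** g).
  by rewrite [RHS]scalerA signK [RHS]scale1r.
apply: (@grassmann_sum_ind (fun x => x ** gbasis S = (-1) ^+ (d && e) *: (gbasis S ** x))).
- exact: comm0.
- by move=> c x y; apply: comm_lin.
move=> T gT; rewrite !gmulU wedgeC (homog_supp fd fS) (homog_supp ge gT).
by rewrite andbC.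
Qed.

Lemma grassmann_gen_anticomm i j :
  grassmann_gen i ** grassmann_gen j = - (grassmann_gen j ** grassmann_gen i).
Proof. by rewrite !gmulU wedgeC !cardfs1 scaleN1r. Qed.

End Grassmann.

(* Nonassociative words in the letters X. Up to the relations [1 ** m = m] and  *)
(* [m ** 1 = m], which every evaluation respects, they are the monomials of the *)
(* free unital algebra K{X}, and lists of (coefficient, word) are its elements. *)
Inductive word (X : Type) : Type :=
| WOne
| WVar of X
| WMul of word X & word X.

(* Words in the letters X and Str(m), m a nonassociative monomial: these are    *)
(* the expressions a_0 Str(a_1) ... Str(a_t) with the factors Str(a_i) inserted *)
(* anywhere and bracketed in any way. In a nonassociative supertrace algebra    *)
(* the unbracketed product a_0 Str(a_1) ... Str(a_t) has no meaning by itself;  *)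
(* the left-normed bracketings ((a_0 Str(a_1)) ...) Str(a_t) alone would not    *)
(* express that the formal supertraces are scalars, e.g. that                   *)
(* x (y Str(z)) = (x y) Str(z).                                                 *)
Inductive str_word (X : Type) : Type :=
| SOne
| SVar of X
| SMul of str_word X & str_word X
| SStr of word X.

(* (d, i) is the i-th variable of degree d: x_i for d = false, y_i for d = true *)
Definition graded_var : Type := (bool * nat)%type.

Section Identities.
Variable K : fieldType.

Fixpoint word_eval (R : gradedAlgType K) X (s : X -> R) (w : word X) : R :=
  match w with
  | WOne => gone
  | WVar x => s x
  | WMul w1 w2 => word_eval s w1 ** word_eval s w2
  end.

Definition npoly_eval (R : gradedAlgType K) X (s : X -> R) (p : seq (K * word X)) : R :=
  \sum_(t <- p) t.1 *: word_eval s t.2.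

Fixpoint str_word_eval (R : gradedAlgType K) (tau : R -> R) X (s : X -> R)
    (w : str_word X) : R :=
  match w with
  | SOne => gone
  | SVar x => s x
  | SMul w1 w2 => str_word_eval tau s w1 ** str_word_eval tau s w2
  | SStr m => tau (word_eval s m)
  end.

Definition str_poly_eval (R : gradedAlgType K) (tau : R -> R) X (s : X -> R)
    (p : seq (K * str_word X)) : R :=
  \sum_(t <- p) t.1 *: str_word_eval tau s t.2.

Definition graded_subst (R : gradedAlgType K) (s : graded_var -> R) : Prop :=
  forall x, gpart x.1 (s x) = s x.

Definition graded_identity (R : gradedAlgType K) (p : seq (K * word graded_var)) : Prop :=
  forall s : graded_var -> R, graded_subst s -> npoly_eval s p = 0.

Definition in_variety_of (S R : gradedAlgType K) : Prop :=
  forall p, graded_identity S p -> graded_identity R p.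

Definition supertrace_identity (R : gradedAlgType K) (tau : R -> R)
    (p : seq (K * str_word graded_var)) : Prop :=
  forall s : graded_var -> R, graded_subst s -> str_poly_eval tau s p = 0.

Definition supercentral (R : gradedAlgType K) (d : bool) (z : R) : Prop :=
  gpart d z = z /\
  forall e b, gpart e b = b -> z ** b = (-1) ^+ (d && e) *: (b ** z).

Definition supercenter (R : gradedAlgType K) (z : R) : Prop :=
  exists z0 z1, [/\ supercentral false z0, supercentral true z1 & z = z0 + z1].

Definition supertrace (R : gradedAlgType K) (tau : R -> R) : Prop :=
  [/\ linear tau,
      (forall d a, gpart d a = a -> gpart d (tau a) = tau a),
      (forall a, supercenter (tau a))
    & (forall a b, tau (tau a ** b) = tau a ** tau b)] /\
  (forall d e a b, gpart d a = a -> gpart e b = b ->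
     tau (a ** b - (-1) ^+ (d && e) *: (b ** a)) = 0) /\
  (forall a b c, tau (a ** b ** c - a ** (b ** c)) = 0).

End Identities.

From mathcomp Require Import mpoly fraction.

Section GenericTrace.
Variables (K : fieldType) (A : finGradedAlgType K).
Local Notation n := (hdim A).
(* monalg has its own {mpoly K[n]}; this is the one of mpoly *)
Local Notation Kxi := (mpoly.mpoly n K).

(* powers v^(k+1) = v^k v of the generic element v = \sum_i 'X_i w_i *)
Fixpoint generic_power (k : nat) : tensor A Kxi :=
  if k is k'.+1 then
    \sum_i \sum_j pure_tensor (hvec i ** hvec j) (generic_power k' i * 'X_j)
  else pure_tensor gone 1.

Definition generic_root (q : {poly {fraction Kxi}}) : Prop :=
  forall i, \sum_(k < size q) q`_k * FracField.tofrac (generic_power k i) = 0.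

(* p = t^s - sigma_1 t^(s-1) + ... is the minimal polynomial of v over the      *)
(* field of fractions of K[xi_1, ..., xi_n], and it has coefficients in         *)
(* K[xi_1, ..., xi_n]                                                           *)
Definition generic_minpoly (p : {poly Kxi}) : Prop :=
  [/\ p \is monic, generic_root (map_poly (@FracField.tofrac _) p)
    & forall q, q != 0 -> generic_root q -> (size p <= size q)%N].

Definition generic_trace (Trd : A -> K) : Prop :=
  exists2 p, generic_minpoly p &
    forall a, Trd a = (- p`_(size p).-2).@[fun i => hcoord i a].

Definition is_trace (Trd : A -> K) : Prop :=
  (forall a b, Trd (a ** b - b ** a) = 0) /\
  (forall a b c, Trd (a ** b ** c - a ** (b ** c)) = 0).

End GenericTrace.

(* The last constructor makes membership insensitive to functional             *)
(* extensionality.                                                             *)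
Inductive fun_alg (K : fieldType) (T : Type) (S : (T -> K) -> Prop) : (T -> K) -> Prop :=
| FunAlgIn f of S f : fun_alg S f
| FunAlgConst c : fun_alg S (fun=> c)
| FunAlgAdd f g of fun_alg S f & fun_alg S g : fun_alg S (fun x => f x + g x)
| FunAlgMul f g of fun_alg S f & fun_alg S g : fun_alg S (fun x => f x * g x)
| FunAlgExt f g of fun_alg S f & f =1 g : fun_alg S g.

Section Conditions.
Variables (K : fieldType) (A : finGradedAlgType K).

(* The group G is taken as the abstract group of K-rational points, together   *)
(* with the regular functions on it defined below; K need not be algebraically *)
(* closed.                                                                     *)
Definition graded_aut (g : 'End(A)) : Prop := graded_hom g /\ bijective g.

Definition polynomial_fun k : (('I_k -> A) -> K) -> Prop :=
  fun_alg (fun f => exists j i, f = fun u => hcoord i (u j)).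

Definition trace_fun (Trd : A -> K) k : (('I_k -> A) -> K) -> Prop :=
  fun_alg (fun f => exists p, f = fun u => Trd (npoly_eval u p)).

Definition invariant_fun k (f : ('I_k -> A) -> K) : Prop :=
  forall g, graded_aut g -> forall u, f (fun j => g (u j)) = f u.

Definition condP1 (Trd : A -> K) : Prop :=
  forall k (f : ('I_k -> A) -> K),
    trace_fun Trd f <-> polynomial_fun f /\ invariant_fun f.

Definition condP2 (Trd : A -> K) : Prop :=
  forall u, (forall v, Trd (u ** v) = 0) -> u = 0.

Definition end_mx (g : 'End(A)) : 'M[K]_(hdim A) := \matrix_(i, j) hcoord i (g (hvec j)).

Definition regular_fun : ('End(A) -> K) -> Prop :=
  fun_alg (fun f => (exists i j, f = fun g => end_mx g i j) \/
                    f = fun g => (\det (end_mx g))^-1).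

(* Only the values of rho on graded automorphisms matter. *)
Definition rational_rep (V : vectType K) (rho : 'End(A) -> 'End(V)) : Prop :=
  [/\ rho \1%VF = \1%VF,
      forall g h, graded_aut g -> graded_aut h -> rho (g \o h)%VF = (rho g \o rho h)%VF
    & forall (phi : 'Hom(V, K^o)) v, exists2 f, regular_fun f &
        forall g, graded_aut g -> phi (rho g v) = f g].

Definition stable_subspace (V : vectType K) (rho : 'End(A) -> 'End(V)) (U : {vspace V}) :=
  forall g, graded_aut g -> (rho g @: U <= U)%VS.

(* linear reductivity of the group of graded automorphisms: every finite-       *)
(* dimensional rational representation is completely reducible                  *)
Definition condP3 : Prop :=
  forall (V : vectType K) (rho : 'End(A) -> 'End(V)), rational_rep rho ->
    forall U, stable_subspace rho U ->
      exists W, [/\ stable_subspace rho W, (U + W)%VS = fullv & (U :&: W)%VS = 0%VS].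

End Conditions.

Section UniversalSupermap.
Variables (K : fieldType) (A : finGradedAlgType K) (Trd : A -> K).
Variables (B : gradedAlgType K) (tau : B -> B).

Definition supertrace_hom (F : gradedAlgType K) (kappa : B -> tensor A F) : Prop :=
  graded_hom kappa /\ forall b, kappa (tau b) = Strd Trd (kappa b).

Definition universal_supermap (Xi : gradedAlgType K) (rho : B -> tensor A Xi) : Prop :=
  [/\ superring Xi, supertrace_hom rho,
      forall x : Xi, subalg_gen (fun f => exists b i, f = rho b i) x
    & forall (F : gradedAlgType K) (kappa : B -> tensor A F), superring F ->
        supertrace_hom kappa ->
        exists2 zeta : Xi -> F, graded_hom zeta & forall b, tensor_map zeta (rho b) = kappa b].

(* u is fixed by xi_g = Phi_g o (zeta^g_A)^-1 for every g; here zeta is zeta^g   *)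
(* and zeta' is its inverse                                                     *)
Definition fixed_point (Xi : gradedAlgType K) (rho : B -> tensor A Xi) (u : tensor A Xi) : Prop :=
  forall g : 'End(A), graded_aut g ->
    exists zeta zeta' : Xi -> Xi,
      [/\ graded_hom zeta, forall b, tensor_act g (rho b) = tensor_map zeta (rho b),
          cancel zeta zeta', cancel zeta' zeta
        & tensor_act g (tensor_map zeta' u) = u].

End UniversalSupermap.

(* Main.v *)
From HB Require Import structures.
Require Import Defs.
From mathcomp Require Import all_boot all_order all_algebra generic_quotient.
From mathcomp Require Import mpoly fraction boolp.

Set Implicit Arguments.
Unset Strict Implicit.
Unset Printing Implicit Defensive.

Import GRing.Theory.
Local Open Scope ring_scope.

(* Following Procesi, B is recovered as a ring of equivariant maps. Invariance under G is     *)
(* detected by P1 and P2: for an equivariant multilinear map phi from A^n to A the form       *)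
(* Trd(phi(u_1, .., u_n) v) is an invariant, hence a trace polynomial, and moving v out of    *)
(* the traces writes phi as a multilinear trace polynomial. Over a superring the same words   *)
(* differ only by signs, which depend on the degrees of the arguments and of their            *)
(* components in A. The latter are controlled because P1 makes the projection onto A^(0) a    *)
(* combination of the identity and the trace: either A is trivially graded or A^(0) = K.      *)
(* Linear reductivity lets one replace a tuple of multilinear maps whose sum is invariant by  *)
(* a tuple of invariant ones, so an invariant element of A (x) F written in entries of        *)
(* equivariant elements is a supertrace polynomial in these. Applied to F = Xi this gives     *)
(* (A (x) Xi)^G = rho(B). Applied to the free superring Omega on the entries of generic       *)
(* elements x_b, with Xi = Omega / J, it shows that if x_b lies in A (x) J, then it is a      *)
(* supertrace polynomial in which every term involves a defining relation of B; this is a     *)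
(* supertrace identity of A (x) E, and in B it reads b = 0.                                   *)

(** * Graded algebras and tensor products *)

(** The algebra [B] is compared with a generic model. [Omega] is the free superring on the entries
    of generic homogeneous elements [xgen v]; J is its ideal generated by the entries of the
    elements [relator], which say that sending b to its generic element is a supertrace
    homomorphism. The quotient [Xi0] with [rho0] is universal by construction ([rho0_universal]). It
    remains to see that [rho0] has no kernel and that every fixed element lies in the image.

    Both rest on one expansion, [invariant_expand]. Let u in A (x) F be a combination of terms a (x)
    m, with m a monomial in entries of elements y, and suppose that every automorphism g acts on u
    and on the y's like some endomorphism of F. Then u is a sum of values of multilinear maps of A
    at the y's. These maps form a rational representation in which the tuples of value 0 are a
    stable subspace, so by linear reductivity the maps may be taken equivariant ([invariant_lift]).
    An equivariant multilinear map of A is a trace polynomial by P1 and P2 ([invariant_map_expand]),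
    and one supertrace polynomial represents it over all superrings once the degrees of the
    arguments are fixed ([representable_invariant]). So u is a supertrace polynomial in the y's.

    If u is a fixed element of A (x) Xi, the y's are values of rho, and u is rho of the same
    polynomial in [B] ([fixed_rho]). If [rho0 b = 0], the generic element of each homogeneous part
    of b lies in A (x) J and becomes a sum of supertrace polynomials, each linear in an argument
    that stands for 0 in [B]. A supertrace relation between generic elements is an identity of A (x)
    E, hence holds in [B] ([generic_identity]), and this one says that the part is 0 ([xi_inj]).

    The delicate point is to substitute inside traces, because an odd scalar 1 (x) f does not
    supercommute with A (x) F when A has an odd part. By [grading_dichotomy] either A is trivially
    graded, and traces can be moved to the front of a word, or A^(0) = K, and traces of words longer
    than a variable can be eliminated. Linearity of [Trd] comes from homogeneity of the generic
    minimal polynomial ([generic_trace_linear]). *)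

Section GradedAlgebra.
Variables (K : fieldType) (R : gradedAlgType K).
Implicit Types a b : R.

Lemma gmulNl a b : (- a) ** b = - (a ** b).
Proof. by rewrite -scaleN1r gmulZl scaleN1r. Qed.

Lemma gmulNr a b : a ** (- b) = - (a ** b).
Proof. by rewrite -scaleN1r gmulZr scaleN1r. Qed.

Lemma gmulBl a b c : (a - b) ** c = a ** c - b ** c.
Proof. by rewrite gmulDl gmulNl. Qed.

Lemma gmulBr a b c : c ** (a - b) = c ** a - c ** b.
Proof. by rewrite gmulDr gmulNr. Qed.

Lemma gmul_suml_cond (I : Type) (r : seq I) (P : pred I) (G : I -> R) a :
  (\sum_(i <- r | P i) G i) ** a = \sum_(i <- r | P i) G i ** a.
Proof. by rewrite -big_filter gmul_suml big_filter. Qed.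

Lemma gpart0 d : gpart d 0 = 0 :> R. Proof. exact: linear0. Qed.

Lemma gpartD d a b : gpart d (a + b) = gpart d a + gpart d b.
Proof. exact: linearD. Qed.

Lemma gpartZ d c a : gpart d (c *: a) = c *: gpart d a.
Proof. exact: linearZ. Qed.

Lemma gpartB d a b : gpart d (a - b) = gpart d a - gpart d b.
Proof. exact: linearB. Qed.

Lemma gpart_mul_homog d e a b :
  gpart (d (+) e) (gpart d a ** gpart e b) = gpart d a ** gpart e b.
Proof. by apply: gpart_mul; rewrite gpart_proj eqxx. Qed.

Lemma gpart_mulE d a b :
  gpart d (a ** b) = gpart d a ** gpart false b + gpart (~~ d) a ** gpart true b.
Proof.
have pm e f : gpart d (gpart e a ** gpart f b) =
    if d == e (+) f then gpart e a ** gpart f b else 0.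
  by rewrite -gpart_mul_homog gpart_proj.
rewrite -{1}[a]gpart_sum -{1}[b]gpart_sum gmulDl !gmulDr !gpartD !pm.
by case: d {pm}; rewrite /= !(addr0, add0r) // addrC.
Qed.

Lemma gpart_neq d e a : gpart d a = a -> d != e -> gpart e a = 0.
Proof. by move=> <- de; rewrite gpart_proj eq_sym (negbTE de). Qed.

End GradedAlgebra.

Section GradedHom.
Variables (K : fieldType) (R S : gradedAlgType K) (f : R -> S).
Hypothesis fP : graded_hom f.

Lemma ghomP c a b : f (c *: a + b) = c *: f a + f b.
Proof. by case: fP => fl _ _ _; apply: fl. Qed.

Lemma ghom0 : f 0 = 0.
Proof.
have := ghomP (-1) 0 0; rewrite scaleN1r oppr0 addr0 scaleN1r => ->.
exact: addNr.
Qed.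

Lemma ghomD a b : f (a + b) = f a + f b.
Proof. by rewrite -[a]scale1r ghomP !scale1r. Qed.

Lemma ghomZ c a : f (c *: a) = c *: f a.
Proof. by rewrite -[c *: a]addr0 ghomP ghom0 addr0. Qed.

Lemma ghomB a b : f (a - b) = f a - f b.
Proof. by rewrite -scaleN1r ghomD ghomZ scaleN1r. Qed.

Lemma ghom1 : f gone = gone. Proof. by case: fP. Qed.

Lemma ghomM a b : f (a ** b) = f a ** f b. Proof. by case: fP. Qed.

Lemma ghom_part d a : f (gpart d a) = gpart d (f a). Proof. by case: fP. Qed.

Lemma ghom_sum (I : Type) (r : seq I) (P : pred I) (G : I -> R) :
  f (\sum_(i <- r | P i) G i) = \sum_(i <- r | P i) f (G i).
Proof. by apply: (big_morph f ghomD ghom0). Qed.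

End GradedHom.

Lemma graded_hom_comp (K : fieldType) (R S T : gradedAlgType K) (f : R -> S) (g : S -> T) :
  graded_hom f -> graded_hom g -> graded_hom (g \o f).
Proof.
move=> fP gP; split => [c a b||a b|d a] /=.
- by rewrite (ghomP fP) (ghomP gP).
- by rewrite (ghom1 fP) (ghom1 gP).
- by rewrite (ghomM fP) (ghomM gP).
- by rewrite (ghom_part fP) (ghom_part gP).
Qed.

Section TensorBasics.
Variables (K : fieldType) (A : finGradedAlgType K).
Local Notation h := (hdim A).

Lemma hcoordD (k : 'I_h) (a b : A) : hcoord k (a + b) = hcoord k a + hcoord k b.
Proof. by rewrite /hcoord linearD. Qed.

Lemma pure_tensorDl (F : lmodType K) a b (f : F) :
  pure_tensor (A := A) (a + b) f = pure_tensor a f + pure_tensor b f.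
Proof. by apply/ffunP => i; rewrite !ffunE hcoordD scalerDl. Qed.

Lemma pure_tensorZl (F : lmodType K) c a (f : F) :
  pure_tensor (A := A) (c *: a) f = c *: pure_tensor a f.
Proof. by apply/ffunP => i; rewrite !ffunE hcoordZ scalerA. Qed.

Lemma pure_tensorDr (F : lmodType K) a (f g : F) :
  pure_tensor (A := A) a (f + g) = pure_tensor a f + pure_tensor a g.
Proof. by apply/ffunP => i; rewrite !ffunE scalerDr. Qed.

Lemma pure_tensorZr (F : lmodType K) c a (f : F) :
  pure_tensor (A := A) a (c *: f) = c *: pure_tensor a f.
Proof. by apply/ffunP => i; rewrite !ffunE !scalerA mulrC. Qed.

Lemma pure_tensor0l (F : lmodType K) (f : F) : pure_tensor (0 : A) f = 0.
Proof. by rewrite -(scale0r (0 : A)) pure_tensorZl scale0r. Qed.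

Lemma pure_tensor0r (F : lmodType K) (a : A) : pure_tensor a (0 : F) = 0.
Proof. by rewrite -(scale0r (0 : F)) pure_tensorZr scale0r. Qed.

Lemma pure_tensor_suml (F : lmodType K) (I : Type) (r : seq I) (P : pred I) G (f : F) :
  pure_tensor (A := A) (\sum_(i <- r | P i) G i) f = \sum_(i <- r | P i) pure_tensor (G i) f.
Proof.
by apply: (big_morph (fun a => pure_tensor a f)) => [a b|]; rewrite ?pure_tensorDl ?pure_tensor0l.
Qed.

Lemma tensorE (F : lmodType K) (u : tensor A F) : u = \sum_i pure_tensor (hvec i) (u i).
Proof.
apply/ffunP => k; rewrite sum_ffunE (bigD1 k) //= big1 ?addr0 => [|j jk].
  by rewrite ffunE hcoord_basis eqxx scale1r.
by rewrite ffunE hcoord_basis eq_sym (negbTE jk) scale0r.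
Qed.

Lemma tensor_ind (F : lmodType K) (Q : tensor A F -> Prop) :
  Q 0 -> (forall u v, Q u -> Q v -> Q (u + v)) ->
  (forall i f, Q (pure_tensor (hvec i) f)) -> forall u, Q u.
Proof. by move=> Q0 QD Qp u; rewrite [u]tensorE; elim/big_rec: _ => // i v _ Qv; apply: QD. Qed.

Lemma pure_tensorM (F : gradedAlgType K) (a b : A) (f g : F) :
  pure_tensor a f ** pure_tensor b g = pure_tensor (a ** b) (f ** g).
Proof.
rewrite {1}/gmul /= /tensor_mul.
transitivity (\sum_i \sum_j
    pure_tensor (hcoord i a *: hvec i ** (hcoord j b *: hvec j)) (f ** g)).
  apply: eq_bigr => i _; apply: eq_bigr => j _.
  by rewrite !ffunE gmulZl gmulZr !gmulZl !gmulZr !pure_tensorZr !pure_tensorZl.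
rewrite [X in pure_tensor (X ** _)]hcoordE [X in pure_tensor (_ ** X)]hcoordE.
rewrite gmul_suml pure_tensor_suml; apply: eq_bigr => i _.
by rewrite gmul_sumr pure_tensor_suml.
Qed.

Lemma entry_homog (F : gradedAlgType K) d (u : tensor A F) i :
  gpart d u = u -> gpart (d (+) hdeg i) (u i) = u i.
Proof. by move=> ud; rewrite -[in RHS]ud ffunE. Qed.

Lemma tensor1E (F : gradedAlgType K) : gone = pure_tensor gone gone :> tensor A F.
Proof. by []. Qed.

Section Map.
Variables (F F' : gradedAlgType K) (z : F -> F').
Hypothesis zP : graded_hom z.

Lemma tensor_map_pure (a : A) f : tensor_map z (pure_tensor a f) = pure_tensor a (z f).
Proof. by apply/ffunP => i; rewrite !ffunE (ghomZ zP). Qed.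

Lemma tensor_map_hom : graded_hom (@tensor_map K A F F' z).
Proof.
have zl : linear (@tensor_map K A F F' z).
  by move=> c u v; apply/ffunP => i; rewrite !ffunE (ghomP zP).
have z0 : @tensor_map K A F F' z 0 = 0.
  by apply/ffunP => i; rewrite !ffunE (ghom0 zP).
have zD u v : @tensor_map K A F F' z (u + v) = tensor_map z u + tensor_map z v.
  by apply/ffunP => i; rewrite !ffunE (ghomD zP).
split=> // [|u v|d u].
- by rewrite tensor1E tensor_map_pure (ghom1 zP).
- elim/tensor_ind: u => [|u u' IH IH'|i f]; first by rewrite gmul0l z0 gmul0l.
    by rewrite gmulDl !zD IH IH' gmulDl.
  elim/tensor_ind: v => [|v v' IH IH'|j g]; first by rewrite gmul0r z0 gmul0r.
    by rewrite gmulDr !zD IH IH' gmulDr.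
  by rewrite pure_tensorM !tensor_map_pure pure_tensorM (ghomM zP).
- by apply/ffunP => i; rewrite !ffunE (ghom_part zP).
Qed.

End Map.

Lemma tensor_map_comp (F F' F'' : lmodType K) (z : F -> F') (z' : F' -> F'') (u : tensor A F) :
  tensor_map z' (tensor_map z u) = tensor_map (z' \o z) u.
Proof. by apply/ffunP => i; rewrite !ffunE. Qed.

Lemma eq_tensor_map (F F' : lmodType K) (z z' : F -> F') (u : tensor A F) :
  z =1 z' -> tensor_map z u = tensor_map z' u.
Proof. by move=> zz; apply/ffunP => i; rewrite !ffunE zz. Qed.

Lemma tensor_map_id (F : lmodType K) (u : tensor A F) : tensor_map id u = u.
Proof. by apply/ffunP => i; rewrite !ffunE. Qed.

Lemma tensor_act_linear (F : lmodType K) (g : 'End(A)) : linear (@tensor_act K A F g).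
Proof.
move=> c u v; rewrite /tensor_act scaler_sumr -big_split; apply: eq_bigr => i _.
by rewrite !ffunE pure_tensorDr pure_tensorZr.
Qed.

HB.instance Definition _ (F : lmodType K) (g : 'End(A)) :=
  GRing.isLinear.Build K (tensor A F) (tensor A F) *:%R (@tensor_act K A F g)
    (@tensor_act_linear F g).

Lemma tensor_act0 (F : lmodType K) (g : 'End(A)) : tensor_act g (0 : tensor A F) = 0.
Proof. exact: linear0. Qed.

Lemma tensor_actD (F : lmodType K) (g : 'End(A)) (u v : tensor A F) :
  tensor_act g (u + v) = tensor_act g u + tensor_act g v.
Proof. exact: linearD. Qed.

Lemma tensor_act_pure (F : lmodType K) (g : 'End(A)) a (f : F) :
  tensor_act g (pure_tensor a f) = pure_tensor (g a) f.
Proof.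
rewrite /tensor_act {2}[a]hcoordE linear_sum pure_tensor_suml.
by apply: eq_bigr => i _; rewrite ffunE linearZ pure_tensorZl pure_tensorZr.
Qed.

Lemma tensor_act_hom (F : gradedAlgType K) (g : 'End(A)) :
  graded_hom g -> graded_hom (@tensor_act K A F g).
Proof.
move=> gP; split=> [|||d u].
- exact: tensor_act_linear.
- by rewrite tensor1E tensor_act_pure (ghom1 gP).
- move=> u v; elim/tensor_ind: u => [|u u' IH IH'|i f].
  + by rewrite gmul0l !tensor_act0 gmul0l.
  + by rewrite gmulDl !tensor_actD IH IH' gmulDl.
  elim/tensor_ind: v => [|v v' IH IH'|j f'].
  + by rewrite gmul0r !tensor_act0 gmul0r.
  + by rewrite gmulDr !tensor_actD IH IH' gmulDr.
  by rewrite pure_tensorM !tensor_act_pure pure_tensorM (ghomM gP).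
- elim/tensor_ind: u => [|u u' IH IH'|i f]; first by rewrite ?(tensor_act0, linear0).
    by rewrite ?(tensor_actD, linearD) IH IH'.
  have -> : gpart d (pure_tensor (hvec i) f) = pure_tensor (hvec i) (gpart (d (+) hdeg i) f).
    apply/ffunP => j; rewrite !ffunE hcoord_basis.
    by case: (j =P i) => [->|_]; rewrite ?scale1r // !scale0r linear0.
  rewrite !tensor_act_pure.
  have gi : gpart (hdeg i) (g (hvec i)) = g (hvec i) by rewrite -(ghom_part gP) hbasis_homog.
  apply/ffunP => j; rewrite !ffunE -gi hcoord_part.
  by case: eqP => [->|_]; rewrite linearZ /= ?scale0r.
Qed.

Lemma tensor_act_map (F F' : gradedAlgType K) (z : F -> F') (g : 'End(A)) (u : tensor A F) :
  graded_hom z -> tensor_act g (tensor_map z u) = tensor_map z (tensor_act g u).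
Proof.
move=> zP; have zA := tensor_map_hom zP.
elim/tensor_ind: u => [|u u' IH IH'|i f].
- by rewrite (ghom0 zA) !tensor_act0 (ghom0 zA).
- by rewrite !tensor_actD !(ghomD zA) tensor_actD IH IH'.
- by rewrite (tensor_map_pure zP) !tensor_act_pure (tensor_map_pure zP).
Qed.

Lemma tensor_act_comp (F : lmodType K) (g g' : 'End(A)) (u : tensor A F) :
  tensor_act g (tensor_act g' u) = tensor_act (g \o g')%VF u.
Proof.
elim/tensor_ind: u => [|u u' IH IH'|i f]; first by rewrite !tensor_act0.
  by rewrite !tensor_actD IH IH'.
by rewrite !tensor_act_pure lfunE.
Qed.

Lemma tensor_act_id (F : lmodType K) (u : tensor A F) : tensor_act \1%VF u = u.
Proof.
elim/tensor_ind: u => [|u u' IH IH'|i f]; first by rewrite !tensor_act0.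
  by rewrite !tensor_actD IH IH'.
by rewrite tensor_act_pure id_lfunE.
Qed.

End TensorBasics.

Section GradedAut.
Variables (K : fieldType) (A : finGradedAlgType K).
Implicit Types g : 'End(A).

Lemma graded_aut_lker g : graded_aut g -> lker g == 0%VS.
Proof. by case=> _ [g' gK _]; apply/lker0P; apply: can_inj gK. Qed.

Lemma graded_autK g : graded_aut g -> cancel g (g^-1)%VF.
Proof. by move=> /graded_aut_lker gk a; rewrite lker0_lfunK. Qed.

Lemma graded_autVK g : graded_aut g -> cancel (g^-1)%VF g.
Proof. by move=> /graded_aut_lker gk a; rewrite lker0_lfunVK. Qed.

Lemma graded_aut1 : @graded_aut K A \1%VF.
Proof.
split; last by exists id => a; rewrite /= id_lfunE.
by split => [c a b||a b|d a]; rewrite !id_lfunE.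
Qed.

Lemma graded_autV g : graded_aut g -> graded_aut (g^-1)%VF.
Proof.
move=> gP; have gK := graded_autK gP; have gVK := graded_autVK gP.
have gi := can_inj gK; have gh := gP.1.
split; last by exists g.
split => [c a b||a b|d a]; apply: gi.
- by rewrite linearP.
- by rewrite gVK (ghom1 gh).
- by rewrite gVK (ghomM gh) !gVK.
- by rewrite gVK (ghom_part gh) gVK.
Qed.

Lemma graded_autM g g' : graded_aut g -> graded_aut g' -> graded_aut (g \o g')%VF.
Proof.
move=> gP g'P; split.
  have [l1 o1 m1 p1] := graded_hom_comp g'P.1 gP.1.
  split => [c a b||a b|d a]; rewrite !lfunE; [exact: l1|exact: o1|exact: m1|exact: p1].
exists ((g'^-1)%VF \o (g^-1)%VF) => a; rewrite lfunE /=.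
  by rewrite (graded_autK gP) (graded_autK g'P).
by rewrite (graded_autVK g'P) (graded_autVK gP).
Qed.

Lemma graded_autVM g g' : graded_aut g -> graded_aut g' ->
  ((g \o g')^-1 =1 (g'^-1 \o g^-1))%VF.
Proof.
move=> gP g'P a; apply: (can_inj (graded_autK (graded_autM gP g'P))).
by rewrite (graded_autVK (graded_autM gP g'P)) !lfunE /= (graded_autVK g'P) (graded_autVK gP).
Qed.

End GradedAut.

(** * Multilinear maps and words *)

Section Words.
Variable X : Type.

Fixpoint word_vars (w : word X) : seq X :=
  match w with
  | WOne => [::]
  | WVar x => [:: x]
  | WMul w1 w2 => word_vars w1 ++ word_vars w2
  end.

Fixpoint str_word_vars (m : str_word X) : seq X :=
  match m with
  | SOne => [::]
  | SVar x => [:: x]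
  | SMul m1 m2 => str_word_vars m1 ++ str_word_vars m2
  | SStr w => word_vars w
  end.

Fixpoint str_of_word (w : word X) : str_word X :=
  match w with
  | WOne => SOne X
  | WVar x => SVar x
  | WMul w1 w2 => SMul (str_of_word w1) (str_of_word w2)
  end.

Definition list_word (s : seq X) : word X := foldr (fun x => WMul (WVar x)) (WOne X) s.

Lemma list_wordK s : word_vars (list_word s) = s.
Proof. by elim: s => //= x s ->. Qed.

Variables (K : fieldType) (R : gradedAlgType K).

Definition gprod (s : seq X) (f : X -> R) : R := word_eval f (list_word s).

Lemma str_of_wordE (tau : R -> R) (y : X -> R) w :
  str_word_eval tau y (str_of_word w) = word_eval y w.
Proof. by elim: w => //= w1 -> w2 ->. Qed.

Lemma eq_word_eval (y z : X -> R) w : y =1 z -> word_eval y w = word_eval z w.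
Proof. by move=> yz; elim: w => //= w1 -> w2 ->. Qed.

Lemma eq_str_word_eval (tau : R -> R) (y z : X -> R) m : y =1 z ->
  str_word_eval tau y m = str_word_eval tau z m.
Proof.
by move=> yz; elim: m => //= [m1 -> m2 ->|w] //; rewrite (eq_word_eval _ yz).
Qed.

Lemma word_eval_hom (S : gradedAlgType K) (f : R -> S) (y : X -> R) w : graded_hom f ->
  f (word_eval y w) = word_eval (f \o y) w.
Proof.
move=> fP; elim: w => //= [|w1 IH1 w2 IH2]; first exact: ghom1.
by rewrite (ghomM fP) IH1 IH2.
Qed.

Lemma str_word_eval_hom (S : gradedAlgType K) (f : R -> S) (tau : R -> R) (tau' : S -> S)
    (y : X -> R) m : graded_hom f -> (forall a, f (tau a) = tau' (f a)) ->
  f (str_word_eval tau y m) = str_word_eval tau' (f \o y) m.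
Proof.
move=> fP ft; elim: m => //= [|m1 IH1 m2 IH2|w]; first exact: ghom1.
  by rewrite (ghomM fP) IH1 IH2.
by rewrite ft word_eval_hom.
Qed.

Lemma str_poly_eval_hom (S : gradedAlgType K) (f : R -> S) (tau : R -> R) (tau' : S -> S)
    (y : X -> R) p : graded_hom f -> (forall a, f (tau a) = tau' (f a)) ->
  f (str_poly_eval tau y p) = str_poly_eval tau' (f \o y) p.
Proof.
move=> fP ft; rewrite /str_poly_eval (ghom_sum fP); apply: eq_bigr => t _.
by rewrite (ghomZ fP) (str_word_eval_hom _ _ fP ft).
Qed.

Lemma gprod_cons x s (f : X -> R) : gprod (x :: s) f = f x ** gprod s f.
Proof. by []. Qed.

Lemma gprodZ s (c : X -> K) (f : X -> R) :
  gprod s (fun x => c x *: f x) = (\prod_(x <- s) c x) *: gprod s f.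
Proof.
elim: s => [|x s IH]; first by rewrite big_nil scale1r.
by rewrite big_cons !gprod_cons IH gmulZl gmulZr scalerA.
Qed.

Lemma gprod_homog s (d : X -> bool) (f : X -> R) : (forall x, gpart (d x) (f x) = f x) ->
  gpart (\big[addb/false]_(x <- s) d x) (gprod s f) = gprod s f.
Proof.
move=> fd; elim: s => [|x s IH]; first by rewrite big_nil gpart_one.
by rewrite big_cons gprod_cons gpart_mul.
Qed.

Lemma gprod_cat s t (f : X -> R) : associative (@gmul K R) ->
  gprod (s ++ t) f = gprod s f ** gprod t f.
Proof.
by move=> mA; elim: s => [|x s IH] /=; rewrite ?gprod_cons ?IH ?mA // gmul1l.
Qed.

End Words.

(** Moving a letter past a block costs a sign read off from the degrees alone, so one [b] serves all
    superrings and all [f] with these degrees. This uniformity is what allows a single polynomial to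
    represent a map over every [F]. *)
Lemma gprod_perm (K : fieldType) (X : eqType) (d : X -> bool) (s t : seq X) : perm_eq s t ->
  exists b : bool, forall F : gradedAlgType K, superring F -> forall f : X -> F,
    (forall x, gpart (d x) (f x) = f x) -> gprod s f = (-1) ^+ b *: gprod t f.
Proof.
elim: s t => [|x s IH] t.
  by rewrite perm_sym => /perm_nilP ->; exists false => F _ f _; rewrite scale1r.
move=> st; have xt : x \in t by rewrite -(perm_mem st) mem_head.
case/splitPr: xt st => t1 t2.
rewrite perm_sym (perm_catCA t1 [:: x]) /= perm_cons perm_sym => /IH[b bP].
exists (b (+) (d x && \big[addb/false]_(z <- t1) d z)) => F Fs f fd.
have mA := Fs.1; rewrite gprod_cons (bP F Fs f fd) (gprod_cat _ _ _ mA).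
rewrite (gprod_cat _ (x :: _) _ mA) gprod_cons.
rewrite gmulZr !mA signr_addb -scalerA; congr (_ *: _).
have -> := Fs.2 _ _ _ _ (fd x) (gprod_homog t1 fd).
by rewrite gmulZl.
Qed.

Section Multilinear.
Variables (K : fieldType) (X : eqType) (T U : lmodType K).

Definition multilinear (G : (X -> T) -> U) : Prop :=
  forall k c (y y1 y2 : X -> T), y k = c *: y1 k + y2 k ->
    (forall j, j != k -> y j = y1 j /\ y j = y2 j) -> G y = c *: G y1 + G y2.

Lemma multilinear0 G k y : multilinear G -> y k = 0 -> G y = 0.
Proof.
move=> Gl yk; rewrite (Gl k (-1) y y y) ?yk ?scaleN1r ?addNr ?oppr0 ?addr0 //.
Qed.

(** The arguments are expanded one index at a time; [s] lists the indices whose arguments may still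
    be proper sums of elements of [S]. *)
Lemma multilinear_ext G H (S : X -> T -> Prop) (s : seq X) :
  multilinear G -> multilinear H ->
  (forall y, (forall k, S k (y k)) -> G y = H y) ->
  forall y, (forall k, S k (y k) \/
    k \in s /\ exists2 l : seq T, forall a, a \in l -> S k a & y k = \sum_(a <- l) a) ->
  G y = H y.
Proof.
move=> Gl Hl GH; elim: s => [|k s IH] y yS.
  by apply: GH => k; case: (yS k) => // -[].
case: (boolP (k \in s)) => ks.
  by apply: IH => j; case: (yS j) => [|[]]; [left | rewrite inE => /predU1P[->|]; right].
have [Sk|[l lS yl]]: S k (y k) \/ exists2 l : seq T,
    forall a, a \in l -> S k a & y k = \sum_(a <- l) a.
- by case: (yS k) => [|[_ ?]]; [left|right].
- apply: IH => j; case: (j =P k) => [->|/eqP jk]; first by left.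
  by case: (yS j) => [|[]]; [left|rewrite inE (negbTE jk) => ?; right].
have yS' j : j != k -> S j (y j) \/ j \in s /\
    exists2 l : seq T, forall a, a \in l -> S j a & y j = \sum_(a <- l) a.
  by move=> jk; case: (yS j) => [|[]]; [left|rewrite inE (negbTE jk) => ?; right].
move=> {yS}; elim: l y lS yl yS' => [|a l IHl] y lS yl yS'.
  by rewrite !(@multilinear0 _ k y) // yl big_nil.
pose z b j := if j == k then b else y j.
have zk b : z b k = b by rewrite /z eqxx.
have zj b j : j != k -> z b j = y j by rewrite /z => /negbTE ->.
have [Gy Hy]: G y = 1 *: G (z a) + G (z (\sum_(b <- l) b)) /\
    H y = 1 *: H (z a) + H (z (\sum_(b <- l) b)).
  split; [apply: (Gl k)|apply: (Hl k)];
    by rewrite ?zk ?scale1r ?yl ?big_cons // => j jk; rewrite !zj.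
rewrite Gy Hy; congr (_ *: _ + _).
  apply: IH => j; case: (j =P k) => [->|/eqP jk]; first left.
    by rewrite zk; apply: lS; apply: mem_head.
  by rewrite zj //; apply: yS'.
apply: IHl => [b bl||j jk]; rewrite ?zk //; first by apply: lS; rewrite inE bl orbT.
by rewrite zj //; apply: yS'.
Qed.

End Multilinear.

Lemma multilinear_lin (K : fieldType) (X : eqType) (T U W : lmodType K) (f : U -> W)
    (G : (X -> T) -> U) : linear f -> multilinear G -> multilinear (fun y => f (G y)).
Proof. by move=> fl Gl k c y y1 y2 yk yj; rewrite (Gl k c y y1 y2) // fl. Qed.


Section MultilinearWords.
Variables (K : fieldType) (X : eqType) (R : gradedAlgType K) (tau : R -> R).
Hypothesis tau_lin : linear tau.

Lemma word_eval_notin (y z : X -> R) w :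
  (forall x, x \in word_vars w -> y x = z x) -> word_eval y w = word_eval z w.
Proof.
elim: w => //= [x|w1 IH1 w2 IH2] yz; first by rewrite yz ?mem_head.
by rewrite IH1 ?IH2 // => x xw; apply: yz; rewrite mem_cat xw ?orbT.
Qed.

Lemma str_word_eval_notin (y z : X -> R) m :
  (forall x, x \in str_word_vars m -> y x = z x) ->
  str_word_eval tau y m = str_word_eval tau z m.
Proof.
elim: m => //= [x|m1 IH1 m2 IH2|w] yz; first by rewrite yz ?mem_head.
  by rewrite IH1 ?IH2 // => x xw; apply: yz; rewrite mem_cat xw ?orbT.
by rewrite (word_eval_notin yz).
Qed.

Lemma count_cat1 (k : X) (s t : seq X) : count_mem k (s ++ t) = 1%N ->
  count_mem k s = 1%N /\ k \notin t \/ k \notin s /\ count_mem k t = 1%N.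
Proof.
rewrite count_cat -!has_pred1 !has_count.
by case: (count_mem k s) => [|[|n]]; case: (count_mem k t) => [|[|n']] //; [right|left].
Qed.

Lemma notin_neq (k : X) (s : seq X) x : k \notin s -> x \in s -> x != k.
Proof. by move=> ks xs; apply: contraNneq ks => <-. Qed.

Lemma word_eval_lin w k c (y y1 y2 : X -> R) : count_mem k (word_vars w) = 1%N ->
  y k = c *: y1 k + y2 k -> (forall j, j != k -> y j = y1 j /\ y j = y2 j) ->
  word_eval y w = c *: word_eval y1 w + word_eval y2 w.
Proof.
elim: w => //= [x|w1 IH1 w2 IH2]; first by rewrite addn0; case: eqP => // <-.
move=> /count_cat1[[k1 /notin_neq k2]|[/notin_neq k1 k2]] yk yj.
  rewrite IH1 // gmulDl gmulZl; congr (c *: (_ ** _) + _ ** _); apply: word_eval_notin => x xw.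
    by have [] := yj x (k2 x xw).
  by have [] := yj x (k2 x xw).
rewrite IH2 // gmulDr gmulZr; congr (c *: (_ ** _) + _ ** _); apply: word_eval_notin => x xw.
  by have [] := yj x (k1 x xw).
by have [] := yj x (k1 x xw).
Qed.

Lemma str_word_eval_lin m k c (y y1 y2 : X -> R) : count_mem k (str_word_vars m) = 1%N ->
  y k = c *: y1 k + y2 k -> (forall j, j != k -> y j = y1 j /\ y j = y2 j) ->
  str_word_eval tau y m = c *: str_word_eval tau y1 m + str_word_eval tau y2 m.
Proof.
elim: m => //= [x|m1 IH1 m2 IH2|w]; first by rewrite addn0; case: eqP => // <-.
  move=> /count_cat1[[k1 /notin_neq k2]|[/notin_neq k1 k2]] yk yj.
    rewrite IH1 // gmulDl gmulZl.
    congr (c *: (_ ** _) + _ ** _); apply: str_word_eval_notin => x xw.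
      by have [] := yj x (k2 x xw).
    by have [] := yj x (k2 x xw).
  rewrite IH2 // gmulDr gmulZr.
  congr (c *: (_ ** _) + _ ** _); apply: str_word_eval_notin => x xw.
    by have [] := yj x (k1 x xw).
  by have [] := yj x (k1 x xw).
by move=> kw yk yj; rewrite (word_eval_lin kw yk yj) tau_lin.
Qed.

Lemma str_word_multilinear m : (forall k, count_mem k (str_word_vars m) = 1%N) ->
  multilinear (fun y : X -> R => str_word_eval tau y m : R).
Proof. by move=> m1 k c y y1 y2 yk yj; apply: (str_word_eval_lin (m1 k)). Qed.

End MultilinearWords.

Section MultilinearMaps.
Variables (K : fieldType) (A : finGradedAlgType K) (n : nat).
Local Notation h := (hdim A).
Local Notation ix := {ffun 'I_n -> 'I_h}.

(* A multilinear map A^n -> A is given by its values on the basis. *)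
Definition map_eval (phi : ix -> A) (a : 'I_n -> A) : A :=
  \sum_(i : ix) (\prod_k hcoord (i k) (a k)) *: phi i.

(** Entries are multiplied in increasing order of the arguments. This fixed order is the sign
    convention that a polynomial representing [phi] has to match. *)
Definition map_ext (F : gradedAlgType K) (phi : ix -> A) (y : 'I_n -> tensor A F) :
    tensor A F :=
  \sum_(i : ix) pure_tensor (phi i) (gprod (enum 'I_n) (fun k => y k (i k))).

Lemma map_ext_multilinear (F : gradedAlgType K) phi : multilinear (@map_ext F phi).
Proof.
move=> k c y y1 y2 yk yj; rewrite scaler_sumr -big_split; apply: eq_bigr => i _.
rewrite /= -pure_tensorZr -pure_tensorDr; congr pure_tensor.
apply: (@word_eval_lin _ _ _ _ k) => [||j jk].
- by rewrite list_wordK count_uniq_mem ?enum_uniq // mem_enum.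
- by rewrite yk !ffunE.
- by have [e1 e2] := yj j jk; rewrite -e1 -e2.
Qed.

Lemma map_ext_pure (F : gradedAlgType K) phi a (f : 'I_n -> F) :
  map_ext phi (fun k => pure_tensor (a k) (f k)) =
  pure_tensor (map_eval phi a) (gprod (enum 'I_n) f).
Proof.
rewrite pure_tensor_suml; apply: eq_bigr => i _.
rewrite [in LHS]/gprod (@eq_word_eval _ _ _ _ (fun k => hcoord (i k) (a k) *: f k))
  => [|k]; last by rewrite ffunE.
by rewrite -/(gprod _ _) gprodZ big_enum pure_tensorZr pure_tensorZl.
Qed.

Lemma map_eval_multilinear phi : multilinear (map_eval phi).
Proof.
move=> k c y y1 y2 yk yj; rewrite scaler_sumr -big_split; apply: eq_bigr => i _.
rewrite /= scalerA -scalerDl; congr (_ *: _).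
rewrite (bigD1 k) //= [X in _ = c * X + _](bigD1 k) //= [X in _ = _ + X](bigD1 k) //=.
rewrite [X in c * (_ * X)](eq_bigr (fun j => hcoord (i j) (y j))) => [|j /yj[-> //]].
rewrite [X in _ + _ * X](eq_bigr (fun j => hcoord (i j) (y j))) => [|j /yj[_ -> //]].
by rewrite yk hcoordD hcoordZ mulrDl -mulrA.
Qed.

Lemma map_eval_basis phi (i : ix) : map_eval phi (fun k => hvec (i k)) = phi i.
Proof.
rewrite /map_eval (bigD1 i) //= big1 => [|k _]; last by rewrite hcoord_basis eqxx.
rewrite scale1r big1 ?addr0 // => j ji.
have [k jk] : exists k, j k != i k.
  by apply/existsP; apply: contraR ji; rewrite negb_exists => /forallP ji;
     apply/eqP/ffunP => k; have := ji k; rewrite negbK => /eqP.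
by rewrite (bigD1 k) //= hcoord_basis (negbTE jk) mul0r scale0r.
Qed.

Lemma multilinear_basis (U : lmodType K) (G H : ('I_n -> A) -> U) :
  multilinear G -> multilinear H ->
  (forall a, (forall k, exists i, a k = hvec i) -> G a = H a) -> forall a, G a = H a.
Proof.
move=> Gl Hl GH a.
(* Arguments are split into multiples of basis vectors; the scalars are then removed index by index,
   reading a multiple as c w_i + 0. *)
pose S (k : 'I_n) (b : A) := exists c i, b = c *: hvec i :> A.
apply: (@multilinear_ext _ _ _ _ G H S (enum 'I_n)) => // [y yS|k].
  have [s [yl ys]] : exists s : seq 'I_n, (forall k, k \notin s -> exists i, y k = hvec i) /\
     forall k, S k (y k).
    by exists (enum 'I_n); split=> // k; rewrite mem_enum.
  elim: s y {yS} yl ys => [|k s IH] y yl ys; first by apply: GH => k; apply: yl.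
  have [c [i yk]] := ys k.
  pose z b j := if j == k then b else y j.
  have zk b : z b k = b by rewrite /z eqxx.
  have zj b j : j != k -> z b j = y j by rewrite /z => /negbTE ->.
  have [Gy Hy]: G y = c *: G (z (hvec i)) + G (z 0) /\ H y = c *: H (z (hvec i)) + H (z 0).
    split; [apply: (Gl k)|apply: (Hl k)];
      by rewrite ?zk ?yk ?addr0 // => j jk; rewrite !zj.
  rewrite Gy Hy (multilinear0 Gl (zk 0)) (multilinear0 Hl (zk 0)).
  congr (_ *: _ + _); apply: IH => j; case: (j =P k) => [->|/eqP jk].
  - by exists i; rewrite zk.
  - by rewrite zj // => js; apply: yl; rewrite inE negb_or jk.
  - by exists 1, i; rewrite zk scale1r.
  - by rewrite zj.
right; split; first by rewrite mem_enum.
exists [seq hcoord i (a k) *: hvec i | i <- enum 'I_h].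
  by move=> _ /mapP[i _ ->]; exists (hcoord i (a k)), i.
by rewrite big_map big_enum; apply: hcoordE.
Qed.

Lemma homog_entries (F : gradedAlgType K) d (u : tensor A F) : gpart d u = u ->
  exists2 l : seq (tensor A F),
    forall v, v \in l -> exists i f, gpart (d (+) hdeg i) f = f /\ v = pure_tensor (hvec i) f
    & u = \sum_(v <- l) v.
Proof.
move=> ud; exists [seq pure_tensor (hvec i) (u i) | i <- enum 'I_h].
  by move=> _ /mapP[i _ ->]; exists i, (u i); split=> //; apply: entry_homog.
by rewrite big_map big_enum; apply: tensorE.
Qed.

(** The i-th entry of an element of degree [d k] has degree [d k (+) hdeg i], so the element is a
    sum of pure tensors with homogeneous coefficients. *)
Lemma multilinear_homog (F : gradedAlgType K) (U : lmodType K) (d : 'I_n -> bool)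
    (G H : ('I_n -> tensor A F) -> U) : multilinear G -> multilinear H ->
  (forall (i : ix) f y, (forall k, gpart (d k (+) hdeg (i k)) (f k) = f k) ->
     (forall k, y k = pure_tensor (hvec (i k)) (f k)) -> G y = H y) ->
  forall y, (forall k, gpart (d k) (y k) = y k) -> G y = H y.
Proof.
move=> Gl Hl GH y yd.
pose S k (v : tensor A F) :=
  exists i f, gpart (d k (+) hdeg i) f = f /\ v = pure_tensor (hvec i) f.
apply: (@multilinear_ext _ _ _ _ G H S (enum 'I_n)) => // [z zS|k]; last first.
  by right; rewrite mem_enum; split=> //; apply: homog_entries.
have [i iP] := fin_all_exists zS; have [f fP] := fin_all_exists iP.
apply: (GH (finfun i) f z) => k; have [fk zk] := fP k; by rewrite ffunE.
Qed.

End MultilinearMaps.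

(** * The supertrace of A (x) F *)

Section Strd.
Variables (K : fieldType) (A : finGradedAlgType K) (Trd : A -> K).
Hypothesis Trd_lin : scalar Trd.

(** The trace with values in K 1 inside A: it plays the part of [Strd] when the same supertrace
    words are evaluated in A itself. *)
Definition tr1 (a : A) : A := Trd a *: gone.

Lemma TrdD a b : Trd (a + b) = Trd a + Trd b.
Proof. by rewrite -[a]scale1r Trd_lin mul1r scale1r. Qed.

Lemma Trd0 : Trd 0 = 0.
Proof. by have := TrdD 0 0; rewrite addr0 -[LHS]addr0 => /addrI. Qed.

Lemma TrdZ c a : Trd (c *: a) = c * Trd a.
Proof. by rewrite -[c *: a]addr0 Trd_lin Trd0 addr0. Qed.

Lemma TrdB a b : Trd (a - b) = Trd a - Trd b.
Proof. by rewrite TrdD -scaleN1r TrdZ mulN1r. Qed.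

Lemma Trd_sum (I : Type) (r : seq I) (P : pred I) (G : I -> A) :
  Trd (\sum_(i <- r | P i) G i) = \sum_(i <- r | P i) Trd (G i).
Proof. exact: (big_morph Trd TrdD Trd0). Qed.

Section OneRing.
Variable F : gradedAlgType K.
Implicit Types u v : tensor A F.

Lemma Strd_linear : linear (@Strd K A Trd F).
Proof.
move=> c u v; rewrite /Strd -pure_tensorZr -pure_tensorDr; congr pure_tensor.
rewrite scaler_sumr -big_split; apply: eq_bigr => i _ /=.
by rewrite !ffunE scalerDr !scalerA mulrC.
Qed.

Lemma StrdZ c u : Strd Trd (c *: u) = c *: Strd Trd u.
Proof.
have := Strd_linear c u 0; rewrite addr0 => ->.
suff -> : Strd Trd (0 : tensor A F) = 0 by rewrite addr0.
have := Strd_linear (-1) 0 0; rewrite scaler0 addr0 scaleN1r => e.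
by rewrite e addNr.
Qed.

Lemma StrdD u v : Strd Trd (u + v) = Strd Trd u + Strd Trd v.
Proof. by have := Strd_linear 1 u v; rewrite !scale1r. Qed.

Lemma Strd0 : Strd Trd (0 : tensor A F) = 0.
Proof. by have := StrdZ 0 0; rewrite !scale0r. Qed.

Lemma Strd_pure a (f : F) : Strd Trd (pure_tensor a f) = pure_tensor gone (Trd a *: f).
Proof.
rewrite /Strd {2}[a]hcoordE Trd_sum scaler_suml; congr pure_tensor.
by apply: eq_bigr => i _; rewrite ffunE TrdZ scalerA mulrC.
Qed.

Lemma Strd_Strd u : Strd Trd (Strd Trd u) = Trd gone *: Strd Trd u.
Proof. by rewrite {2}/Strd Strd_pure pure_tensorZr. Qed.

Lemma Strd_act (g : 'End(A)) u : g gone = gone -> (forall a, Trd (g a) = Trd a) ->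
  tensor_act g (Strd Trd u) = Strd Trd (tensor_act g u).
Proof.
move=> g1 gT; elim/tensor_ind: u => [|u v IHu IHv|i f].
- by rewrite Strd0 !tensor_act0 Strd0.
- by rewrite StrdD !tensor_actD StrdD IHu IHv.
- by rewrite Strd_pure !tensor_act_pure Strd_pure g1 gT.
Qed.

(** Only even basis vectors have a trace, and 1 is even, so an entry that survives in [Strd] keeps
    its degree. *)
Lemma Strd_part d u : (forall a, Trd (gpart true a) = 0) ->
  gpart d (Strd Trd u) = Strd Trd (gpart d u).
Proof.
move=> T1; have pu a f : gpart d (pure_tensor a f : tensor A F) =
    pure_tensor (gpart false a) (gpart d f) + pure_tensor (gpart true a) (gpart (~~ d) f).
  apply/ffunP => i; rewrite !ffunE !hcoord_part gpartZ.
  by case: (hdeg i); case: d; rewrite /= ?scale0r ?addr0 ?add0r.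
elim/tensor_ind: u => [|u v IHu IHv|i f]; first by rewrite Strd0 !gpart0 Strd0.
  by rewrite StrdD !gpartD StrdD IHu IHv.
rewrite Strd_pure !pu StrdD !Strd_pure T1 scale0r pure_tensor0r addr0.
rewrite -(@gpart_one K A) !gpart_proj /= pure_tensor0l addr0 gpartZ.
congr (pure_tensor _ (_ *: _)).
by rewrite -[in LHS](gpart_sum (hvec i)) TrdD T1 addr0.
Qed.

(** Bracketing and traces concern the factors in A only; in the associative [F] all letters, also
    those under a trace, are multiplied in order of appearance. *)
Lemma str_word_eval_pure X (a : X -> A) (f : X -> F) m : superring F ->
  str_word_eval (@Strd K A Trd F) (fun x => pure_tensor (a x) (f x)) m =
  pure_tensor (str_word_eval tr1 a m) (gprod (str_word_vars m) f).
Proof.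
move=> [mA _].
have wE w : word_eval (fun x => pure_tensor (a x) (f x)) w =
    pure_tensor (word_eval a w) (gprod (word_vars w) f).
  elim: w => //= [x|w1 -> w2 ->]; first by rewrite gprod_cons /gprod /= gmul1r.
  by rewrite pure_tensorM gprod_cat.
elim: m => //= [x|m1 -> m2 ->|w]; first by rewrite gprod_cons /gprod /= gmul1r.
  by rewrite pure_tensorM gprod_cat.
by rewrite wE Strd_pure pure_tensorZl pure_tensorZr.
Qed.

End OneRing.

Lemma Strd_map (F F' : gradedAlgType K) (z : F -> F') (u : tensor A F) : graded_hom z ->
  tensor_map z (Strd Trd u) = Strd Trd (tensor_map z u).
Proof.
move=> zP; rewrite /Strd (tensor_map_pure zP) (ghom_sum zP); congr pure_tensor.
by apply: eq_bigr => i _; rewrite (ghomZ zP) ffunE.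
Qed.

End Strd.

Section Parity.
Variables (K : fieldType) (A : finGradedAlgType K).

Definition parity_fun (a : A) : A := gpart false a - gpart true a.

Lemma parity_fun_linear : linear parity_fun.
Proof. by move=> c a b; rewrite /parity_fun !gpartD !gpartZ scalerBr opprD addrACA. Qed.

HB.instance Definition _ :=
  GRing.isLinear.Build K A A *:%R parity_fun parity_fun_linear.

Definition parity_aut : 'End(A) := linfun parity_fun.

Lemma parity_autE a : parity_aut a = gpart false a - gpart true a.
Proof. by rewrite lfunE. Qed.

(** This automorphism exists because of the grading alone; its invariance makes the trace vanish on
    odd elements ([Trd_odd]). *)
Lemma parity_aut_graded : graded_aut parity_aut.
Proof.
have pK : involutive parity_aut.
  by move=> a; rewrite !parity_autE !gpartB !gpart_proj /= subr0 sub0r opprK gpart_sum.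
split; last by exists parity_aut.
split => [c a b||a b|d a].
- by rewrite linearP.
- by rewrite parity_autE -(@gpart_one K A) !gpart_proj subr0.
- rewrite !parity_autE !gpart_mulE /= gmulBl !gmulBr.
  rewrite !opprD !opprK [X in _ + X = _]addrC addrACA.
  by congr (_ + _); rewrite addrC.
- by rewrite !parity_autE !gpartB !gpart_proj; case: d; rewrite /= ?subr0 ?sub0r.
Qed.

End Parity.

(** * Lifting invariants *)

(** As long as [P] has a vector outside a subspace contained in [P], a line can be added; the
    codimension, bounded by [n], drops each time. *)
Lemma vspace_of_pred (K : fieldType) (V : vectType K) (P : V -> Prop) :
  P 0 -> (forall c u v, P u -> P v -> P (c *: u + v)) ->
  exists U : {vspace V}, forall v, v \in U <-> P v.
Proof.
move=> P0 PD; suff ext n : forall U : {vspace V}, (\dim {:V} - \dim U <= n)%N ->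
    (forall v, v \in U -> P v) -> exists U : {vspace V}, forall v, v \in U <-> P v.
  apply: (ext _ 0%VS (leqnn _)) => v; by rewrite memv0 => /eqP ->.
elim: n => [|n IH] U dU UP.
  exists U => v; split; first exact: UP.
  suff /eqP -> : U == fullv by rewrite memvf.
  by rewrite eqEdim subvf -subn_eq0 -leqn0.
case: (EM (exists2 v, P v & v \notin U)) => [[v Pv vU]|no]; last first.
  exists U => v; split; first exact: UP.
  by move=> Pv; apply: contrapT => /negP vU; apply: no; exists v.
apply: (IH (U + <[v]>)%VS) => [|w /memv_addP[u uU [x /vlineP[c ->] ->]]]; last first.
  by rewrite addrC; apply: PD => //; apply: UP.
have dx : (U :&: <[v]> = 0)%VS.
  apply/eqP; rewrite -subv0; apply/subvP => w; rewrite memv_cap memv0.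
  case/andP=> wU /vlineP[c wE]; case: (eqVneq c 0) => [c0|c0].
    by rewrite wE c0 scale0r.
  by move: wU; rewrite wE rpredZeq (negbTE c0) (negbTE vU).
rewrite dimv_disjoint_sum // dim_vline.
have -> : v != 0 by apply: contraNneq vU => ->; rewrite mem0v.
by rewrite addn1 subnS -subn1 leq_subLR add1n.
Qed.

Section Reductive.
Variables (K : fieldType) (A : finGradedAlgType K).
Local Notation h := (hdim A).

(** Take for [w] the component of [v] in a stable complement W of [U]. Then [rho g w - w] lies in W,
    and also in [U] because [v] is fixed modulo the stable [U]. *)
Lemma reductive_lift (V : vectType K) (rho : 'End(A) -> 'End(V)) (U : {vspace V}) v :
  condP3 A -> rational_rep rho -> stable_subspace rho U ->
  (forall g, graded_aut g -> rho g v - v \in U) ->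
  exists2 w, forall g, graded_aut g -> rho g w = w & v - w \in U.
Proof.
move=> P3 rhoP Ust vU; have [W [Wst UW UW0]] := P3 V rho rhoP U Ust.
have: v \in (U + W)%VS by rewrite UW memvf.
case/memv_addP=> u uU [w wW vE]; exists w; last by rewrite vE addrK.
move=> g gP; apply/eqP; rewrite -subr_eq0 -memv0 -UW0 memv_cap; apply/andP; split.
  have := vU g gP; rewrite vE linearD /= opprD addrACA rpredDl //.
  by rewrite memvB // (subvP (Ust g gP)) // memv_img.
by rewrite memvB // (subvP (Wst g gP)) // memv_img.
Qed.

(** Equality with a regular function is asked on automorphisms only, since the formula for the
    entries of an inverse holds only for invertible maps. *)
Definition regular_on_aut (f : 'End(A) -> K) : Prop :=
  exists2 f', regular_fun f' & forall g, graded_aut g -> f g = f' g.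

Lemma regular_const c : regular_on_aut (fun=> c).
Proof. by exists (fun=> c) => //; apply: FunAlgConst. Qed.

Lemma regular_add f f' : regular_on_aut f -> regular_on_aut f' ->
  regular_on_aut (fun g => f g + f' g).
Proof.
move=> [k kr fk] [k' kr' fk']; exists (fun g => k g + k' g); first exact: FunAlgAdd.
by move=> g gP; rewrite fk // fk'.
Qed.

Lemma regular_mul f f' : regular_on_aut f -> regular_on_aut f' ->
  regular_on_aut (fun g => f g * f' g).
Proof.
move=> [k kr fk] [k' kr' fk']; exists (fun g => k g * k' g); first exact: FunAlgMul.
by move=> g gP; rewrite fk // fk'.
Qed.

Lemma regular_ext f f' : regular_on_aut f -> (forall g, graded_aut g -> f' g = f g) ->
  regular_on_aut f'.
Proof. by move=> [k kr fk] ff; exists k => // g gP; rewrite ff // fk. Qed.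

Lemma regular_sum (I : Type) (r : seq I) (P : pred I) (f : I -> 'End(A) -> K) :
  (forall i, P i -> regular_on_aut (f i)) ->
  regular_on_aut (fun g => \sum_(i <- r | P i) f i g).
Proof.
move=> fr; elim: r => [|i r IH].
  by apply: (regular_ext (regular_const 0)) => g _; rewrite big_nil.
case Pi: (P i); last by apply: (regular_ext IH) => g _; rewrite big_cons Pi.
by apply: (regular_ext (regular_add (fr i Pi) IH)) => g _; rewrite big_cons Pi.
Qed.

Lemma regular_prod (I : Type) (r : seq I) (P : pred I) (f : I -> 'End(A) -> K) :
  (forall i, P i -> regular_on_aut (f i)) ->
  regular_on_aut (fun g => \prod_(i <- r | P i) f i g).
Proof.
move=> fr; elim: r => [|i r IH].
  by apply: (regular_ext (regular_const 1)) => g _; rewrite big_nil.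
case Pi: (P i); last by apply: (regular_ext IH) => g _; rewrite big_cons Pi.
by apply: (regular_ext (regular_mul (fr i Pi) IH)) => g _; rewrite big_cons Pi.
Qed.

Lemma regular_entry i j : regular_on_aut (fun g : 'End(A) => end_mx g i j).
Proof.
by exists (fun g : 'End(A) => end_mx g i j) => //; apply: FunAlgIn; left; exists i, j.
Qed.

Lemma regular_det n (M : 'End(A) -> 'M[K]_n) :
  (forall i j, regular_on_aut (fun g => M g i j)) -> regular_on_aut (fun g => \det (M g)).
Proof.
move=> Mr; apply: regular_sum => s _; apply: regular_mul; first exact: regular_const.
by apply: regular_prod => i _.
Qed.

Lemma hcoord_end (g : 'End(A)) i a : hcoord i (g a) = \sum_j end_mx g i j * hcoord j a.
Proof.
rewrite {1}[a]hcoordE linear_sum hcoord_sum; apply: eq_bigr => j _.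
by rewrite linearZ /= hcoordZ mxE mulrC.
Qed.

Lemma end_mxM (g g' : 'End(A)) : end_mx (g \o g')%VF = end_mx g *m end_mx g'.
Proof.
apply/matrixP => i j; rewrite !mxE lfunE /= hcoord_end.
by apply: eq_bigr => k _; rewrite !mxE.
Qed.

Lemma end_mxV (g : 'End(A)) : graded_aut g ->
  end_mx (g^-1)%VF = (\det (end_mx g))^-1 *: \adj (end_mx g).
Proof.
move=> gP; have: end_mx g *m end_mx (g^-1)%VF = 1%:M.
  rewrite -end_mxM; apply/matrixP => i j; rewrite !mxE lfunE /= (graded_autVK gP).
  by rewrite hcoord_basis.
move=> e1; have [gu _] := mulmx1_unit e1.
have := congr1 (mulmx (invmx (end_mx g))) e1.
by rewrite mulmxA mulVmx // mul1mx mulmx1 /invmx gu.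
Qed.

(** Cramer's rule: a cofactor is a polynomial in the entries, and the inverse determinant is one of
    the generating regular functions. *)
Lemma regular_entryV i j : regular_on_aut (fun g : 'End(A) => end_mx (g^-1)%VF i j).
Proof.
apply: (@regular_ext (fun g : 'End(A) => (\det (end_mx g))^-1 * \adj (end_mx g) i j)); last first.
  by move=> g gP; rewrite end_mxV // mxE.
apply: regular_mul.
  by exists (fun g : 'End(A) => (\det (end_mx g))^-1) => //; apply: FunAlgIn; right.
apply: (@regular_ext (fun g : 'End(A) => (-1) ^+ (j + i) * \det (row' j (col' i (end_mx g))))).
  apply: regular_mul; first exact: regular_const.
  by apply: regular_det => k l; apply: (regular_ext (regular_entry _ _)) => g _; rewrite !mxE.
by move=> g _; rewrite mxE.
Qed.

Lemma multilinear_comp (X : eqType) (T T' U : lmodType K) (f : X -> T' -> T)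
    (G : (X -> T) -> U) :
  (forall k, linear (f k)) -> multilinear G -> multilinear (fun y => G (fun k => f k (y k))).
Proof.
move=> fl Gl k c y y1 y2 yk yj; apply: (Gl k); first by rewrite yk fl.
by move=> j jk; have [e1 e2] := yj j jk; rewrite -e1 -e2.
Qed.

(** * Conjugation on tuples of multilinear maps *)

Section Conjugation.
Variables (r n : nat).
Local Notation ix := {ffun 'I_n -> 'I_h}.
Local Notation V := {ffun 'I_r * ix -> A}.

(* r-tuples of multilinear maps A^n -> A, on which g acts by g o phi o g^-1. *)
Definition conj_fun (g : 'End(A)) (v : V) : V :=
  [ffun p : 'I_r * ix =>
     g (map_eval (fun i => v (p.1, i)) (fun k => (g^-1)%VF (hvec (p.2 k))))].

Lemma conj_fun_linear g : linear (conj_fun g).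
Proof.
move=> c u v; apply/ffunP => p; rewrite !ffunE -linearP; congr (fun_of_lfun g _).
rewrite /map_eval scaler_sumr -big_split; apply: eq_bigr => i _ /=.
by rewrite !ffunE scalerDr !scalerA mulrC.
Qed.

HB.instance Definition _ g := GRing.isLinear.Build K V V *:%R (conj_fun g) (conj_fun_linear g).

Definition conj_rep (g : 'End(A)) : 'End(V) := linfun (conj_fun g).

Lemma conj_repE g v s i : conj_rep g v (s, i) =
  g (map_eval (fun i => v (s, i)) (fun k => (g^-1)%VF (hvec (i k)))).
Proof. by rewrite lfunE /= ffunE. Qed.

Lemma map_eval_conj g v s a : graded_aut g ->
  map_eval (fun i => conj_rep g v (s, i)) a =
  g (map_eval (fun i => v (s, i)) (fun k => (g^-1)%VF (a k))).
Proof.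
move=> gP; move: a; apply: multilinear_basis.
- exact: map_eval_multilinear.
- apply: (@multilinear_lin _ _ _ _ _ g); first by move=> c x y; rewrite linearP.
  apply: (multilinear_comp (f := fun=> (g^-1)%VF)) (@map_eval_multilinear _ _ _ _).
  by move=> k c x y; rewrite linearP.
move=> a /fin_all_exists[i ai].
transitivity (map_eval (fun i => conj_rep g v (s, i)) (fun k => hvec (finfun i k))).
  by apply: eq_bigr => j _; congr (_ *: _); apply: eq_bigr => k _; rewrite ffunE ai.
rewrite map_eval_basis conj_repE; congr (fun_of_lfun g _).
by apply: eq_bigr => j _; congr (_ *: _); apply: eq_bigr => k _; rewrite ffunE ai.
Qed.

Lemma eq_map_eval (phi psi : ix -> A) a b : phi =1 psi -> a =1 b ->
  map_eval phi a = map_eval psi b.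
Proof.
move=> pp ab; apply: eq_bigr => i _; rewrite pp; congr (_ *: _).
by apply: eq_bigr => k _; rewrite ab.
Qed.

(** The coordinates of [conj_rep g v] are polynomials in the entries of g and of its inverse, and a
    linear form is a combination of coordinates. *)
Lemma conj_rep_rational : rational_rep conj_rep.
Proof.
split.
- apply/lfunP => v; apply/ffunP => -[s i]; rewrite conj_repE !id_lfunE.
  rewrite (@eq_map_eval _ (fun i => v (s, i)) _ (fun k => hvec (i k))) ?map_eval_basis //.
  move=> k; apply: (can_inj (graded_autK (graded_aut1 A))).
  by rewrite (graded_autVK (graded_aut1 A)) id_lfunE.
- move=> g g' gP g'P; apply/lfunP => v; apply/ffunP => -[s i].
  rewrite (comp_lfunE (conj_rep g)) !conj_repE (comp_lfunE g); congr (fun_of_lfun g _).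
  rewrite map_eval_conj //; congr (fun_of_lfun g' _).
  by apply: eq_map_eval => // k; rewrite (graded_autVM gP g'P).
move=> phi v.
pose e p a : V := [ffun q => if q == p then a else 0].
have vE (x : V) : x = \sum_p \sum_l hcoord l (x p) *: e p (hvec l).
  apply/ffunP => q; rewrite sum_ffunE (bigD1 q) //= [X in _ + X]big1 => [|p pq].
    by rewrite addr0 sum_ffunE [LHS]hcoordE; apply: eq_bigr => l _; rewrite !ffunE eqxx.
  rewrite sum_ffunE big1 // => l _.
  by rewrite !ffunE eq_sym (negbTE pq) scaler0.
apply: (@regular_ext (fun g => \sum_p \sum_l hcoord l (conj_rep g v p) * phi (e p (hvec l)))).
  apply: regular_sum => -[s i] _; apply: regular_sum => l _.
  apply: regular_mul; last exact: regular_const.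
  apply: (@regular_ext (fun g : 'End(A) => \sum_m end_mx g l m *
     \sum_(j : ix) (\prod_k \sum_o end_mx (g^-1)%VF (j k) o * hcoord o (hvec (i k))) *
       hcoord m (v (s, j)))).
    apply: regular_sum => m _; apply: regular_mul; first exact: regular_entry.
    apply: regular_sum => j _; apply: regular_mul; last exact: regular_const.
    apply: regular_prod => k _; apply: regular_sum => o _.
    by apply: regular_mul; [apply: regular_entryV|apply: regular_const].
  move=> g _; rewrite conj_repE hcoord_end; apply: eq_bigr => m _; congr (_ * _).
  rewrite /map_eval /hcoord linear_sum /=; apply: eq_bigr => j _.
  rewrite linearZ /=; congr (_ * _); apply: eq_bigr => k _; exact: hcoord_end.
move=> g _; rewrite {1}[conj_rep g v]vE linear_sum; apply: eq_bigr => p _.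
by rewrite linear_sum; apply: eq_bigr => l _; rewrite linearZ.
Qed.

Section Lift.
Variables (F : gradedAlgType K) (d : 'I_r -> 'I_n -> bool) (y : 'I_r -> 'I_n -> tensor A F).
Hypothesis yd : forall s k, gpart (d s k) (y s k) = y s k.

Definition tuple_ext (v : V) : tensor A F := \sum_s map_ext (fun i => v (s, i)) (y s).

Lemma tuple_ext_linear c u v : tuple_ext (c *: u + v) = c *: tuple_ext u + tuple_ext v.
Proof.
rewrite /tuple_ext scaler_sumr -big_split; apply: eq_bigr => s _ /=.
rewrite /map_ext scaler_sumr -big_split; apply: eq_bigr => i _ /=.
by rewrite !ffunE pure_tensorDl pure_tensorZl.
Qed.

Lemma map_ext_map (F' : gradedAlgType K) (z : F -> F') (phi : ix -> A) (x : 'I_n -> tensor A F) :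
  graded_hom z -> map_ext phi (fun k => tensor_map z (x k)) = tensor_map z (map_ext phi x).
Proof.
move=> zP; rewrite /map_ext (ghom_sum (tensor_map_hom A zP)); apply: eq_bigr => i _.
rewrite (tensor_map_pure zP); congr pure_tensor; rewrite /gprod (word_eval_hom _ _ zP).
by apply: eq_word_eval => k; rewrite ffunE.
Qed.

Lemma map_ext_conj (g : 'End(A)) v s : graded_aut g ->
  map_ext (fun i => conj_rep g v (s, i)) (y s) =
  tensor_act g (map_ext (fun i => v (s, i)) (fun k => tensor_act (g^-1)%VF (y s k))).
Proof.
move=> gP; move: (y s) (yd s); apply: (@multilinear_homog K A n F _ (d s)).
- exact: map_ext_multilinear.
- apply: (@multilinear_lin _ _ _ _ _ (@tensor_act K A F g)); first exact: tensor_act_linear.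
  apply: (multilinear_comp (f := fun=> @tensor_act K A F (g^-1)%VF)).
    by move=> k; apply: tensor_act_linear.
  exact: map_ext_multilinear.
move=> i f x _ xE.
transitivity (map_ext (fun i => conj_rep g v (s, i)) (fun k => pure_tensor (hvec (i k)) (f k))).
  by apply: eq_bigr => j _; congr pure_tensor; apply: eq_word_eval => k; rewrite xE.
rewrite map_ext_pure map_eval_basis conj_repE.
rewrite -tensor_act_pure -map_ext_pure; congr tensor_act.
apply: eq_bigr => j _; congr pure_tensor; apply: eq_word_eval => k.
by rewrite xE tensor_act_pure.
Qed.

(** Let U be the kernel of [tuple_ext]. Transforming a tuple [u] by g changes its value to g(z(value
    of u)), where z realises the inverse of g on the arguments. Hence U is stable. For [u = v] the
    two actions cancel, so [v] is fixed modulo U and [reductive_lift] applies. *)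
Lemma invariant_lift v : condP3 A ->
  (forall g, graded_aut g -> exists z : F -> F, [/\ graded_hom z,
     forall s k, tensor_map z (y s k) = tensor_act g (y s k)
     & tensor_map z (tuple_ext v) = tensor_act g (tuple_ext v)]) ->
  exists2 w, forall g, graded_aut g -> conj_rep g w = w & tuple_ext w = tuple_ext v.
Proof.
move=> P3 zP; have [|c u w u0 w0|U UP] := @vspace_of_pred K V (fun v => tuple_ext v = 0).
- by have := tuple_ext_linear (-1) 0 0; rewrite scaler0 addr0 scaleN1r addNr.
- by rewrite tuple_ext_linear u0 w0 scaler0 addr0.
have conj_ext g u : graded_aut g -> exists z : F -> F, [/\ graded_hom z,
    tensor_map z (tuple_ext v) = tensor_act (g^-1)%VF (tuple_ext v)
    & tuple_ext (conj_rep g u) = tensor_act g (tensor_map z (tuple_ext u))].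
  (* The inverse is used here: conjugation lets it act on the arguments, and there it can be
     replaced by a homomorphism acting on entries. *)
  move=> gP; have [z [zh zy zu]] := zP _ (graded_autV gP); exists z; split=> //.
  rewrite /tuple_ext (ghom_sum (tensor_map_hom A zh)) linear_sum; apply: eq_bigr => s _.
  rewrite map_ext_conj //; congr tensor_act; rewrite -map_ext_map //.
  by apply: eq_bigr => j _; congr pure_tensor; apply: eq_word_eval => k; rewrite zy.
have [|g gP|w winv vw] := @reductive_lift V conj_rep U v P3 conj_rep_rational.
- move=> g gP; apply/subvP => _ /memv_imgP[u /UP u0 ->]; apply/UP.
  have [z [zh _ ->]] := conj_ext g u gP.
  by rewrite u0 (ghom0 (tensor_map_hom A zh)) tensor_act0.
- apply/UP; have [z [zh zu e]] := conj_ext g v gP.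
  have -> : conj_rep g v - v = (-1) *: v + conj_rep g v by rewrite scaleN1r addrC.
  rewrite tuple_ext_linear scaleN1r e zu tensor_act_comp.
  have -> : (g \o g^-1)%VF = \1%VF by apply/lfunP => a; rewrite lfunE id_lfunE /= graded_autVK.
  by rewrite tensor_act_id addNr.
exists w => //; have := UP (v - w); rewrite vw => -[/(_ isT) + _].
have -> : v - w = (-1) *: w + v by rewrite scaleN1r addrC.
by rewrite tuple_ext_linear scaleN1r addrC => /eqP; rewrite subr_eq0 => /eqP.
Qed.

End Lift.
End Conjugation.
End Reductive.

(** * Invariant multilinear maps are trace polynomials *)

Section InfiniteField.
Variables (K : fieldType) (charK : [pchar K] =i pred0).

(** In characteristic 0 the integers below [size p] give more distinct roots than a nonzero [p] can
    have. *)
Lemma poly_eq0_values (p : {poly K}) : (forall c, p.[c] = 0) -> p = 0.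
Proof.
move=> p0; apply/eqP/negPn/negP => pn0.
pose rs := [seq i%:R : K | i <- iota 0 (size p)].
have := @max_poly_roots K p rs pn0; rewrite size_map size_iota ltnn => H.
suff: false by []; apply: H; first by apply/allP => c _; apply/eqP/p0.
rewrite map_inj_uniq ?iota_uniq // => i j; wlog: i j / (i <= j)%N => [W|ij] /eqP.
  by case/orP: (leq_total i j) => ij /eqP e; [apply: W | apply/esym/W].
rewrite eq_sym -subr_eq0 -natrB // ((pcharf0P K).1 charK) subn_eq0 => ji.
by apply/eqP; rewrite eqn_leq ij ji.
Qed.

(** Both sides are polynomials in c, and their linear coefficients are compared. This picks out the
    terms of degree one from a sum of homogeneous terms. *)
Lemma coef1_values (T : Type) (s : seq T) (v : T -> K) (e : T -> nat) (w : K) :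
  (forall c, \sum_(t <- s) c ^+ e t * v t = c * w) ->
  \sum_(t <- s | e t == 1%N) v t = w.
Proof.
move=> vw; pose p : {poly K} := \sum_(t <- s) v t *: 'X^(e t) - w *: 'X.
have p0 : p = 0.
  apply: poly_eq0_values => c; rewrite /p hornerD hornerN hornerZ hornerX.
  rewrite horner_sum [w * c]mulrC -vw; apply/eqP; rewrite subr_eq0; apply/eqP.
  by apply: eq_bigr => t _; rewrite hornerZ hornerXn mulrC.
have := congr1 (fun q : {poly K} => q`_1) p0.
rewrite coef0 /p coefB coefZ coefX mulr1 coef_sum => /eqP; rewrite subr_eq0 => /eqP <-.
rewrite big_mkcond; apply: eq_bigr => t _.
by rewrite coefZ coefXn eq_sym; case: eqP; rewrite ?mulr1 ?mulr0.
Qed.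

End InfiniteField.

Section FunAlg.
Variables (K : fieldType) (T : Type) (S : (T -> K) -> Prop).

Lemma fun_alg_sum (I : Type) (r : seq I) (P : pred I) (f : I -> T -> K) :
  (forall i, P i -> fun_alg S (f i)) -> fun_alg S (fun x => \sum_(i <- r | P i) f i x).
Proof.
move=> fr; elim: r => [|i r IH].
  by apply: (FunAlgExt (FunAlgConst S 0)) => x; rewrite big_nil.
case Pi: (P i); last by apply: (FunAlgExt IH) => x; rewrite big_cons Pi.
by apply: (FunAlgExt (FunAlgAdd (fr i Pi) IH)) => x; rewrite big_cons Pi.
Qed.

Lemma fun_alg_prod (I : Type) (r : seq I) (P : pred I) (f : I -> T -> K) :
  (forall i, P i -> fun_alg S (f i)) -> fun_alg S (fun x => \prod_(i <- r | P i) f i x).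
Proof.
move=> fr; elim: r => [|i r IH].
  by apply: (FunAlgExt (FunAlgConst S 1)) => x; rewrite big_nil.
case Pi: (P i); last by apply: (FunAlgExt IH) => x; rewrite big_cons Pi.
by apply: (FunAlgExt (FunAlgMul (fr i Pi) IH)) => x; rewrite big_cons Pi.
Qed.

End FunAlg.

Section WordMap.
Variables (X Y : Type) (r : X -> option Y).

Fixpoint word_map (w : word X) : word Y :=
  match w with
  | WOne => WOne Y
  | WVar x => if r x is Some y then WVar y else WOne Y
  | WMul w1 w2 => WMul (word_map w1) (word_map w2)
  end.

Lemma word_map_vars w : word_vars (word_map w) = pmap r (word_vars w).
Proof.
elim: w => //= [x|w1 -> w2 ->]; first by case: (r x).
by rewrite pmap_cat.
Qed.

Lemma word_map_eval (K : fieldType) (R : gradedAlgType K) (s : Y -> R) w :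
  word_eval s (word_map w) = word_eval (fun x => if r x is Some y then s y else gone) w.
Proof. by elim: w => //= [x|w1 -> w2 ->] //; case: (r x). Qed.

End WordMap.

Section TraceExpansion.
Variables (K : fieldType) (charK : [pchar K] =i pred0) (A : finGradedAlgType K) (Trd : A -> K).
Hypotheses (Trd_lin : scalar Trd) (Trd_trace : is_trace Trd).
Hypotheses (P1 : condP1 Trd) (P2 : condP2 Trd).
Local Notation h := (hdim A).

Definition tmon X (u : X -> A) (l : seq (word X)) : K := \prod_(w <- l) Trd (word_eval u w).

Definition tmon_vars X (l : seq (word X)) : seq X := flatten [seq word_vars w | w <- l].

Lemma trace_fun_expand k (f : ('I_k -> A) -> K) : trace_fun Trd f ->
  exists p : seq (K * seq (word 'I_k)), forall u, f u = \sum_(t <- p) t.1 * tmon u t.2.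
Proof.
elim=> {f} [f [q ->]|c|f g _ [p fE] _ [q gE]|f g _ [p fE] _ [q gE]|f g _ [p fE] fg].
- exists [seq (t.1, [:: t.2]) | t <- q] => u.
  rewrite big_map /npoly_eval (Trd_sum Trd_lin); apply: eq_bigr => t _.
  by rewrite (TrdZ Trd_lin) /tmon big_seq1.
- by exists [:: (c, [::])] => u; rewrite big_seq1 /tmon big_nil mulr1.
- by exists (p ++ q) => u; rewrite big_cat fE gE.
- exists [seq (t.1 * t'.1, t.2 ++ t'.2) | t <- p, t' <- q] => u.
  rewrite fE gE big_allpairs_dep big_distrl; apply: eq_bigr => t _.
  rewrite big_distrr; apply: eq_bigr => t' _ /=.
  by rewrite /tmon big_cat mulrACA.
- by exists p => u; rewrite -fg fE.
Qed.

Lemma word_eval_scale (X : eqType) (u v : X -> A) k c w :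
  v k = c *: u k -> (forall j, j != k -> v j = u j) ->
  word_eval v w = c ^+ count_mem k (word_vars w) *: word_eval u w.
Proof.
move=> vk vj; elim: w => [|x|w1 IH1 w2 IH2] /=; first by rewrite scale1r.
  by case: (x =P k) => [->|/eqP xk]; rewrite ?vk // vj // scale1r.
by rewrite IH1 IH2 gmulZl gmulZr scalerA count_cat exprD.
Qed.

Lemma tmon_scale (X : eqType) (u v : X -> A) k c l :
  v k = c *: u k -> (forall j, j != k -> v j = u j) ->
  tmon v l = c ^+ count_mem k (tmon_vars l) * tmon u l.
Proof.
move=> vk vj; elim: l => [|w l IH]; first by rewrite /tmon !big_nil mulr1.
rewrite /tmon !big_cons -/(tmon v l) IH (word_eval_scale w vk vj) (TrdZ Trd_lin).
by rewrite /tmon_vars /= count_cat exprD mulrACA.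
Qed.

(** Scaling one argument by c scales [f] by c and a trace monomial by a power of c, so the monomials
    of degree one in this argument already add up to [f]. The list [s] holds the arguments treated
    so far. *)
Lemma multilinear_trace_expand k (f : ('I_k -> A) -> K^o) (s : seq 'I_k) :
  multilinear f -> trace_fun Trd f ->
  exists p : seq (K * seq (word 'I_k)), forall u,
    f u = \sum_(t <- p | all (fun j => count_mem j (tmon_vars t.2) == 1%N) s) t.1 * tmon u t.2.
Proof.
move=> fl /trace_fun_expand[p pE]; exists p; elim: s => [|k0 s IH] u.
  by rewrite pE; apply: eq_bigl.
rewrite (eq_bigl (fun t => all (fun j => count_mem j (tmon_vars t.2) == 1%N) s &&
  (count_mem k0 (tmon_vars t.2) == 1%N))) => [|t]; last by rewrite andbC.
rewrite -big_filter_cond; symmetry; apply: (coef1_values charK) => c.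
pose v j := if j == k0 then c *: u j else u j.
have vk : v k0 = c *: u k0 by rewrite /v eqxx.
have vj j : j != k0 -> v j = u j by rewrite /v => /negbTE ->.
have -> : c * f u = f v.
  pose v0 j := if j == k0 then 0 else u j.
  rewrite (fl k0 c v u v0) ?vk /v0 ?eqxx ?addr0 //; last first.
    by move=> j jk; rewrite vj // (negbTE jk).
  by rewrite (@multilinear0 _ _ _ _ f k0 v0) ?/v0 ?eqxx // addr0.
rewrite IH big_filter; apply: eq_bigr => t _.
by rewrite (tmon_scale _ vk vj) mulrCA.
Qed.

Lemma Trd_comm a b : Trd (a ** b) = Trd (b ** a).
Proof.
by have := Trd_trace.1 a b; rewrite (TrdB Trd_lin) => /eqP; rewrite subr_eq0 => /eqP.
Qed.

Lemma Trd_assoc a b c : Trd (a ** b ** c) = Trd (a ** (b ** c)).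
Proof.
by have := Trd_trace.2 a b c; rewrite (TrdB Trd_lin) => /eqP; rewrite subr_eq0 => /eqP.
Qed.

(* An associative trace form lets one move any letter out of a word. *)
Lemma word_trace_isolate (X : eqType) (z : X) (w w0 : word X) :
  count_mem z (word_vars w) = 1%N ->
  exists2 w' : word X, perm_eq (z :: word_vars w') (word_vars w0 ++ word_vars w)
    & forall u : X -> A, Trd (word_eval u w0 ** word_eval u w) = Trd (word_eval u w' ** u z).
Proof.
elim: w w0 => // [x|w1 IH1 w2 IH2] w0 /=.
  rewrite addn0; case: eqP => // -> _; exists w0 => //.
  by rewrite -cat1s perm_catC.
case/count_cat1=> -[z1 z2].
  (* Trd(w0 (w1 w2)) = Trd((w2 w0) w1), so the factor free of [z] is absorbed into the prefix. *)
  have [w' w'p w'E] := IH1 (WMul w2 w0) z1; exists w' => [|u].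
    by rewrite (perm_trans w'p) //= -catA perm_catC -catA perm_refl.
  by rewrite -w'E /= [LHS]Trd_comm Trd_assoc [LHS]Trd_comm.
have [w' w'p w'E] := IH2 (WMul w0 w1) z2; exists w' => [|u].
  by rewrite (perm_trans w'p) //= catA.
by rewrite -w'E /= Trd_assoc.
Qed.

Lemma tmon_isolate (X : eqType) (z : X) (l : seq (word X)) :
  count_mem z (tmon_vars l) = 1%N ->
  exists l' w, perm_eq (z :: tmon_vars l' ++ word_vars w) (tmon_vars l) /\
    forall u : X -> A, tmon u l = tmon u l' * Trd (word_eval u w ** u z).
Proof.
elim: l => // w l IH; rewrite /tmon_vars /= -/(tmon_vars l) => /count_cat1[[zw zl]|[zw zl]].
  have [w' w'p w'E] := word_trace_isolate (WOne X) zw; exists l, w'; split=> [|u].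
    apply: (@perm_trans _ ((z :: word_vars w') ++ tmon_vars l)); last by rewrite perm_cat2r.
    by rewrite /= perm_cons perm_catC.
  by rewrite /tmon big_cons -w'E /= gmul1l mulrC.
have [l' [w' [p E]]] := IH zl; exists (w :: l'), w'; split=> [|u].
  rewrite /tmon_vars /= -/(tmon_vars l') -catA -cat1s.
  by rewrite perm_catCA perm_cat2l.
by rewrite /tmon !big_cons -/(tmon u l) E mulrA.
Qed.

(** One half of P1, that trace functions are invariant, is applied to the trace of a single
    variable. *)
Lemma Trd_aut g a : graded_aut g -> Trd (g a) = Trd a.
Proof.
move=> gP; have /P1[_ inv]: trace_fun Trd (fun u : 'I_1 -> A => Trd (u ord0)).
  apply: (@FunAlgExt _ _ _ (fun u => Trd (npoly_eval u [:: (1, WVar ord0)]))).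
    by apply: FunAlgIn; exists [:: (1, WVar ord0)].
  by move=> u; rewrite /npoly_eval big_seq1 scale1r.
exact: (inv g gP (fun=> a)).
Qed.

Lemma count_pmap_unlift n (z : 'I_n.+1) (k : 'I_n) s :
  count_mem k (pmap (unlift z) s) = count_mem (lift z k) s.
Proof.
elim: s => //= x s IH; case: unliftP => [j ->|->] /=; rewrite IH.
  by rewrite (inj_eq (@lift_inj _ z)).
by rewrite (negbTE (neq_lift z k)).
Qed.

Definition traces_word X (l : seq (word X)) (w : word X) : str_word X :=
  foldr (fun w' m => SMul (SStr w') m) (str_of_word w) l.

Lemma traces_wordE X (a : X -> A) l w :
  str_word_eval (tr1 Trd) a (traces_word l w) = tmon a l *: word_eval a w.
Proof.
elim: l => [|w' l IH] /=; first by rewrite str_of_wordE /tmon big_nil scale1r.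
by rewrite IH gmulZl gmul1l scalerA /tmon big_cons.
Qed.

Lemma traces_word_vars X (l : seq (word X)) w :
  str_word_vars (traces_word l w) = tmon_vars l ++ word_vars w.
Proof.
elim: l => [|w' l IH] /=; last by rewrite IH /tmon_vars /= catA.
by elim: w => //= w1 -> w2 ->.
Qed.

Section Invariant.
Variable n : nat.
Local Notation ix := {ffun 'I_n -> 'I_h}.
Variable phi : ix -> A.

(** Pairing with an extra argument, placed at [ord_max], turns an equivariant map into a scalar
    invariant, to which P1 applies. *)
Let f (u : 'I_n.+1 -> A) : K^o :=
  Trd (map_eval phi (fun k => u (lift ord_max k)) ** u ord_max).

Lemma trace_form_multilinear : multilinear f.
Proof.
move=> k c y y1 y2 yk yj; rewrite /f.
case: (unliftP ord_max k) yk yj => [j ->|->] yk yj.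
  rewrite (@map_eval_multilinear _ _ _ phi j c _ (fun k => y1 (lift ord_max k))
    (fun k => y2 (lift ord_max k))) //; last first.
    by move=> i ij; apply: yj; rewrite (inj_eq (@lift_inj _ _)).
  have [e1 e2] := yj ord_max (neq_lift _ _).
  by rewrite gmulDl gmulZl Trd_lin -e1 -e2.
have e i : y (lift ord_max i) = y1 (lift ord_max i) /\ y (lift ord_max i) = y2 (lift ord_max i).
  by apply: yj; rewrite eq_sym neq_lift.
rewrite yk gmulDr gmulZr Trd_lin; congr (_ * Trd (_ ** _) + Trd (_ ** _)).
  by apply: eq_map_eval => // i; have [-> _] := e i.
by apply: eq_map_eval => // i; have [_ ->] := e i.
Qed.

Lemma trace_form_polynomial : polynomial_fun f.
Proof.
apply: (@FunAlgExt _ _ _ (fun u => \sum_(i : ix) (\prod_k hcoord (i k) (u (lift ord_max k))) *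
    \sum_l hcoord l (u ord_max) * Trd (phi i ** hvec l))).
  apply: fun_alg_sum => i _; apply: FunAlgMul.
    by apply: fun_alg_prod => k _; apply: FunAlgIn; exists (lift ord_max k), (i k).
  apply: fun_alg_sum => l _; apply: FunAlgMul; last exact: FunAlgConst.
  by apply: FunAlgIn; exists ord_max, l.
move=> u; rewrite /f /map_eval gmul_suml (Trd_sum Trd_lin); apply: eq_bigr => i _.
rewrite gmulZl (TrdZ Trd_lin); congr (_ * _).
rewrite {2}[u ord_max]hcoordE gmul_sumr (Trd_sum Trd_lin); apply: eq_bigr => l _.
by rewrite gmulZr (TrdZ Trd_lin).
Qed.

Definition uses_once (m : str_word 'I_n) : bool :=
  [forall k, count_mem k (str_word_vars m) == 1%N].

(** The trace containing the extra letter is rotated until that letter stands last; the word before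
    it, multiplied by the remaining traces, is the supertrace word [m]. The other letters are
    renamed along [unlift]. *)
Lemma trace_form_expand (t : seq (word 'I_n.+1)) :
  all (fun j => count_mem j (tmon_vars t) == 1%N) (enum 'I_n.+1) ->
  exists2 m, uses_once m & forall u,
    tmon u t = Trd (str_word_eval (tr1 Trd) (fun k => u (lift ord_max k)) m ** u ord_max).
Proof.
move=> /allP tc; have {}tc j : count_mem j (tmon_vars t) = 1%N.
  by apply/eqP/tc; rewrite mem_enum.
have [l [w [p tE]]] := tmon_isolate (tc ord_max).
have pc j : count_mem j (ord_max :: tmon_vars l ++ word_vars w) = 1%N.
  by rewrite (permP p) tc.
pose wm := word_map (unlift (@ord_max n)).
exists (traces_word [seq wm w' | w' <- l] (wm w)).
  apply/forallP => k; rewrite traces_word_vars.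
  have -> : tmon_vars [seq wm w' | w' <- l] = pmap (unlift ord_max) (tmon_vars l).
    elim: l {p tE pc} => //= w' l IH.
    by rewrite /tmon_vars /= -!/(tmon_vars _) IH pmap_cat word_map_vars.
  rewrite word_map_vars -pmap_cat count_pmap_unlift; have := pc (lift ord_max k).
  by rewrite /= (negbTE (neq_lift _ _)) add0n => ->.
move=> u; rewrite tE traces_wordE gmulZl (TrdZ Trd_lin).
have wE w' : ord_max \notin word_vars w' ->
    word_eval (fun k => u (lift ord_max k)) (wm w') = word_eval u w'.
  move=> w'z; rewrite word_map_eval; apply: word_eval_notin => x xw'.
  by case: unliftP xw' w'z => [j ->|->] // ->.
have /(@count_memPn _ ord_max) : count_mem ord_max (tmon_vars l ++ word_vars w) = 0%N.
  by have := pc ord_max; rewrite /= eqxx => -[].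
rewrite mem_cat negb_or => /andP[zl zw]; rewrite wE //; congr (_ * _).
rewrite /tmon big_map; elim: l zl {p tE pc} => [|w' l IH]; first by rewrite !big_nil.
by rewrite /tmon_vars /= mem_cat negb_or => /andP[zw' zl]; rewrite !big_cons wE // IH.
Qed.

(** P1 makes the trace form a trace polynomial, multilinearity keeps the monomials that use each
    letter once, and nondegeneracy P2 cancels the extra letter once it has been moved to the end of
    its trace. *)
Lemma invariant_map_expand :
  (forall g, graded_aut g -> forall a, map_eval phi (fun k => g (a k)) = g (map_eval phi a)) ->
  exists p : seq (K * str_word 'I_n), forall a,
    map_eval phi a = \sum_(t <- p | uses_once t.2) t.1 *: str_word_eval (tr1 Trd) a t.2.
Proof.
move=> inv; have f_inv : invariant_fun f.
  by move=> g gP u; rewrite /f inv // -(ghomM gP.1) Trd_aut.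
have /P1 f_tr := conj trace_form_polynomial f_inv.
have [p pE] := multilinear_trace_expand (enum 'I_n.+1) trace_form_multilinear f_tr.
have [q qE] : exists q : seq (K * str_word 'I_n), forall u : 'I_n.+1 -> A, f u =
    \sum_(t <- q | uses_once t.2)
      t.1 * Trd (str_word_eval (tr1 Trd) (fun k => u (lift ord_max k)) t.2 ** u ord_max).
  suff [q qE] : exists q : seq (K * str_word 'I_n), forall u : 'I_n.+1 -> A,
      \sum_(t <- p | all (fun j => count_mem j (tmon_vars t.2) == 1%N) (enum 'I_n.+1))
        t.1 * tmon u t.2 = \sum_(t <- q | uses_once t.2)
      t.1 * Trd (str_word_eval (tr1 Trd) (fun k => u (lift ord_max k)) t.2 ** u ord_max).
    by exists q => u; rewrite pE qE.
  elim: p {pE} => [|t p [q qE]]; first by exists [::] => u; rewrite !big_nil.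
  case: (boolP (all (fun j => count_mem j (tmon_vars t.2) == 1%N) (enum 'I_n.+1))) => tc.
    have [m mo mE] := trace_form_expand tc.
    by exists ((t.1, m) :: q) => u; rewrite !big_cons tc /= mo qE mE.
  by exists q => u; rewrite big_cons (negbTE tc) qE.
exists q => a; apply/eqP; rewrite -subr_eq0; apply/eqP/P2 => v.
rewrite gmulBl (TrdB Trd_lin); apply/eqP; rewrite subr_eq0; apply/eqP.
pose u k := if unlift ord_max k is Some j then a j else v.
have uE k : u (lift ord_max k) = a k by rewrite /u liftK.
have uz : u ord_max = v by rewrite /u unlift_none.
have := qE u; rewrite /f uz => e.
rewrite -(eq_map_eval (phi := phi) (fun=> erefl) uE) e gmul_suml_cond (Trd_sum Trd_lin).
by apply: eq_bigr => t _; rewrite gmulZl (TrdZ Trd_lin) (eq_str_word_eval _ _ uE).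
Qed.

End Invariant.
End TraceExpansion.

(** * Invariant multilinear maps over a superring *)

Section StrPoly.
Variables (K : fieldType) (X : Type).
Implicit Types p q : seq (K * str_word X).

Definition str_poly_scale (c : K) p : seq (K * str_word X) := [seq (c * t.1, t.2) | t <- p].

Definition str_poly_mul p q : seq (K * str_word X) :=
  [seq (t.1 * t'.1, SMul t.2 t'.2) | t <- p, t' <- q].

Fixpoint var_traces (m : str_word X) : bool :=
  match m with
  | SMul m1 m2 => var_traces m1 && var_traces m2
  | SStr (WVar _) => true
  | SStr _ => false
  | _ => true
  end.

Variables (R : gradedAlgType K) (tau : R -> R) (y : X -> R).

Lemma str_poly_eval0 : str_poly_eval tau y [::] = 0.
Proof. by rewrite /str_poly_eval big_nil. Qed.

Lemma str_poly_eval_cons t p :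
  str_poly_eval tau y (t :: p) = t.1 *: str_word_eval tau y t.2 + str_poly_eval tau y p.
Proof. by rewrite /str_poly_eval big_cons. Qed.

Lemma str_poly_eval_cat p q :
  str_poly_eval tau y (p ++ q) = str_poly_eval tau y p + str_poly_eval tau y q.
Proof. by rewrite /str_poly_eval big_cat. Qed.

Lemma str_poly_eval_scale c p :
  str_poly_eval tau y (str_poly_scale c p) = c *: str_poly_eval tau y p.
Proof.
by rewrite /str_poly_eval big_map scaler_sumr; apply: eq_bigr => t _; rewrite scalerA.
Qed.

Lemma str_poly_eval_mul p q :
  str_poly_eval tau y (str_poly_mul p q) = str_poly_eval tau y p ** str_poly_eval tau y q.
Proof.
rewrite /str_poly_eval big_allpairs_dep gmul_suml; apply: eq_bigr => t _.
by rewrite gmul_sumr; apply: eq_bigr => t' _; rewrite gmulZl gmulZr scalerA.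
Qed.

Lemma eq_str_poly_eval (z : X -> R) p : y =1 z ->
  str_poly_eval tau y p = str_poly_eval tau z p.
Proof. by move=> yz; apply: eq_bigr => t _; rewrite (eq_str_word_eval _ _ yz). Qed.

Lemma all_var_traces_mul p q : all (fun t => var_traces t.2) p ->
  all (fun t => var_traces t.2) q -> all (fun t => var_traces t.2) (str_poly_mul p q).
Proof.
move=> pv qv; elim: p pv => //= t p IH /andP[tv /IH pv]; rewrite all_cat pv andbT all_map.
by apply: sub_all qv => t' /= ->; rewrite tv.
Qed.

Lemma all_var_traces_scale c p : all (fun t => var_traces t.2) p ->
  all (fun t => var_traces t.2) (str_poly_scale c p).
Proof. by rewrite all_map. Qed.

End StrPoly.

Section TensorProjection.
Variables (K : fieldType) (A : finGradedAlgType K) (F : gradedAlgType K).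
Implicit Types u v : tensor A F.

(** The projection onto A^(e) (x) F, to be distinguished from [gpart e], which is taken with respect
    to the total degree. *)
Definition tproj e u : tensor A F := [ffun i => if hdeg i == e then u i else 0].

Lemma tproj_linear e : linear (tproj e).
Proof.
move=> c u v; apply/ffunP => i; rewrite !ffunE.
by case: ifP; rewrite // scaler0 addr0.
Qed.

Lemma tproj0 e : tproj e 0 = 0.
Proof. by apply/ffunP => i; rewrite !ffunE; case: ifP. Qed.

Lemma tprojD e u v : tproj e (u + v) = tproj e u + tproj e v.
Proof. by apply/ffunP => i; rewrite !ffunE; case: ifP; rewrite ?addr0. Qed.

Lemma tproj_pure e a (f : F) : tproj e (pure_tensor a f) = pure_tensor (gpart e a) f.
Proof. by apply/ffunP => i; rewrite !ffunE hcoord_part; case: ifP; rewrite ?scale0r. Qed.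

Lemma tproj_idem e u : tproj e (tproj e u) = tproj e u.
Proof. by apply/ffunP => i; rewrite !ffunE; case: (hdeg i == e). Qed.

Lemma tprojM e e' u v : tproj e u = u -> tproj e' v = v -> tproj (e (+) e') (u ** v) = u ** v.
Proof.
move=> <- <-; elim/tensor_ind: u => [|u u' IH IH'|i f].
- by rewrite !tproj0 gmul0l tproj0.
- by rewrite tprojD !gmulDl tprojD IH IH'.
elim/tensor_ind: v => [|v v' IH IH'|j f'].
- by rewrite !tproj0 gmul0r tproj0.
- by rewrite tprojD !gmulDr tprojD IH IH'.
by rewrite !tproj_pure pure_tensorM tproj_pure gpart_mul_homog.
Qed.

End TensorProjection.

(** * The grading of A seen by traces, and elimination of nested traces *)

Section Dichotomy.
Variables (K : fieldType) (charK : [pchar K] =i pred0) (A : finGradedAlgType K) (Trd : A -> K).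
Hypotheses (Trd_lin : scalar Trd) (Trd_trace : is_trace Trd).
Hypotheses (P1 : condP1 Trd) (P2 : condP2 Trd).
Local Notation h := (hdim A).

(** The parity automorphism negates an odd element but preserves its trace, and 2 is invertible. *)
Lemma Trd_odd a : Trd (gpart true a) = 0.
Proof.
have := Trd_aut P1 (gpart true a) (@parity_aut_graded _ A).
rewrite parity_autE !gpart_proj /= sub0r => e; apply/eqP.
have := congr1 (+%R (Trd (gpart true a))) e.
rewrite -(TrdD Trd_lin) subrr (Trd0 Trd_lin) -mulr2n => /esym/eqP.
by rewrite -mulr_natl mulf_eq0 ((pcharf0P K).1 charK).
Qed.

Lemma word_eval_novar X (R : gradedAlgType K) (a : X -> R) w :
  word_vars w = [::] -> word_eval a w = gone.
Proof.
elim: w => //= w1 IH1 w2 IH2.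
by case e: (word_vars w1) => //= e'; rewrite IH1 ?IH2 // gmul1l.
Qed.

Lemma word_eval_onevar X (R : gradedAlgType K) (a : X -> R) w x :
  word_vars w = [:: x] -> word_eval a w = a x.
Proof.
elim: w => //= [z [->]|w1 IH1 w2 IH2] //.
case e: (word_vars w1) IH1 => [|z [|]] //= IH1; first by rewrite (word_eval_novar _ e) gmul1l.
by case=> ? e'; subst z; rewrite IH1 // (word_eval_novar _ e') gmul1r.
Qed.

Lemma str_word_eval_novar X m : str_word_vars m = [::] ->
  exists c, forall a : X -> A, str_word_eval (tr1 Trd) a m = c *: gone.
Proof.
elim: m => //= [|m1 IH1 m2 IH2|w wv]; first by exists 1 => a; rewrite scale1r.
  case e: (str_word_vars m1) => //= e'; have [c cE] := IH1 e; have [c' cE'] := IH2 e'.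
  by exists (c * c') => a; rewrite cE cE' gmulZl gmul1l scalerA.
by exists (Trd gone) => a; rewrite word_eval_novar.
Qed.

Lemma str_word_eval_onevar X m x : str_word_vars m = [:: x] ->
  exists al be, forall a : X -> A,
    str_word_eval (tr1 Trd) a m = al *: a x + (be * Trd (a x)) *: gone.
Proof.
elim: m => //= [z [->]|m1 IH1 m2 IH2|w wv].
- by exists 1, 0 => a; rewrite scale1r mul0r scale0r addr0.
- case e: (str_word_vars m1) IH1 => [|z [|]] //= IH1.
    move/IH2=> [al [be E]]; have [c cE] := str_word_eval_novar e.
    exists (c * al), (c * be) => a.
    by rewrite cE E gmulZl gmul1l scalerDr !scalerA mulrA.
  case=> ? e'; subst z; have [//|al [be E]] := IH1; have [c cE] := str_word_eval_novar e'.
  exists (c * al), (c * be) => a.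
  by rewrite cE E gmulZr gmul1r scalerDr !scalerA mulrA.
- exists 0, 1 => a; rewrite (word_eval_onevar _ wv).
  by rewrite scale0r add0r mul1r.
Qed.

(** The projection onto A^(0) commutes with graded automorphisms, so it is a trace polynomial linear
    in one letter x; up to scalars such words are only x and Str(x). *)
Lemma even_part_trace : exists al be, forall a : A, gpart false a = al *: a + (be * Trd a) *: gone.
Proof.
pose phi (i : {ffun 'I_1 -> 'I_h}) : A := gpart false (hvec (i ord0)).
have phiE : forall a, map_eval phi a = gpart false (a ord0).
  apply: multilinear_basis; first exact: map_eval_multilinear.
    move=> k c y y1 y2; rewrite [k]ord1 => -> _.
    by rewrite gpartD gpartZ.
  move=> a /fin_all_exists[i ai].
  rewrite (@eq_map_eval _ _ _ _ phi _ (fun k => hvec (finfun i k))) //.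
    by rewrite map_eval_basis /phi ffunE -ai.
  by move=> k; rewrite ffunE -ai.
have [|p pE] := @invariant_map_expand _ charK _ _ Trd_lin Trd_trace P1 P2 _ phi.
  by move=> g gP a; rewrite !phiE (ghom_part gP.1).
suff [al [be E]] : exists al be, forall a : A,
    \sum_(t <- p | uses_once t.2) t.1 *: str_word_eval (tr1 Trd) (fun=> a) t.2 =
    al *: a + (be * Trd a) *: gone.
  by exists al, be => a; rewrite -E -pE phiE.
elim: p {pE} => [|t p [al [be E]]].
  by exists 0, 0 => a; rewrite big_nil mul0r !scale0r addr0.
case: (boolP (uses_once t.2)) => tu; last first.
  by exists al, be => a; rewrite big_cons (negbTE tu) E.
have tv : str_word_vars t.2 = [:: ord0].
  have /eqP := forallP tu ord0; have : all (pred1 ord0) (str_word_vars t.2).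
    by apply/allP => x _; rewrite [x]ord1 /=.
  rewrite all_count => /eqP -> /eqP; case: (str_word_vars t.2) => [|x [|]] // _.
  by rewrite [x]ord1.
have [al' [be' E']] := str_word_eval_onevar tv.
exists (t.1 * al' + al), (t.1 * be' + be) => a; rewrite big_cons tu E E'.
by rewrite scalerDr !scalerA addrACA -scalerDl mulrA -scalerDl -mulrDl.
Qed.

(** Apply [even_part_trace] to a nonzero odd element: its even part is 0, and the odd component of
    the formula forces [al = 0]. Evaluation at 1 then normalises [be]. *)
Lemma grading_dichotomy :
  (forall a : A, gpart true a = 0) \/
  exists2 be, be * Trd gone = 1 & forall a : A, gpart false a = (be * Trd a) *: gone.
Proof.
case: (EM (forall a : A, gpart true a = 0)) => [|/existsNP[a0 a0n]]; first by left.
right; have [al [be E]] := even_part_trace.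
have al0 : al = 0.
  have := congr1 (gpart true) (E (gpart true a0)).
  rewrite !gpart_proj /= gpartD !gpartZ gpart_proj eqxx -(@gpart_one K A) gpart_proj /=.
  rewrite scaler0 addr0 => /esym/eqP; rewrite scaler_eq0 => /orP[/eqP //|/eqP ?]; contradiction.
have E' a : gpart false a = (be * Trd a) *: gone by rewrite E al0 scale0r add0r.
exists be => //; have /eqP: (1 - be * Trd gone) *: gone = 0 :> A.
  by rewrite scalerBl scale1r -E' gpart_one subrr.
rewrite scaler_eq0 => /orP[/eqP e|/eqP o0]; first by apply/eqP; rewrite eq_sym -subr_eq0 e.
by case: a0n; rewrite -[gpart true a0]gmul1l o0 gmul0l.
Qed.

Lemma hdeg_trivial (i : 'I_h) : (forall a : A, gpart true a = 0) -> hdeg i = false.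
Proof.
move=> A1; apply/negbTE/negP => hi; have := hbasis_homog i; rewrite hi A1 => w0.
by have := hcoord_basis i i; rewrite -w0 /hcoord linear0 eqxx => /esym/eqP; rewrite oner_eq0.
Qed.

(* If A^(1) <> 0, then the odd elements 1 (x) f are not supercentral in A (x) F, so that a
   trace cannot be moved out of another one; tracing only variables avoids nested traces. *)
Definition tame X (p : seq (K * str_word X)) : Prop :=
  (forall a : A, gpart true a = 0) \/ all (fun t => var_traces t.2) p.

Section Projected.
Variable be : K.
Hypotheses (be1 : be * Trd gone = 1)
  (even_scalar : forall a : A, gpart false a = (be * Trd a) *: gone).

Lemma tproj_even (F : gradedAlgType K) (u : tensor A F) : tproj false u = be *: Strd Trd u.
Proof.
elim/tensor_ind: u => [|u v IHu IHv|i f]; first by rewrite tproj0 Strd0 scaler0.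
  by rewrite tprojD StrdD IHu IHv scalerDr.
rewrite tproj_pure (Strd_pure Trd_lin) even_scalar pure_tensorZl pure_tensorZr scalerA.
by [].
Qed.

Lemma tproj_odd (F : gradedAlgType K) (u : tensor A F) :
  tproj true u = u - be *: Strd Trd u.
Proof.
rewrite -tproj_even; apply/ffunP => i; rewrite !ffunE.
by case: (hdeg i); rewrite /= ?subr0 ?subrr.
Qed.

(** The odd part has trace 0, and on A^(0) (x) F = K (x) F the supertrace is multiplication by
    [Trd gone]. *)
Lemma Strd_tproj (F : gradedAlgType K) e (u : tensor A F) : tproj e u = u ->
  Strd Trd u = if e then 0 else Trd gone *: u.
Proof.
case: e => <-; last by rewrite tproj_even StrdZ (Strd_Strd Trd_lin) !scalerA mulrC.
rewrite tproj_odd -scaleN1r StrdD !StrdZ (Strd_Strd Trd_lin) !scalerA -mulrA be1 mulr1.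
by rewrite scaleN1r subrr.
Qed.

(** Since A^(0) = K, projecting a variable x amounts to a combination of x and Str(x). Products of
    factors homogeneous in A are again so, and the resulting parity [e] is what decides the trace in
    [projected_str_word]. *)
Lemma projected_word (X : Type) (ep : X -> bool) (w : word X) :
  exists p : seq (K * str_word X), [/\ all (fun t => var_traces t.2) p,
    forall (F : gradedAlgType K) (y : X -> tensor A F),
      str_poly_eval (@Strd K A Trd F) y p = word_eval (fun k => tproj (ep k) (y k)) w
    & exists e, forall (F : gradedAlgType K) (y : X -> tensor A F),
      let u := word_eval (fun k => tproj (ep k) (y k)) w in tproj e u = u].
Proof.
elim: w => [|x|w1 [p1 [v1 E1 [e1 e1E]]] w2 [p2 [v2 E2 [e2 e2E]]]].
- exists [:: (1, SOne X)]; split=> // [F y|].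
    by rewrite str_poly_eval_cons str_poly_eval0 addr0 scale1r.
  by exists false => F y /=; rewrite tensor1E tproj_pure gpart_one.
- exists (if ep x then [:: (1, SVar x); (- be, SStr (WVar x))] else [:: (be, SStr (WVar x))]).
  split=> [|F y|]; first by case: (ep x).
    rewrite /=; case: (ep x); rewrite !str_poly_eval_cons str_poly_eval0 /= addr0 ?tproj_even //.
    by rewrite tproj_odd scale1r scaleNr.
  by exists (ep x) => F y; rewrite /= tproj_idem.
exists (str_poly_mul p1 p2); split; first exact: all_var_traces_mul.
  by move=> F y; rewrite str_poly_eval_mul E1 E2.
by exists (e1 (+) e2) => F y; apply: tprojM; [apply: e1E|apply: e2E].
Qed.

(** By [Strd_tproj] the trace of a word in projected letters is 0 or a multiple of that word, so the
    only traces left are those of variables introduced by the projections. *)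
Lemma projected_str_word (X : Type) (ep : X -> bool) (m : str_word X) :
  exists2 p : seq (K * str_word X), all (fun t => var_traces t.2) p &
    forall (F : gradedAlgType K) (y : X -> tensor A F),
      str_poly_eval (@Strd K A Trd F) y p =
      str_word_eval (@Strd K A Trd F) (fun k => tproj (ep k) (y k)) m.
Proof.
elim: m => [|x|m1 [p1 v1 E1] m2 [p2 v2 E2]|w].
- have [p [pv pE _]] := projected_word ep (WOne X); by exists p.
- have [p [pv pE _]] := projected_word ep (WVar x); by exists p.
- exists (str_poly_mul p1 p2); first exact: all_var_traces_mul.
  by move=> F y; rewrite str_poly_eval_mul E1 E2.
have [p [pv pE [e eE]]] := projected_word ep w.
exists (if e then [::] else str_poly_scale (Trd gone) p).
  by case: (e); rewrite // all_var_traces_scale.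
move=> F y; rewrite /= (Strd_tproj (eE F y)); case: (e); first exact: str_poly_eval0.
by rewrite str_poly_eval_scale pE.
Qed.

End Projected.

(** For trivially graded A each projection is the identity or 0, and one zero argument makes the
    multilinear word vanish, whence the empty polynomial. *)
Lemma projected_uses_once n (ep : 'I_n -> bool) (m : str_word 'I_n) : uses_once m ->
  exists2 p : seq (K * str_word 'I_n), tame p &
    forall (F : gradedAlgType K) (y : 'I_n -> tensor A F),
      str_poly_eval (@Strd K A Trd F) y p =
      str_word_eval (@Strd K A Trd F) (fun k => tproj (ep k) (y k)) m.
Proof.
move=> /forallP mo; case: grading_dichotomy => [A1|[be be1 ev]]; last first.
  have [p pv pE] := projected_str_word be1 ev ep m; by exists p => //; right.
have tE (F : gradedAlgType K) e (u : tensor A F) : tproj e u = if e then 0 else u.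
  by apply/ffunP => i; rewrite ffunE hdeg_trivial //; case: e; rewrite // ffunE.
case: (boolP [forall k, ~~ ep k]) => [/forallP e0|].
  exists [:: (1, m)]; first by left.
  move=> F y; rewrite str_poly_eval_cons str_poly_eval0 addr0 scale1r.
  by apply: eq_str_word_eval => k; rewrite tE (negbTE (e0 k)).
rewrite negb_forall => /existsP[k]; rewrite negbK => ek.
exists [::]; first by left.
move=> F y; rewrite str_poly_eval0.
pose G (z : 'I_n -> tensor A F) : tensor A F := str_word_eval (@Strd K A Trd F) z m.
have Gl : multilinear G by apply: str_word_multilinear => [|j]; [apply: Strd_linear|apply/eqP].
by apply/esym/(multilinear0 (k := k) Gl); rewrite tE ek.
Qed.

(** * One supertrace polynomial for all superrings *)

Section Represent.
Variables (n : nat) (d : 'I_n -> bool).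
Local Notation ix := {ffun 'I_n -> 'I_h}.

(** The polynomial may not depend on [F], but it may depend on the degrees [d] of the arguments,
    which govern the reordering signs. Multilinearity is recorded because both [represents_ext] and
    [xi_inj] call on it. *)
Definition represents (p : seq (K * str_word 'I_n)) (phi : ix -> A) : Prop :=
  tame p /\ forall F : gradedAlgType K, superring F ->
    multilinear (fun y : 'I_n -> tensor A F => str_poly_eval (@Strd K A Trd F) y p : tensor A F) /\
    forall (i : ix) f, (forall k, gpart (d k (+) hdeg (i k)) (f k) = f k) ->
      str_poly_eval (@Strd K A Trd F) (fun k => pure_tensor (hvec (i k)) (f k) : tensor A F) p =
      pure_tensor (phi i) (gprod (enum 'I_n) f).

Definition representable (phi : ix -> A) : Prop := exists p, represents p phi.

Lemma representable_ext phi psi : phi =1 psi -> representable phi -> representable psi.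
Proof.
move=> pp [p [pt pE]]; exists p; split=> // F Fs; have [pl pv] := pE F Fs.
by split=> // i f fd; rewrite pv // pp.
Qed.

Lemma representable_lin c phi psi : representable phi -> representable psi ->
  representable (fun i => c *: phi i + psi i).
Proof.
move=> [p [pt pE]] [q [qt qE]]; exists (str_poly_scale c p ++ q); split.
  case: pt => [|pt]; first by left.
  case: qt => [|qt]; first by left.
  by right; rewrite all_cat all_var_traces_scale.
move=> F Fs; have [pl pv] := pE F Fs; have [ql qv] := qE F Fs; split.
  move=> k b y y1 y2 yk yj; rewrite !str_poly_eval_cat !str_poly_eval_scale.
  rewrite (pl k b y y1 y2) // (ql k b y y1 y2) // !scalerDr addrACA !scalerA.
  by rewrite [b * c]mulrC.
move=> i f fd; rewrite str_poly_eval_cat str_poly_eval_scale pv // qv //.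
by rewrite pure_tensorDl pure_tensorZl.
Qed.

Lemma representable0 : representable (fun=> 0).
Proof.
exists [::]; split; first by right.
move=> F _; split=> [k c y y1 y2 _ _|i f _]; rewrite !str_poly_eval0.
  by rewrite scaler0 addr0.
by rewrite pure_tensor0l.
Qed.

Lemma representable_sum (I : Type) (r : seq I) (P : pred I) (G : I -> ix -> A) :
  (forall i, P i -> representable (G i)) ->
  representable (fun j => \sum_(i <- r | P i) G i j).
Proof.
move=> GP; elim: r => [|i r IH].
  by apply: (representable_ext _ representable0) => j; rewrite big_nil.
case Pi: (P i); last by apply: (representable_ext _ IH) => j; rewrite big_cons Pi.
apply: (representable_ext _ (representable_lin 1 (GP i Pi) IH)) => j.
by rewrite big_cons Pi scale1r.
Qed.

(** On basis vectors of parities [ep] the coefficients have degrees [d k (+) ep k], so passing from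
    word order to index order costs a constant sign, which is put into the polynomial. The
    projections annihilate every other parity pattern. *)
Lemma representable_word (ep : 'I_n -> bool) (m : str_word 'I_n) : uses_once m ->
  representable (fun i => if [forall k, hdeg (i k) == ep k]
    then str_word_eval (tr1 Trd) (fun k => hvec (i k)) m else 0).
Proof.
move=> mo; have [p pt pE] := projected_uses_once ep mo.
have mp : perm_eq (str_word_vars m) (enum 'I_n).
  apply/allP => k _ /=; rewrite (eqP (forallP mo k)) count_uniq_mem ?enum_uniq //.
  by rewrite mem_enum.
have [b bE] := gprod_perm K (fun k => d k (+) ep k) mp.
exists (str_poly_scale ((-1) ^+ b) p); split.
  by case: pt => [|pt]; [left|right; apply: all_var_traces_scale].
move=> F Fs; split.
  move=> k c y y1 y2 yk yj; rewrite !str_poly_eval_scale !pE.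
  rewrite (@multilinear_comp _ _ _ _ _ (fun k => @tproj K A F (ep k))
    (fun y => str_word_eval (@Strd K A Trd F) y m : tensor A F) _ _ k c y y1 y2) //.
  - by rewrite scalerDr !scalerA mulrC.
  - by move=> j; apply: tproj_linear.
  - by apply: str_word_multilinear => [|j]; [apply: Strd_linear|apply/eqP/(forallP mo)].
move=> i f fd; rewrite str_poly_eval_scale pE.
case: (boolP [forall k, hdeg (i k) == ep k]) => [/forallP ei|].
  rewrite (@eq_str_word_eval _ _ _ _ _ (fun k => pure_tensor (hvec (i k)) (f k))) => [|k].
    rewrite (str_word_eval_pure Trd_lin) // (bE F Fs) => [|k]; last first.
      by rewrite -(eqP (ei k)).
    by rewrite pure_tensorZr scalerA -expr2 sqrr_sign scale1r.
  by rewrite tproj_pure -(eqP (ei k)) hbasis_homog.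
rewrite negb_forall => /existsP[k ek].
pose G (z : 'I_n -> tensor A F) : tensor A F := str_word_eval (@Strd K A Trd F) z m.
have Gl : multilinear G.
  by apply: str_word_multilinear => [|j]; [apply: Strd_linear|apply/eqP/(forallP mo)].
rewrite pure_tensor0l -[RHS](scaler0 _ ((-1) ^+ b)); congr (_ *: _).
apply: (multilinear0 (k := k) Gl); rewrite tproj_pure.
by rewrite (gpart_neq (hbasis_homog (i k)) ek) pure_tensor0l.
Qed.

(** Split [phi] according to the parities of its basis arguments. Each piece is [phi] composed with
    projections of the arguments; graded automorphisms commute with these, so the piece is still
    equivariant and [representable_word] treats its words. *)
Lemma representable_invariant (phi : ix -> A) :
  (forall g, graded_aut g -> forall a, map_eval phi (fun k => g (a k)) = g (map_eval phi a)) ->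
  representable phi.
Proof.
move=> inv; pose phie (ep : {ffun 'I_n -> bool}) (i : ix) : A :=
  if [forall k, hdeg (i k) == ep k] then phi i else 0.
apply: (@representable_ext (fun i => \sum_ep phie ep i)) => [i|].
  rewrite (bigD1 [ffun k => hdeg (i k)]) //= big1 => [|ep epi].
    by rewrite addr0 /phie; case: forallP => // -[] k; rewrite ffunE.
  rewrite /phie; case: forallP => // ei; case/eqP: epi; apply/ffunP => k.
  by rewrite ffunE (eqP (ei k)).
apply: representable_sum => ep _.
have phieE : forall a, map_eval (phie ep) a = map_eval phi (fun k => gpart (ep k) (a k)).
  apply: multilinear_basis; first exact: map_eval_multilinear.
    apply: (multilinear_comp (f := fun k => @gpart K A (ep k))).
      by move=> k c x y; rewrite gpartD gpartZ.
    exact: map_eval_multilinear.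
  move=> a /fin_all_exists[i ai].
  rewrite (@eq_map_eval _ _ _ _ (phie ep) _ (fun k => hvec (finfun i k))) => [||k]; last 2 first.
  - by [].
  - by rewrite ffunE -ai.
  rewrite map_eval_basis /phie; case: forallP => [ei|nei].
    rewrite (@eq_map_eval _ _ _ phi phi _ (fun k => hvec (finfun i k))) ?map_eval_basis // => k.
    by rewrite ai -(eqP (ei k)) ffunE hbasis_homog.
  have [k ek] : exists k, hdeg (i k) != ep k.
    apply/existsP; rewrite -negb_forall; apply/negP => /forallP ei.
    by case: nei => k; rewrite ffunE.
  apply/esym/(multilinear0 (k := k) (@map_eval_multilinear _ _ _ phi)).
  by rewrite ai (gpart_neq (hbasis_homog (i k)) ek).
have [|p pE] := @invariant_map_expand _ charK _ _ Trd_lin Trd_trace P1 P2 _ (phie ep).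
  move=> g gP a; rewrite !phieE -inv //; apply: eq_map_eval => // k.
  by rewrite (ghom_part gP.1).
apply: (@representable_ext (fun i => \sum_(t <- p | uses_once t.2) t.1 *:
    (if [forall k, hdeg (i k) == ep k]
     then str_word_eval (tr1 Trd) (fun k => hvec (i k)) t.2 else 0))) => [i|].
  have := pE (fun k => hvec (i k)); rewrite map_eval_basis {1}/phie.
  rewrite /phie; case: ifP => [_ -> //|_ _].
  by rewrite big1 // => t _; rewrite scaler0.
apply: representable_sum => t tu; apply: representable_ext (representable_lin t.1 _ representable0).
  by move=> i; rewrite addr0.
exact: representable_word.
Qed.

Lemma represents_ext p phi (F : gradedAlgType K) (y : 'I_n -> tensor A F) : superring F ->
  represents p phi -> (forall k, gpart (d k) (y k) = y k) ->
  map_ext phi y = str_poly_eval (@Strd K A Trd F) y p.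
Proof.
move=> Fs [_ /(_ F Fs)[pl pv]]; move: y; apply: multilinear_homog => //.
  exact: map_ext_multilinear.
move=> i f y fd yE; rewrite (eq_str_poly_eval _ _ yE) pv //.
rewrite -(map_eval_basis phi i) -map_ext_pure.
by apply: eq_bigr => j _; congr pure_tensor; apply: eq_word_eval => k; rewrite yE.
Qed.

End Represent.
End Dichotomy.

(** * Superrings by generators and relations *)

Section SuperringTerms.
Variables (K : fieldType) (X : Type) (deg : X -> bool).

(** The homogeneous projections belong to the syntax, so that the quotient by the congruence
    inherits a grading without any normal form for monomials. *)
Inductive sterm : Type :=
| TGen of X
| TZero
| TOne
| TAdd of sterm & sterm
| TScale of K & sterm
| TMul of sterm & sterm
| TPart of bool & sterm.

Inductive superring_law : sterm -> sterm -> Prop :=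
| LAddA a b c : superring_law (TAdd a (TAdd b c)) (TAdd (TAdd a b) c)
| LAddC a b : superring_law (TAdd a b) (TAdd b a)
| LAdd0 a : superring_law (TAdd TZero a) a
| LAddN a : superring_law (TAdd (TScale (-1) a) a) TZero
| LScaleA c d a : superring_law (TScale c (TScale d a)) (TScale (c * d) a)
| LScale1 a : superring_law (TScale 1 a) a
| LScaleDr c a b : superring_law (TScale c (TAdd a b)) (TAdd (TScale c a) (TScale c b))
| LScaleDl a c d : superring_law (TScale (c + d) a) (TAdd (TScale c a) (TScale d a))
| LMulDl a b c : superring_law (TMul (TAdd a b) c) (TAdd (TMul a c) (TMul b c))
| LMulDr a b c : superring_law (TMul a (TAdd b c)) (TAdd (TMul a b) (TMul a c))
| LMulZl c a b : superring_law (TMul (TScale c a) b) (TScale c (TMul a b))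
| LMulZr c a b : superring_law (TMul a (TScale c b)) (TScale c (TMul a b))
| LMul1l a : superring_law (TMul TOne a) a
| LMul1r a : superring_law (TMul a TOne) a
| LPart d c a b : superring_law (TPart d (TAdd (TScale c a) b))
    (TAdd (TScale c (TPart d a)) (TPart d b))
| LPartProj d e a : superring_law (TPart d (TPart e a)) (if d == e then TPart e a else TZero)
| LPartSum a : superring_law (TAdd (TPart false a) (TPart true a)) a
| LPartMul d e a b : superring_law (TPart (d (+) e) (TMul (TPart d a) (TPart e b)))
    (TMul (TPart d a) (TPart e b))
| LPartOne : superring_law (TPart false TOne) TOne
| LGen x : superring_law (TPart (deg x) (TGen x)) (TGen x)
| LMulA a b c : superring_law (TMul a (TMul b c)) (TMul (TMul a b) c)
| LComm d e a b : superring_law (TMul (TPart d a) (TPart e b))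
    (TScale ((-1) ^+ (d && e)) (TMul (TPart e b) (TPart d a))).

Inductive seqv (Rel : sterm -> Prop) : sterm -> sterm -> Prop :=
| ELaw a b of superring_law a b : seqv Rel a b
| ERel a of Rel a : seqv Rel a TZero
| ERefl a : seqv Rel a a
| ESym a b of seqv Rel a b : seqv Rel b a
| ETrans b a c of seqv Rel a b & seqv Rel b c : seqv Rel a c
| EAdd a a' b b' of seqv Rel a a' & seqv Rel b b' : seqv Rel (TAdd a b) (TAdd a' b')
| EScale c a a' of seqv Rel a a' : seqv Rel (TScale c a) (TScale c a')
| EMul a a' b b' of seqv Rel a a' & seqv Rel b b' : seqv Rel (TMul a b) (TMul a' b')
| EPart d a a' of seqv Rel a a' : seqv Rel (TPart d a) (TPart d a').

HB.instance Definition _ := gen_eqMixin sterm.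
HB.instance Definition _ := gen_choiceMixin sterm.

Section Eval.
Variables (F : gradedAlgType K) (v : X -> F).

Fixpoint sterm_eval (t : sterm) : F :=
  match t with
  | TGen x => v x
  | TZero => 0
  | TOne => gone
  | TAdd a b => sterm_eval a + sterm_eval b
  | TScale c a => c *: sterm_eval a
  | TMul a b => sterm_eval a ** sterm_eval b
  | TPart d a => gpart d (sterm_eval a)
  end.

Lemma sterm_eval_sound Rel a b : superring F -> (forall x, gpart (deg x) (v x) = v x) ->
  (forall t, Rel t -> sterm_eval t = 0) -> seqv Rel a b -> sterm_eval a = sterm_eval b.
Proof.
move=> [mA mC] vd R0; elim=> {a b} //=; last first.
- by move=> d a a' _ ->.
- by move=> a a' b b' _ -> _ ->.
- by move=> c a a' _ ->.
- by move=> a a' b b' _ -> _ ->.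
- by move=> b a c _ -> _ ->.
move=> a b; case=> {a b} /=.
- by move=> a b c; rewrite addrA.
- by move=> a b; rewrite addrC.
- by move=> a; rewrite add0r.
- by move=> a; rewrite scaleN1r addNr.
- by move=> c d a; rewrite scalerA.
- by move=> a; rewrite scale1r.
- by move=> c a b; rewrite scalerDr.
- by move=> a c d; rewrite scalerDl.
- by move=> a b c; rewrite gmulDl.
- by move=> a b c; rewrite gmulDr.
- by move=> c a b; rewrite gmulZl.
- by move=> c a b; rewrite gmulZr.
- by move=> a; rewrite gmul1l.
- by move=> a; rewrite gmul1r.
- by move=> d c a b; rewrite gpartD gpartZ.
- by move=> d e a; rewrite gpart_proj; case: ifP.
- by move=> a; rewrite gpart_sum.
- by move=> d e a b; rewrite gpart_mul_homog.
- by rewrite gpart_one.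
- by move=> x; rewrite vd.
- by move=> a b c; rewrite mA.
- by move=> d e a b; apply: mC; rewrite gpart_proj eqxx.
Qed.

End Eval.

Section Quotient.
Variable Rel : sterm -> Prop.

Definition srel (a b : sterm) : bool := `[< seqv Rel a b >].

Lemma srel_equiv : equiv_class_of srel.
Proof.
split=> [a|a b|b a c].
- by apply/asboolP/ERefl.
- by apply/asboolP/asboolP => ?; apply: ESym.
- by move=> /asboolP ab /asboolP bc; apply/asboolP/(ETrans ab).
Qed.

Canonical srel_equiv_rel := EquivRelPack srel_equiv.

Definition presented : Type := {eq_quot srel_equiv_rel}%qT.
HB.instance Definition _ := Choice.on presented.

Definition cls (a : sterm) : presented := \pi_({eq_quot srel_equiv_rel})%qT a.

Definition rep (x : presented) : sterm := repr (x : {eq_quot srel_equiv_rel}%qT).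

Lemma repK x : cls (rep x) = x.
Proof. exact: reprK. Qed.

Lemma clsP a b : seqv Rel a b <-> cls a = cls b.
Proof.
split=> [ab|/eqmodP/asboolP //]; apply/eqmodP; exact/asboolP.
Qed.

Lemma rep_cls a : seqv Rel (rep (cls a)) a.
Proof. by apply/clsP; rewrite repK. Qed.

Lemma cls_law a b : superring_law a b -> cls a = cls b.
Proof. by move=> ab; apply/clsP/ELaw. Qed.

Definition padd x y := cls (TAdd (rep x) (rep y)).
Definition pscale c x := cls (TScale c (rep x)).
Definition pmul x y := cls (TMul (rep x) (rep y)).
Definition ppart d x := cls (TPart d (rep x)).

Lemma paddE a b : padd (cls a) (cls b) = cls (TAdd a b).
Proof. by apply/clsP/EAdd; apply: rep_cls. Qed.

Lemma pscaleE c a : pscale c (cls a) = cls (TScale c a).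
Proof. by apply/clsP/EScale/rep_cls. Qed.

Lemma pmulE a b : pmul (cls a) (cls b) = cls (TMul a b).
Proof. by apply/clsP/EMul; apply: rep_cls. Qed.

Lemma ppartE d a : ppart d (cls a) = cls (TPart d a).
Proof. by apply/clsP/EPart/rep_cls. Qed.

Lemma cls_ind (P : presented -> Prop) : (forall a, P (cls a)) -> forall x, P x.
Proof. by move=> Pc x; rewrite -[x]repK. Qed.

Definition presE := (paddE, pscaleE, pmulE, ppartE).

Lemma paddA : associative padd.
Proof.
by do 3![elim/cls_ind => ?]; rewrite !presE; apply/cls_law; constructor.
Qed.

Lemma paddC : commutative padd.
Proof. by do 2![elim/cls_ind => ?]; rewrite !presE; apply/cls_law; constructor. Qed.

Lemma padd0 : left_id (cls TZero) padd.
Proof. by elim/cls_ind => ?; rewrite !presE; apply/cls_law; constructor. Qed.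

Lemma paddN : left_inverse (cls TZero) (pscale (-1)) padd.
Proof. by elim/cls_ind => ?; rewrite !presE; apply/cls_law; constructor. Qed.

HB.instance Definition _ := GRing.isZmodule.Build presented paddA paddC padd0 paddN.

Lemma presentedD a b : cls a + cls b = cls (TAdd a b).
Proof. exact: paddE. Qed.

Lemma pscaleA c d x : pscale c (pscale d x) = pscale (c * d) x.
Proof. by elim/cls_ind: x => ?; rewrite !presE; apply/cls_law; constructor. Qed.

Lemma pscale1 : left_id 1 pscale.
Proof. by elim/cls_ind => ?; rewrite !presE; apply/cls_law; constructor. Qed.

Lemma pscaleDr : right_distributive pscale +%R.
Proof.
move=> c; do 2![elim/cls_ind => ?]; rewrite presentedD !presE presentedD.
by apply/cls_law; constructor.
Qed.

Lemma pscaleDl x : {morph pscale^~ x : c d / c + d}.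
Proof.
move=> c d; elim/cls_ind: x => a; rewrite !presE presentedD.
by apply/cls_law; constructor.
Qed.

HB.instance Definition _ :=
  GRing.Zmodule_isLmodule.Build K presented pscaleA pscale1 pscaleDr pscaleDl.

Lemma presentedZ c a : c *: cls a = cls (TScale c a).
Proof. exact: pscaleE. Qed.

Definition presLE := (presentedD, presentedZ, pmulE, ppartE).

Lemma pmulDl : left_distributive pmul +%R.
Proof. by do 3![elim/cls_ind => ?]; rewrite !presLE; apply/cls_law; constructor. Qed.

Lemma pmulDr : right_distributive pmul +%R.
Proof. by do 3![elim/cls_ind => ?]; rewrite !presLE; apply/cls_law; constructor. Qed.

Lemma pmulZl (c : K) x y : pmul (c *: x) y = c *: pmul x y.
Proof.
elim/cls_ind: x => a; elim/cls_ind: y => b; rewrite presentedZ !pmulE presentedZ.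
by apply/cls_law; constructor.
Qed.

Lemma pmulZr (c : K) x y : pmul x (c *: y) = c *: pmul x y.
Proof.
elim/cls_ind: x => a; elim/cls_ind: y => b; rewrite presentedZ !pmulE presentedZ.
by apply/cls_law; constructor.
Qed.

Lemma pmul1l : left_id (cls TOne) pmul.
Proof. by elim/cls_ind => ?; rewrite !presLE; apply/cls_law; constructor. Qed.

Lemma pmul1r : right_id (cls TOne) pmul.
Proof. by elim/cls_ind => ?; rewrite !presLE; apply/cls_law; constructor. Qed.

Lemma ppart_linear d : linear (ppart d).
Proof.
move=> c; do 2![elim/cls_ind => ?]; rewrite presentedZ presentedD !ppartE presentedZ presentedD.
by apply/cls_law; constructor.
Qed.

Lemma ppart_proj d e x : ppart d (ppart e x) = if d == e then ppart e x else 0.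
Proof.
elim/cls_ind: x => a; rewrite !presLE (cls_law (LPartProj d e a)).
by case: (d == e).
Qed.

Lemma ppart_sum x : ppart false x + ppart true x = x.
Proof. by elim/cls_ind: x => a; rewrite !presLE; apply/cls_law; constructor. Qed.

Lemma ppart_mul d e x y : ppart d x = x -> ppart e y = y ->
  ppart (d (+) e) (pmul x y) = pmul x y.
Proof.
elim/cls_ind: x => a; elim/cls_ind: y => b xd ye; rewrite -xd -ye !presLE.
by apply/cls_law; constructor.
Qed.

Lemma ppart_one : ppart false (cls TOne) = cls TOne.
Proof. by rewrite !presLE; apply/cls_law; constructor. Qed.

HB.instance Definition _ := isGradedAlg.Build K presented
  pmulDl pmulDr pmulZl pmulZr pmul1l pmul1r ppart_linear ppart_proj ppart_sum
  ppart_mul ppart_one.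

Lemma presentedM a b : cls a ** cls b = cls (TMul a b).
Proof. exact: pmulE. Qed.

Lemma presented_part d a : gpart d (cls a) = cls (TPart d a).
Proof. exact: ppartE. Qed.

Lemma presented_superring : superring presented.
Proof.
split=> [x y z|d e x y].
  elim/cls_ind: x => a; elim/cls_ind: y => b; elim/cls_ind: z => c.
  rewrite (presentedM b c) (presentedM a (TMul b c)) (presentedM a b) (presentedM (TMul a b) c).
  by apply/cls_law; constructor.
elim/cls_ind: x => a; elim/cls_ind: y => b xd ye; rewrite -xd -ye !presented_part.
rewrite (presentedM (TPart e b) (TPart d a)) (presentedM (TPart d a) (TPart e b)) presentedZ.
by apply/cls_law; constructor.
Qed.

Lemma cls_gen_homog x : gpart (deg x) (cls (TGen x)) = cls (TGen x).
Proof. by rewrite presented_part; apply/cls_law; constructor. Qed.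

Definition presented_lift (F : gradedAlgType K) (v : X -> F) (x : presented) : F :=
  sterm_eval v (rep x).

Section Lift.
Variables (F : gradedAlgType K) (v : X -> F).
Hypotheses (Fs : superring F) (vd : forall x, gpart (deg x) (v x) = v x).
Hypothesis v0 : forall t, Rel t -> sterm_eval v t = 0.

Lemma presented_liftE a : presented_lift v (cls a) = sterm_eval v a.
Proof. exact: sterm_eval_sound (rep_cls a). Qed.

Lemma presented_lift_hom : graded_hom (presented_lift v).
Proof.
split=> [c x y||x y|d x].
- elim/cls_ind: x => a; elim/cls_ind: y => b.
  by rewrite presentedZ presentedD !presented_liftE.
- exact: (presented_liftE TOne).
- by elim/cls_ind: x => a; elim/cls_ind: y => b; rewrite presentedM !presented_liftE.
- by elim/cls_ind: x => a; rewrite presented_part !presented_liftE.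
Qed.

End Lift.

(** [subalg_gen] is not closed under [gpart] by definition; the induction on terms therefore treats
    all homogeneous components. *)
Lemma cls_gen_generate x : subalg_gen (fun f => exists g, f = cls (TGen g)) x.
Proof.
suff gen d t : subalg_gen (fun f => exists g, f = cls (TGen g)) (gpart d (cls t)).
  rewrite -[x]repK -[cls _]gpart_sum -[gpart false _]scale1r.
  by apply: SubalgLin; apply: gen.
have gen0 : subalg_gen (fun f : presented => exists g, f = cls (TGen g)) 0.
  by rewrite -(addNr gone) -scaleN1r; apply: SubalgLin; apply: SubalgOne.
have genD a b : subalg_gen (fun f : presented => exists g, f = cls (TGen g)) a ->
   subalg_gen (fun f : presented => exists g, f = cls (TGen g)) b ->
   subalg_gen (fun f : presented => exists g, f = cls (TGen g)) (a + b).
  by move=> ga gb; rewrite -[a]scale1r; apply: SubalgLin.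
elim: t d => [g||||||] .
- move=> d; rewrite -cls_gen_homog gpart_proj; case: ifP => // _.
  by rewrite cls_gen_homog; apply: SubalgIn; exists g.
- by move=> d; rewrite gpart0.
- move=> d; rewrite -[cls TOne]gpart_one gpart_proj; case: ifP => // _.
  by rewrite gpart_one; apply: SubalgOne.
- by move=> a IHa b IHb d; rewrite -presentedD gpartD; apply: genD.
- by move=> c a IH d; rewrite -presentedZ gpartZ -[_ *: _]addr0; apply: SubalgLin.
- move=> a IHa b IHb d; rewrite -presentedM gpart_mulE.
  by apply: genD; apply: SubalgMul.
- by move=> e a IH d; rewrite -presented_part gpart_proj; case: ifP.
Qed.

End Quotient.

(** By induction on the derivation: a graded ideal of the free superring containing the relations
    contains every difference of equivalent terms. This turns an equality in the quotient into
    membership in an ideal upstairs. *)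
Lemma seqv_ideal Rel (J : presented (fun=> False) -> Prop) a b :
  J 0 -> (forall x y, J x -> J y -> J (x + y)) -> (forall c x, J x -> J (c *: x)) ->
  (forall x y, J x -> J (x ** y)) -> (forall x y, J x -> J (y ** x)) ->
  (forall d x, J x -> J (gpart d x)) -> (forall t, Rel t -> J (cls _ t)) ->
  seqv Rel a b -> J (cls _ a - cls _ b).
Proof.
move=> J0 JD JZ Jl Jr Jp JR; elim=> {a b}.
- by move=> a b /cls_law ->; rewrite subrr.
- by move=> t /JR Jt; rewrite (_ : cls _ TZero = 0) ?subr0.
- by move=> a; rewrite subrr.
- by move=> a b _ /(JZ (-1)); rewrite scaleN1r opprB.
- by move=> b a c _ ab _ bc; have := JD _ _ ab bc; rewrite addrA subrK.
- by move=> a a' b b' _ Ja _ Jb; rewrite -!presentedD opprD addrACA; apply: JD.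
- by move=> c a a' _ Ja; rewrite -!presentedZ -scalerBr; apply: JZ.
- move=> a a' b b' _ Ja _ Jb; rewrite -!presentedM.
  have -> : cls _ a ** cls _ b - cls _ a' ** cls _ b' =
      (cls (fun=> False) a - cls _ a') ** cls _ b + cls _ a' ** (cls _ b - cls _ b').
    by rewrite gmulBl gmulBr addrA subrK.
  by apply: JD; [apply: Jl|apply: Jr].
- by move=> d a a' _ Ja; rewrite -!presented_part -gpartB; apply: Jp.
Qed.

End SuperringTerms.

(** * Linearity of the generic trace *)

Section GenericTraceLinear.
Variables (K : fieldType) (charK : [pchar K] =i pred0) (A : finGradedAlgType K).
Local Notation n := (hdim A).
Local Notation Kxi := (mpoly.mpoly n K).

(** The substitution of c xi for xi, which carries the generic element v to c v. *)
Definition mscale (c : K) (p : Kxi) : Kxi := comp_mpoly [tuple c *: 'X_i | i < n] p.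

Lemma mscaleM c : {morph mscale c : p q / p * q}.
Proof. by move=> p q; rewrite /mscale rmorphM. Qed.

Lemma mscale_sum c (I : Type) (r : seq I) (G : I -> Kxi) :
  mscale c (\sum_(i <- r) G i) = \sum_(i <- r) mscale c (G i).
Proof. by rewrite /mscale linear_sum. Qed.

Lemma mscaleZ c a p : mscale c (a *: p) = a *: mscale c p.
Proof. exact: comp_mpolyZ. Qed.

Lemma mscale_meval c p (v : 'I_n -> K) : (mscale c p).@[v] = p.@[fun i => c * v i].
Proof.
rewrite /mscale comp_mpoly_meval; apply: meval_eq => i.
by rewrite tnth_mktuple mevalZ mevalXU.
Qed.

Lemma generic_power_scale c k i :
  mscale c (generic_power A k i) = c ^+ k *: generic_power A k i.
Proof.
elim: k i => [|k IH] i /=.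
  by rewrite ffunE mscaleZ expr0 scale1r /mscale comp_mpoly1.
rewrite !sum_ffunE mscale_sum scaler_sumr; apply: eq_bigr => l _.
rewrite !sum_ffunE mscale_sum scaler_sumr; apply: eq_bigr => j _.
rewrite !ffunE mscaleZ mscaleM IH /mscale comp_mpolyXU -tnth_nth tnth_mktuple.
by rewrite -scalerAl -scalerAr !scalerA exprSr -mulrA [X in X *: _ = _]mulrC.
Qed.

(** Denominators are cleared; [m] may exceed the size of [q], so that several polynomials can be
    compared over a common range. *)
Lemma generic_rootP (q : {poly Kxi}) m : (size q <= m)%N ->
  generic_root (map_poly (@FracField.tofrac _) q) <->
  forall i, \sum_(k < m) q`_k * generic_power A k i = 0.
Proof.
move=> qm; have sE : size (map_poly (@FracField.tofrac _) q) = size q.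
  apply: size_map_inj_poly => [x y /eqP|]; last exact: tofrac0.
  by rewrite tofrac_eq => /eqP.
have E i : \sum_(k < size (map_poly (@FracField.tofrac _) q))
    (map_poly (@FracField.tofrac _) q)`_k * FracField.tofrac (generic_power A k i) =
    FracField.tofrac (\sum_(k < m) q`_k * generic_power A k i).
  rewrite sE rmorph_sum (big_ord_widen m (fun k => (map_poly (@FracField.tofrac _) q)`_k *
    FracField.tofrac (generic_power A k i))) //= big_mkcond /=.
  apply: eq_bigr => k _; rewrite coef_map /= rmorphM /=; case: ltnP => // qk.
  by rewrite (nth_default _ qk) rmorph0 mul0r.
split=> [r i|r i]; last by rewrite E r rmorph0.
by have := r i; rewrite E => /eqP; rewrite tofrac_eq0 => /eqP.
Qed.

(** If 1 = 0, the constant 1 annihilates the generic element, so the minimal polynomial is 1. As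
    [1.-2] is 0, [Trd] would then be constantly -1, against [Trd 0 = 0]. *)
Lemma generic_trace_unit (Trd : A -> K) : generic_trace Trd -> is_trace Trd ->
  (gone : A) != 0.
Proof.
move=> [p [pm _ pmin] TE] [Tc _]; apply/eqP => o0.
have T0 : Trd 0 = 0 by have := Tc 0 0; rewrite subrr.
have /(pmin _ (oner_neq0 _)): generic_root (1 : {poly {fraction Kxi}}).
  move=> i; rewrite size_poly1 big_ord1 /= ffunE o0 /hcoord linear0 scale0r tofrac0.
  by rewrite mulr0.
rewrite size_poly1 => p1; have p1E : size p = 1%N.
  apply/eqP; rewrite eqn_leq p1 lt0n size_poly_eq0; apply/eqP => p0.
  by move/monicP/eqP: pm; rewrite p0 lead_coef0 eq_sym oner_eq0.
move/monicP: pm; rewrite /lead_coef p1E /= => pm; have := TE 0.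
by rewrite T0 p1E pm mevalN meval1 => /eqP; rewrite eq_sym oppr_eq0 oner_eq0.
Qed.

(** Substituting c xi for xi in p(v) = 0 gives a relation with coefficients c^k p_k(c xi). Its
    leading coefficient is that of c^(s+1) p, where s+1 is the degree, so the difference has smaller
    degree and vanishes by minimality; the coefficient at s is read off. *)
Lemma generic_minpoly_scale (p : {poly Kxi}) c : generic_minpoly p -> (1 < size p)%N -> c != 0 ->
  mscale c p`_(size p).-2 = c *: p`_(size p).-2.
Proof.
case=> pm proot pmin p1 c0.
case sp: (size p) p1 => [|[|s]] // _ /=; pose q := \poly_(k < s.+1)
  (c ^+ k *: mscale c p`_k - c ^+ s.+1 *: p`_k).
have q0 : q = 0.
  apply/eqP/negPn/negP => qn0.
  have q0' : map_poly (@FracField.tofrac _) q != 0.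
    rewrite map_poly_eq0_id0 // tofrac_eq0 lead_coef_eq0 //.
  have sq : (size (map_poly (@FracField.tofrac Kxi) q) <= s.+1)%N.
    exact: leq_trans (size_poly _ _) (size_poly _ _).
  suff /(pmin _ q0') : generic_root (map_poly (@FracField.tofrac _) q).
    rewrite sp => /leq_trans /(_ sq); by rewrite ltnn.
  apply/(@generic_rootP q s.+2) => [|i]; first exact: leq_trans (size_poly _ _) (leqnSn _).
  move/(@generic_rootP p s.+2): proot; rewrite sp => /(_ (leqnn _)) proot.
  have e1 := congr1 (mscale c) (proot i).
  have {}e1 : \sum_(k < s.+2) (c ^+ k *: mscale c p`_k) * generic_power A k i = 0.
    rewrite -[RHS](comp_mpoly0 [tuple c *: 'X_i | i < n]) -/(mscale c 0) -e1 mscale_sum.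
    by apply: eq_bigr => k _; rewrite mscaleM generic_power_scale -scalerAl scalerAr.
  have e2 : \sum_(k < s.+2) (c ^+ s.+1 *: p`_k) * generic_power A k i = 0.
    transitivity (c ^+ s.+1 *: \sum_(k < s.+2) p`_k * generic_power A k i); last first.
      by rewrite proot scaler0.
    rewrite scaler_sumr; by apply: eq_bigr => k _; rewrite scalerAl.
  transitivity (\sum_(k < s.+2) ((c ^+ k *: mscale c p`_k) * generic_power A k i -
      (c ^+ s.+1 *: p`_k) * generic_power A k i)); last by rewrite sumrB e1 e2 subrr.
  apply: eq_bigr => k _.
  rewrite -mulrBl coef_poly; case: ltnP => // ks.
  have -> : k = ord_max by apply/val_inj/eqP; rewrite eqn_leq -ltnS ltn_ord.
  have -> : p`_(@ord_max s.+1) = 1 by have /monicP := pm; rewrite /lead_coef sp.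
  by rewrite /mscale comp_mpoly1 subrr.
have := congr1 (fun r : {poly Kxi} => r`_s) q0.
rewrite coef0 coef_poly ltnSn => /eqP; rewrite subr_eq0 exprSr -scalerA => /eqP.
by apply: scalerI; rewrite expf_neq0.
Qed.

(** Comparing linear coefficients in f(c a) = c f(a) shows that the monomials of degree one in [p]
    already give f. *)
Lemma homogeneous_linear (p : Kxi) (f : A -> K) :
  (forall a, f a = p.@[fun i => hcoord i a]) -> (forall c a, f (c *: a) = c * f a) ->
  scalar f.
Proof.
move=> fE fZ; pose v (a : A) (m : 'X_{1.. n}) := p@_m * \prod_i hcoord i a ^+ m i.
have f1 a : f a = \sum_(m <- msupp p | mdeg m == 1%N) v a m.
  symmetry; apply: (coef1_values charK) => c; rewrite -fZ fE mevalE.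
  apply: eq_bigr => m _; rewrite mulrCA; congr (_ * _).
  rewrite mdegE -prodrXr -big_split; apply: eq_bigr => i _ /=.
  by rewrite hcoordZ exprMn.
move=> c a b; rewrite !f1 mulr_sumr -big_split; apply: eq_bigr => m /mdeg1P[i /eqP ->] /=.
have vE x : v x U_(i)%MM = p@_U_(i) * hcoord i x.
  rewrite /v (bigD1 i) //= mnm1E eqxx expr1 big1 ?mulr1 // => j ji.
  by rewrite mnm1E eq_sym (negbTE ji) expr0.
by rewrite !vE hcoordD hcoordZ mulrDr mulrCA.
Qed.

Lemma generic_trace_linear (Trd : A -> K) : generic_trace Trd -> is_trace Trd -> scalar Trd.
Proof.
move=> [p pmin TE] [Tc _].
have T0 : Trd 0 = 0 by have := Tc 0 0; rewrite subrr.
have p1 : (1 < size p)%N.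
  rewrite ltnNge; apply/negP => p1; have [/monicP pm _ _] := pmin.
  have p1E : size p = 1%N.
    apply/eqP; rewrite eqn_leq p1 lt0n size_poly_eq0; apply/eqP => p0.
    by move/eqP: pm; rewrite p0 lead_coef0 eq_sym oner_eq0.
  move: pm; rewrite /lead_coef p1E /= => pm; have := TE 0.
  by rewrite T0 p1E pm mevalN meval1 => /eqP; rewrite eq_sym oppr_eq0 oner_eq0.
apply: (homogeneous_linear TE) => c a; case: (eqVneq c 0) => [->|c0].
  by rewrite scale0r T0 mul0r.
rewrite !TE !mevalN mulrN; congr (- _).
rewrite -mevalZ -(generic_minpoly_scale pmin p1 c0) mscale_meval.
by apply: meval_eq => i; rewrite hcoordZ.
Qed.

End GenericTraceLinear.

(** * Invariant elements of A (x) F *)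

Section Monomials.
Variables (K : fieldType) (A : finGradedAlgType K) (F : gradedAlgType K).
Local Notation h := (hdim A).
Hypothesis Fs : superring F.

(* A list of pairs (y, i) codes the product of the i-th entries of the y's. *)
Definition entries := seq (tensor A F * 'I_h).

Definition mon (l : entries) : F := gprod l (fun p => p.1 p.2).

(** [Q] restricts the whole list of factors of a monomial; it will express, for instance, that some
    factor stands for 0 in [B]. *)
Inductive mspan (Q : entries -> Prop) : F -> Prop :=
| MSpan0 : mspan Q 0
| MSpanAdd c l x of Q l & mspan Q x : mspan Q (c *: mon l + x).

Inductive vspan (Q : entries -> Prop) : tensor A F -> Prop :=
| VSpan0 : vspan Q 0
| VSpanAdd a l u of Q l & vspan Q u : vspan Q (pure_tensor a (mon l) + u).

Lemma mspan_mon (Q : entries -> Prop) l : Q l -> mspan Q (mon l).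
Proof. by move=> Ql; rewrite -[mon l]addr0 -[mon l]scale1r; apply: MSpanAdd (MSpan0 Q). Qed.

Lemma mspanD Q x y : mspan Q x -> mspan Q y -> mspan Q (x + y).
Proof.
by move=> Qx Qy; elim: Qx => [|c l z Ql _ IH]; rewrite ?add0r // -addrA; apply: MSpanAdd.
Qed.

Lemma mspanZ Q c x : mspan Q x -> mspan Q (c *: x).
Proof.
elim=> [|b l z Ql _ IH]; first by rewrite scaler0; apply: MSpan0.
by rewrite scalerDr scalerA; apply: MSpanAdd.
Qed.

Lemma mon_cat l l' : mon (l ++ l') = mon l ** mon l'.
Proof. by apply: gprod_cat; case: Fs. Qed.

Lemma mspanM Q1 Q2 Q3 x y : (forall l l', Q1 l -> Q2 l' -> Q3 (l ++ l')) ->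
  mspan Q1 x -> mspan Q2 y -> mspan Q3 (x ** y).
Proof.
move=> QQ; elim=> [|c l z Ql _ IH] Qy; first by rewrite gmul0l; apply: MSpan0.
rewrite gmulDl; apply: mspanD (IH Qy); rewrite gmulZl; apply: mspanZ.
elim: Qy => [|b l' t Ql' _ IH']; first by rewrite gmul0r; apply: MSpan0.
rewrite gmulDr gmulZr; apply: mspanD IH'; apply: mspanZ; rewrite -mon_cat.
exact/mspan_mon/QQ.
Qed.

Lemma mspan_part Q d x : (forall l, Q l -> forall p, p \in l -> exists e, gpart e p.1 = p.1) ->
  mspan Q x -> mspan Q (gpart d x).
Proof.
move=> Qh; elim=> [|c l z Ql _ IH]; first by rewrite gpart0; apply: MSpan0.
rewrite gpartD gpartZ; apply: mspanD IH; apply: mspanZ.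
have [e le] : exists e, gpart e (mon l) = mon l.
  move: (Qh l Ql) => {Ql}; elim: l => [|p l IHl] lh.
    by exists false; rewrite /mon /gprod /= gpart_one.
  have [e1 pe] := lh p (mem_head _ _).
  have [|e2 le] := IHl; first by move=> q ql; apply: lh; rewrite inE ql orbT.
  exists ((e1 (+) hdeg p.2) (+) e2); rewrite /mon gprod_cons.
  by apply: gpart_mul => //; apply: entry_homog.
rewrite -le gpart_proj; case: ifP => _; last exact: MSpan0.
by rewrite le; apply: mspan_mon.
Qed.

Lemma vspanD Q u v : vspan Q u -> vspan Q v -> vspan Q (u + v).
Proof.
by move=> Qu Qv; elim: Qu => [|a l z Ql _ IH]; rewrite ?add0r // -addrA; apply: VSpanAdd.
Qed.

Lemma vspan_entries Q (u : tensor A F) : (forall i, mspan Q (u i)) -> vspan Q u.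
Proof.
move=> Qu; rewrite [u]tensorE; elim/big_rec: _ => [|i v _ Qv]; first exact: VSpan0.
apply: vspanD Qv; elim: (Qu i) => [|c l z Ql _ IH]; first by rewrite pure_tensor0r; apply: VSpan0.
by rewrite pure_tensorDr pure_tensorZr -pure_tensorZl; apply: VSpanAdd.
Qed.

Lemma vspan_sum Q u : vspan Q u -> exists r (a : 'I_r -> A) (l : 'I_r -> entries),
  (forall s, Q (l s)) /\ u = \sum_s pure_tensor (a s) (mon (l s)).
Proof.
elim=> [|b m z Qm _ [r [a [l [Ql ->]]]]].
  by exists 0%N, (fun=> 0), (fun=> [::]); split=> [[]//|]; rewrite big_ord0.
exists r.+1, (fun s => if unlift ord0 s is Some t then a t else b),
  (fun s => if unlift ord0 s is Some t then l t else m); split=> [s|].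
  by case: (unlift ord0 s).
rewrite big_ord_recl unlift_none; congr (_ + _).
by apply: eq_bigr => s _; rewrite liftK.
Qed.

Lemma gprod_map (X Y : Type) (g : X -> Y) (f : Y -> F) s :
  gprod (map g s) f = gprod s (f \o g).
Proof. by elim: s => //= x s; rewrite !gprod_cons => ->. Qed.

Hypothesis A_neq0 : (gone : A) != 0.

(** A term a (x) m is the value of a multilinear map supported on one basis index at the elements
    whose entries occur in m. The monomials have to be brought to a common length [n] first. *)
Lemma vspan_tuple_ext Q u : vspan Q u -> exists r n
    (v : {ffun 'I_r * {ffun 'I_n -> 'I_h} -> A}) (y : 'I_r -> 'I_n -> tensor A F),
  u = tuple_ext y v /\ forall s, exists l, [/\ Q l,
    forall k, y s k = gone \/ exists i, (y s k, i) \in l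
    & forall p, p \in l -> exists k, y s k = p.1].
Proof.
case/vspan_sum=> r [a [l [Ql ->]]].
(* The entry [i0] of 1 is an invertible scalar c. It pads short monomials, and the coefficient is
   divided by the corresponding power of c. *)
have [i0 c0] : exists i0 : 'I_h, hcoord i0 (gone : A) != 0.
  apply/existsP; apply: contraR A_neq0; rewrite negb_exists => /forallP c0.
  rewrite [gone]hcoordE big1 // => i _.
  by have := c0 i; rewrite negbK => /eqP ->; rewrite scale0r.
pose n := \max_s size (l s); pose def : tensor A F * 'I_h := (gone, i0).
pose y s (k : 'I_n) := (nth def (l s) k).1.
pose ix s := [ffun k : 'I_n => (nth def (l s) k).2].
pose c := hcoord i0 (gone : A).
exists r, n, [ffun q : 'I_r * {ffun 'I_n -> 'I_h} =>
  if q.2 == ix q.1 then c ^- (n - size (l q.1)) *: a q.1 else 0], y; split.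
  apply: eq_bigr => s _; rewrite /map_ext (bigD1 (ix s)) //= big1 => [|j /negbTE js].
    rewrite addr0 ffunE eqxx.
    have -> : gprod (enum 'I_n) (fun k => y s k (ix s k)) = c ^+ (n - size (l s)) *: mon (l s).
      have sn : (size (l s) <= n)%N by apply: leq_bigmax.
      transitivity (gprod (l s ++ nseq (n - size (l s)) def) (fun p => p.1 p.2)).
        have -> : l s ++ nseq (n - size (l s)) def = [seq nth def (l s) (val k) | k <- enum 'I_n].
          rewrite map_comp val_enum_ord; apply: (@eq_from_nth _ def).
            by rewrite size_cat size_nseq size_map size_iota subnKC.
          move=> k; rewrite size_cat size_nseq subnKC // => kn.
          rewrite (nth_map 0%N) ?size_iota // nth_iota // add0n nth_cat.
          by case: ltnP => // ks; rewrite nth_nseq (nth_default _ ks); case: ifP.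
        by rewrite gprod_map; apply: eq_word_eval => k; rewrite /= ffunE.
      rewrite gprod_cat; last by case: Fs.
      have -> : gprod (nseq (n - size (l s)) def) (fun p => p.1 p.2) =
          c ^+ (n - size (l s)) *: gone.
        elim: (n - _)%N => [|m IH]; first by rewrite scale1r.
        by rewrite gprod_cons IH gmulZr gmul1r exprS mulrC -scalerA /def /= tensor1E ffunE.
      by rewrite gmulZr gmul1r.
    rewrite pure_tensorZl pure_tensorZr scalerA mulVf ?scale1r //.
    by rewrite expf_neq0.
  by rewrite ffunE /= js pure_tensor0l.
move=> s; exists (l s); split=> [//|k|p pl].
  case: (ltnP k (size (l s))) => kl; last by left; rewrite /y nth_default.
  by right; exists (nth def (l s) k).2; rewrite /y -surjective_pairing mem_nth.
have pn : (index p (l s) < n)%N.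
  apply: leq_trans (leq_bigmax s); by rewrite index_mem.
by exists (Ordinal pn); rewrite /y /= nth_index.
Qed.

End Monomials.

Section InvariantExpand.
Variables (K : fieldType) (charK : [pchar K] =i pred0) (A : finGradedAlgType K) (Trd : A -> K).
Hypotheses (Trd_lin : scalar Trd) (Trd_trace : is_trace Trd) (A_neq0 : (gone : A) != 0).
Hypotheses (P1 : condP1 Trd) (P2 : condP2 Trd) (P3 : condP3 A).
Variable F : gradedAlgType K.
Hypothesis Fs : superring F.

(** The maps found by [vspan_tuple_ext] become equivariant by [invariant_lift], hence supertrace
    polynomials. The lists [l] are kept in the conclusion so that a condition [Q] on monomials
    passes to the arguments of the polynomials. *)
Lemma invariant_expand (T : tensor A F -> Prop) (Q : entries A F -> Prop) u :
  (forall l, Q l -> forall p, p \in l -> T p.1) -> T gone ->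
  (forall y, T y -> exists d, gpart d y = y) ->
  (forall g, graded_aut g -> exists z : F -> F, [/\ graded_hom z,
     forall y, T y -> tensor_map z y = tensor_act g y & tensor_map z u = tensor_act g u]) ->
  vspan Q u ->
  exists r n (y : 'I_r -> 'I_n -> tensor A F) (p : 'I_r -> seq (K * str_word 'I_n)),
    u = \sum_s str_poly_eval (@Strd K A Trd F) (y s) (p s) /\
    forall s, (exists d phi, represents Trd d (p s) phi) /\
      exists l, [/\ Q l, forall k, y s k = gone \/ exists i, (y s k, i) \in l
        & forall q, q \in l -> exists k, y s k = q.1].
Proof.
move=> QT T1 Th Tz /(vspan_tuple_ext Fs A_neq0)[r [n [v [y [uE yQ]]]]].
have yT s k : T (y s k).
  have [l [Ql ly _]] := yQ s; case: (ly k) => [->//|[i]]; exact: (QT l Ql).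
have [d dP] : exists d, forall s k, gpart (d s k) (y s k) = y s k.
  have [s|d dP] := @fin_all_exists _ _ (fun s (d : 'I_n -> bool) =>
      forall k, gpart (d k) (y s k) = y s k); last by exists d.
  have [k|f fP] := @fin_all_exists _ _ (fun k (d : bool) => gpart d (y s k) = y s k).
    exact/Th/yT.
  by exists f.
have [|w winv wE] := invariant_lift dP (v := v) P3.
  move=> g gP; have [z [zh zT zu]] := Tz g gP; exists z; split=> // [s k|].
    by rewrite zT.
  by rewrite -uE.
have rep s : exists p, represents Trd (d s) p (fun i => w (s, i)).
  apply: representable_invariant => // g gP a.
  rewrite -{1}(winv g gP) map_eval_conj //; congr (fun_of_lfun g _).
  by apply: eq_map_eval => // k; rewrite graded_autK.
have [p pP] := fin_all_exists rep.
exists r, n, y, p; split.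
  rewrite uE -wE; apply: eq_bigr => s _.
  exact: (represents_ext Fs (pP s) (dP s)).
by move=> s; split; [exists (d s), (fun i => w (s, i))|apply: yQ].
Qed.

End InvariantExpand.

(** * The universal supermap *)

Section StrWordMap.
Variables (X Y : Type) (r : X -> Y).

Fixpoint str_word_map (m : str_word X) : str_word Y :=
  match m with
  | SOne => SOne Y
  | SVar x => SVar (r x)
  | SMul m1 m2 => SMul (str_word_map m1) (str_word_map m2)
  | SStr w => SStr (word_map (fun x => Some (r x)) w)
  end.

Variables (K : fieldType) (R : gradedAlgType K) (tau : R -> R).

Definition str_poly_map (q : seq (K * str_word X)) : seq (K * str_word Y) :=
  [seq (t.1, str_word_map t.2) | t <- q].

Lemma str_poly_map_eval (s : Y -> R) q :
  str_poly_eval tau s (str_poly_map q) = str_poly_eval tau (s \o r) q.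
Proof.
rewrite /str_poly_eval big_map; apply: eq_bigr => t _; congr (_ *: _) => /=.
by elim: t.2 => //= [m1 -> m2 ->|w] //; rewrite word_map_eval.
Qed.

End StrWordMap.

Lemma str_poly_eval_notin (K : fieldType) (X : eqType) (R : gradedAlgType K) (tau : R -> R)
    (y z : X -> R) (q : seq (K * str_word X)) :
  (forall x, x \in flatten [seq str_word_vars t.2 | t <- q] -> y x = z x) ->
  str_poly_eval tau y q = str_poly_eval tau z q.
Proof.
elim: q => [|t q IH] yz; first by rewrite !str_poly_eval0.
rewrite !str_poly_eval_cons IH => [|x xq]; last by apply: yz; rewrite /= mem_cat xq orbT.
congr (_ *: _ + _); apply: str_word_eval_notin => x xt.
by apply: yz; rewrite /= mem_cat xt.
Qed.

(** * Transfer of relations from generic elements to [B] *)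

Section Embedding.
Variables (K : fieldType) (charK : [pchar K] =i pred0) (A : finGradedAlgType K) (Trd : A -> K).
Hypotheses (Trd_lin : scalar Trd) (Trd_trace : is_trace Trd) (A_neq0 : (gone : A) != 0).
Hypotheses (P1 : condP1 Trd) (P2 : condP2 Trd) (P3 : condP3 A).
Variables (B : gradedAlgType K) (tau : B -> B) (tau_str : supertrace tau).
Hypothesis B_str : forall p, supertrace_identity (@Strd K A Trd (grassmann K)) p ->
  supertrace_identity tau p.
Local Notation h := (hdim A).
Local Notation var := (bool * B)%type.

Let tau_lin : linear tau. Proof. by case: tau_str => [[]]. Qed.

Lemma tau_part d b : tau (gpart d b) = gpart d (tau b).
Proof.
have tp e a : gpart e a = a -> gpart e (tau a) = tau a.
  by case: tau_str => [[_ tp _ _] _]; apply: tp.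
have tD a c : tau (a + c) = tau a + tau c.
  by have := tau_lin 1 a c; rewrite !scale1r.
have te e : gpart e (tau (gpart e b)) = tau (gpart e b) by apply: tp; rewrite gpart_proj eqxx.
rewrite -[b in RHS]gpart_sum tD gpartD.
case: d; first by rewrite te (gpart_neq (te false)) ?add0r.
by rewrite te (gpart_neq (te true)) ?addr0.
Qed.

Lemma tauM a b : tau (tau a ** b) = tau a ** tau b.
Proof. by case: tau_str => [[]]. Qed.

Definition bval (v : var) : B := gpart v.1 v.2.

Definition gdeg (x : var * 'I_h) : bool := x.1.1 (+) hdeg x.2.

(* The superring freely generated by the entries of one generic element of A (x) Omega of
   degree d for each d and b; this element stands for the degree d part of b. *)
Definition Omega : gradedAlgType K := @presented K _ gdeg (fun=> False).

Definition xgen (v : var) : tensor A Omega := [ffun i => cls gdeg (fun=> False) (TGen K (v, i))].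

Lemma Omega_superring : superring Omega.
Proof. exact: presented_superring. Qed.

Lemma xgen_homog v : gpart v.1 (xgen v) = xgen v.
Proof. by apply/ffunP => i; rewrite !ffunE -[RHS]cls_gen_homog. Qed.

Lemma Omega_free (F : gradedAlgType K) (y : var -> tensor A F) : superring F ->
  (forall v, gpart v.1 (y v) = y v) ->
  exists2 z : Omega -> F, graded_hom z & forall v, tensor_map z (xgen v) = y v.
Proof.
move=> Fs yd; pose f (x : var * 'I_h) := y x.1 x.2.
have fd x : gpart (gdeg x) (f x) = f x by apply: entry_homog.
have f0 t : False -> sterm_eval f t = 0 by [].
exists (presented_lift f); first exact: presented_lift_hom Fs fd f0.
by move=> v; apply/ffunP => i; rewrite !ffunE (presented_liftE Fs fd f0).
Qed.

Local Notation str := (@Strd K A Trd Omega).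

(** Every graded substitution in A (x) E is a specialisation of the generic elements, so [q] gives a
    supertrace identity of A (x) E, which [B] satisfies. *)
Lemma generic_identity (q : seq (K * str_word var)) :
  str_poly_eval str xgen q = 0 -> str_poly_eval tau bval q = 0.
Proof.
move=> q0; pose vs := flatten [seq str_word_vars t.2 | t <- q].
pose r (v : var) : graded_var := (v.1, index v vs).
have /B_str id : supertrace_identity (@Strd K A Trd (grassmann K)) (str_poly_map r q).
  move=> s sd; rewrite str_poly_map_eval.
  have [z zh zx] := @Omega_free _ (s \o r) (grassmann_superring K) (fun v => sd (r v)).
  rewrite -(eq_str_poly_eval _ _ zx).
  rewrite -(@str_poly_eval_hom _ _ _ _ (tensor_map z) str) ?q0.
  - exact: ghom0 (tensor_map_hom A zh).
  - exact: tensor_map_hom.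
  - by move=> u; apply: Strd_map.
(* The default matters only for variables numbered beyond [vs]; they are sent to 0. *)
pose s (x : graded_var) : B := gpart x.1 (nth (x.1, 0) vs x.2).2.
have sd : graded_subst s by move=> x; rewrite /s gpart_proj eqxx.
have := id s sd; rewrite str_poly_map_eval => <-; apply: str_poly_eval_notin => v vq.
by rewrite /= /s /r /= nth_index.
Qed.

(* The graph of the partial map sending x_v to [bval v]. The supertrace identities of
   A (x) E make it single-valued, even though Omega does not satisfy the relations of B. *)
Definition corr (u : tensor A Omega) (b : B) : Prop :=
  exists q, u = str_poly_eval str xgen q /\ b = str_poly_eval tau bval q.

Lemma corr_lin c u u' b b' : corr u b -> corr u' b' -> corr (c *: u + u') (c *: b + b').
Proof.
move=> [q [-> ->]] [q' [-> ->]]; exists (str_poly_scale c q ++ q').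
by rewrite !str_poly_eval_cat !str_poly_eval_scale.
Qed.

Lemma corr_word m : corr (str_word_eval str xgen m) (str_word_eval tau bval m).
Proof.
by exists [:: (1, m)]; rewrite !str_poly_eval_cons !str_poly_eval0 !addr0 !scale1r.
Qed.

Lemma corr0 : corr 0 0.
Proof. by exists [::]; rewrite !str_poly_eval0. Qed.

Lemma corrD u u' b b' : corr u b -> corr u' b' -> corr (u + u') (b + b').
Proof. by move=> c c'; have := corr_lin 1 c c'; rewrite !scale1r. Qed.

Lemma corrZ c u b : corr u b -> corr (c *: u) (c *: b).
Proof. by move=> c1; have := corr_lin c c1 corr0; rewrite !addr0. Qed.

Lemma corrM u u' b b' : corr u b -> corr u' b' -> corr (u ** u') (b ** b').
Proof.
by move=> [q [-> ->]] [q' [-> ->]]; exists (str_poly_mul q q'); rewrite !str_poly_eval_mul.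
Qed.

Lemma corr_fun b : corr 0 b -> b = 0.
Proof. by move=> [q [/esym/generic_identity q0 ->]]. Qed.

Lemma corr_inj u b b' : corr u b -> corr u b' -> b = b'.
Proof.
move=> c c'; apply/eqP; rewrite -subr_eq0 -scaleN1r addrC; apply/eqP/corr_fun.
by have := corr_lin (-1) c' c; rewrite scaleN1r addNr.
Qed.

(** Str(1) = Trd(1) 1 holds in A (x) Omega, and single-valuedness of [corr] carries it to [B]. *)
Lemma tau1 : tau gone = Trd gone *: gone.
Proof.
have c1 := corr_word (SStr (WOne _)); have c2 := corrZ (Trd gone) (corr_word (SOne _)).
apply: (corr_inj c1); move: c2; rewrite /= tensor1E (Strd_pure Trd_lin).
by rewrite -pure_tensorZr.
Qed.

Lemma tau_tau b : tau (tau b) = Trd gone *: tau b.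
Proof. by rewrite -[tau b in LHS]gmul1r tauM tau1 gmulZr gmul1r. Qed.

Lemma tauZ c b : tau (c *: b) = c *: tau b.
Proof.
have t0 : tau 0 = 0 by have := tau_lin (-1) 0 0; rewrite scaler0 addr0 scaleN1r addNr.
by have := tau_lin c b 0; rewrite t0 !addr0.
Qed.

Lemma Strd_mul_Strd (F : gradedAlgType K) (u v : tensor A F) :
  Strd Trd (Strd Trd u ** v) = Strd Trd u ** Strd Trd v.
Proof.
have [f ->] : exists f, Strd Trd u = pure_tensor gone f by eexists; rewrite /Strd.
elim/tensor_ind: v => [|v v' IH IH'|i g].
- by rewrite gmul0r Strd0 gmul0r.
- by rewrite gmulDr !StrdD gmulDr IH IH'.
by rewrite pure_tensorM !(Strd_pure Trd_lin) pure_tensorM gmul1l gmul1l gmulZr.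
Qed.

Section TrivialGrading.
Hypothesis A1 : forall a : A, gpart true a = 0.

Lemma hdeg0 (i : 'I_h) : hdeg i = false. Proof. exact: hdeg_trivial. Qed.

Lemma word_homog w : exists d, gpart d (word_eval xgen w) = word_eval xgen w.
Proof.
elim: w => [|v|w1 [d1 e1] w2 [d2 e2]] /=.
- by exists false; rewrite gpart_one.
- by exists v.1; apply: xgen_homog.
- by exists (d1 (+) d2); apply: gpart_mul.
Qed.

Lemma Strd_word w : exists e (f : Omega),
  gpart e f = f /\ str (word_eval xgen w) = pure_tensor gone f.
Proof.
have [d wd] := word_homog w; exists d; eexists; split; last by rewrite /Strd.
rewrite linear_sum; apply: eq_bigr => i _ /=; rewrite gpartZ.
by have := entry_homog i wd; rewrite hdeg0 addbF => ->.
Qed.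

Lemma scalar_mulA (f : Omega) (u v : tensor A Omega) :
  pure_tensor gone f ** u ** v = pure_tensor gone f ** (u ** v).
Proof.
have [mA _] := Omega_superring.
elim/tensor_ind: u => [|u u' IH IH'|i g]; first by rewrite gmul0l !gmul0r gmul0l.
  by rewrite gmulDl !gmulDr gmulDl IH IH'.
elim/tensor_ind: v => [|v v' IH IH'|j g']; first by rewrite !gmul0r.
  by rewrite !gmulDr IH IH'.
by rewrite !pure_tensorM !gmul1l mA.
Qed.

(** For trivially graded A every entry of [u] has the degree of [u], so the scalar passes each of
    them with the same sign. *)
Lemma scalar_mul_comm d e (f : Omega) (u v : tensor A Omega) :
  gpart e f = f -> gpart d u = u ->
  u ** (pure_tensor gone f ** v) = (-1) ^+ (d && e) *: (pure_tensor gone f ** (u ** v)).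
Proof.
move=> fe ud; have [mA mC] := Omega_superring.
rewrite [u]tensorE !gmul_suml gmul_sumr scaler_sumr; apply: eq_bigr => i _.
have ui : gpart d (u i) = u i by have := entry_homog i ud; rewrite hdeg0 addbF.
elim/tensor_ind: v => [|v v' IH IH'|j g]; first by rewrite !gmul0r scaler0.
  by rewrite !gmulDr scalerDr IH IH'.
rewrite !pure_tensorM !gmul1l mA (mC _ _ _ _ ui fe) gmulZl pure_tensorZr.
by rewrite mA.
Qed.

(** Traces of words are homogeneous scalars by [Strd_word]; they move to the front at the cost of a
    sign. *)
Lemma trace_normal_form (m : str_word var) : exists c l w,
  str_word_eval str xgen m = c *: str_word_eval str xgen (traces_word l w).
Proof.
elim: m => [|v|m1 [c1 [l1 [w1 E1]]] m2 [c2 [l2 [w2 E2]]]|w].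
- by exists 1, [::], (WOne _); rewrite scale1r.
- by exists 1, [::], (WVar v); rewrite scale1r.
- rewrite /= E1 E2 gmulZl gmulZr scalerA.
  suff [c E] : exists c, str_word_eval str xgen (traces_word l1 w1) **
     str_word_eval str xgen (traces_word l2 w2) =
     c *: str_word_eval str xgen (traces_word (l1 ++ l2) (WMul w1 w2)).
    by exists (c1 * c2 * c), (l1 ++ l2), (WMul w1 w2); rewrite E scalerA.
  elim: l1 {E1} => [|w l1 [c E]] /=; last first.
    have [e [f [_ ->]]] := Strd_word w.
    by exists c; rewrite scalar_mulA E gmulZr.
  elim: l2 {E2} => [|w l2 [c E]] /=; first by exists 1; rewrite scale1r.
  have [e [f [fe ->]]] := Strd_word w; have [d wd] := word_homog w1.
  exists ((-1) ^+ (d && e) * c).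
  by move: E; rewrite str_of_wordE (scalar_mul_comm _ fe wd) => ->; rewrite gmulZr scalerA.
- exists 1, [:: w], (WOne _).
  by rewrite scale1r /= gmul1r.
Qed.

(** The normal form is an equation between generic values, so it also holds in [B]. On a normal form
    the outer trace slides past the leading traces, on both sides, and ends on the last word, which
    again gives a supertrace word. *)
Lemma corr_trace u b : corr u b -> corr (str u) (tau b).
Proof.
move=> [q [-> ->]]; elim: q => [|[c m] q IH].
  rewrite !str_poly_eval0 Strd0 -(scale0r (0 : B)) tauZ scale0r; exact: corr0.
rewrite !str_poly_eval_cons Strd_linear tau_lin; apply: corr_lin IH.
have [c' [l [w E]]] := trace_normal_form m.
have Eb : str_word_eval tau bval m = c' *: str_word_eval tau bval (traces_word l w).
  apply: (corr_inj (corr_word m)); rewrite E; apply/corrZ/corr_word.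
rewrite E Eb StrdZ tauZ; apply: corrZ.
pose m' := foldr (fun w m => SMul (SStr w) m) (SStr w) l.
have [-> ->] : str (str_word_eval str xgen (traces_word l w)) = str_word_eval str xgen m' /\
    tau (str_word_eval tau bval (traces_word l w)) = str_word_eval tau bval m'.
  elim: l {E Eb} @m' => [|w' l [IH1 IH2]] /=; first by rewrite !str_of_wordE.
  by rewrite Strd_mul_Strd tauM IH1 IH2.
exact: corr_word.
Qed.

End TrivialGrading.

(** Stability of [corr] under traces is proved for trivially graded A only, so in general the trace
    is recorded as a second condition; tame polynomials ask for no more. *)
Definition tr_ok (u : tensor A Omega) (b : B) : Prop := corr u b /\ corr (str u) (tau b).

(** If A is trivially graded, any trace is handled by [corr_trace]; otherwise only variables are
    traced, and [tr_ok] provides exactly that. *)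
Lemma corr_tame (n : nat) (p : seq (K * str_word 'I_n)) (y : 'I_n -> tensor A Omega)
    (b : 'I_n -> B) : tame A p -> (forall k, tr_ok (y k) (b k)) ->
  corr (str_poly_eval str y p) (str_poly_eval tau b p).
Proof.
move=> pt yb; have wc w : corr (word_eval y w) (word_eval b w).
  elim: w => [|k|w1 IH1 w2 IH2] /=; [exact: (corr_word (SOne _))|by case: (yb k)|exact: corrM].
have mc m : (forall a : A, gpart true a = 0) \/ var_traces m ->
    corr (str_word_eval str y m) (str_word_eval tau b m).
  elim: m => [_|k _|m1 IH1 m2 IH2 mt|w mt] /=.
  - exact: (corr_word (SOne _)).
  - by case: (yb k).
  - by apply: corrM; [apply: IH1|apply: IH2]; case: mt => [?|/andP[]]; [left|right|left|right].
  case: mt => [A1|]; first by apply: corr_trace.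
  by case: w => // k _; case: (yb k).
elim: p pt => [|[c m] p IH] pt; first by rewrite !str_poly_eval0; apply: corr0.
rewrite !str_poly_eval_cons; apply: corr_lin.
  by apply: mc; case: pt => [?|/andP[]]; [left|right].
by apply: IH; case: pt => [?|/andP[]]; [left|right].
Qed.

Lemma tr_ok_lin c u u' b b' : tr_ok u b -> tr_ok u' b' -> tr_ok (c *: u + u') (c *: b + b').
Proof.
move=> [c1 t1] [c2 t2]; split; first exact: corr_lin.
by rewrite Strd_linear tau_lin; apply: corr_lin.
Qed.

Lemma tr_ok0 : tr_ok 0 0.
Proof.
split; first exact: corr0.
by rewrite Strd0 -(scale0r (0 : B)) tauZ scale0r; apply: corr0.
Qed.

Lemma tr_okB u u' b b' : tr_ok u b -> tr_ok u' b' -> tr_ok (u - u') (b - b').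
Proof.
move=> t t'; have := tr_ok_lin (-1) t' t.
by rewrite !scaleN1r [- u' + u]addrC [- b' + b]addrC.
Qed.

Lemma tr_ok_word w : tr_ok (word_eval xgen w) (word_eval bval w).
Proof.
split; last exact: (corr_word (SStr w)).
by have := corr_word (str_of_word w); rewrite !str_of_wordE.
Qed.

Lemma tr_ok_trace v : tr_ok (str (xgen v)) (tau (bval v)).
Proof.
have c := corr_word (SStr (WVar v)); split=> //.
by rewrite (Strd_Strd Trd_lin) tau_tau; apply: corrZ.
Qed.

(** * Relators and the universal supermap *)

Inductive relator : tensor A Omega -> Prop :=
| RelLin d c b b' : relator (xgen (d, c *: b + b') - (c *: xgen (d, b) + xgen (d, b')))
| RelPart d e b : relator (xgen (d, gpart e b) - if d == e then xgen (d, b) else 0)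
| RelMul d e b b' : relator (xgen (d, b) ** xgen (e, b') -
    xgen (d (+) e, gpart d b ** gpart e b'))
| RelOne : relator (xgen (false, gone) - gone)
| RelTr d b : relator (xgen (d, tau b) - str (xgen (d, b))).

Lemma relator_homog r : relator r -> exists d, gpart d r = r.
Proof.
have xh d b : gpart d (xgen (d, b)) = xgen (d, b) by apply: (xgen_homog (d, b)).
case=> [d c b b'|d e b|d e b b'||d b].
- by exists d; rewrite gpartB gpartD gpartZ !xh.
- by exists d; rewrite gpartB xh; case: ifP; rewrite ?xh ?gpart0.
- by exists (d (+) e); rewrite gpartB xh gpart_mul.
- by exists false; rewrite gpartB xh gpart_one.
- by exists d; rewrite gpartB xh (Strd_part Trd_lin) ?xh //; apply: Trd_odd.
Qed.

Lemma relator_tr_ok r : relator r -> tr_ok r 0.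
Proof.
have xt d b : tr_ok (xgen (d, b)) (gpart d b) by apply: (tr_ok_word (WVar (d, b))).
case=> [d c b b'|d e b|d e b b'||d b].
- have := tr_okB (xt d (c *: b + b')) (tr_ok_lin c (xt d b) (xt d b')).
  by rewrite gpartD gpartZ subrr.
- have := xt d (gpart e b); rewrite gpart_proj; case: (d =P e) => [-> t|_ t].
    by have := tr_okB t (xt e b); rewrite subrr.
  by rewrite subr0.
- have := tr_okB (tr_ok_word (WMul (WVar (d, b)) (WVar (e, b'))))
    (xt (d (+) e) (gpart d b ** gpart e b')).
  by rewrite gpart_mul_homog subrr.
- have := tr_okB (xt false gone) (tr_ok_word (WOne _)).
  by rewrite gpart_one subrr.
- have := tr_okB (xt d (tau b)) (tr_ok_trace (d, b)).
  by rewrite /bval /= tau_part subrr.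
Qed.

(** Relators are built from generic elements by operations commuting with both g and z; for the
    trace this uses invariance of [Trd]. *)
Lemma relator_equivariant r (g : 'End(A)) (z : Omega -> Omega) : relator r -> graded_aut g ->
  graded_hom z -> (forall v, tensor_map z (xgen v) = tensor_act g (xgen v)) ->
  tensor_map z r = tensor_act g r.
Proof.
move=> rP gP zh zx; have zA := tensor_map_hom A zh; have gA := tensor_act_hom Omega gP.1.
case: rP => [d c b b'|d e b|d e b b'||d b].
- by rewrite !(ghomB zA) !(ghomB gA) !(ghomP zA) !(ghomP gA) !zx.
- rewrite !(ghomB zA) !(ghomB gA) !zx; case: ifP => _; first by rewrite zx.
  by rewrite (ghom0 zA) (ghom0 gA).
- by rewrite !(ghomB zA) !(ghomB gA) !(ghomM zA) !(ghomM gA) !zx.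
- by rewrite !(ghomB zA) !(ghomB gA) (ghom1 zA) (ghom1 gA) zx.
- rewrite !(ghomB zA) !(ghomB gA) zx Strd_map // zx (Strd_act Trd_lin) //; first exact: ghom1 gP.1.
  by move=> a; apply: Trd_aut.
Qed.

Lemma relator_hom r (F : gradedAlgType K) (f : B -> tensor A F) (z : Omega -> F) : relator r ->
  supertrace_hom Trd tau f -> graded_hom z ->
  (forall v, tensor_map z (xgen v) = f (bval v)) -> tensor_map z r = 0.
Proof.
move=> rP [fh ft] zh zx; have zA := tensor_map_hom A zh.
case: rP => [d c b b'|d e b|d e b b'||d b].
- by rewrite (ghomB zA) (ghomP zA) !zx /bval /= gpartD gpartZ (ghomP fh) subrr.
- rewrite (ghomB zA) zx /bval /= gpart_proj; case: (d =P e) => [->|_].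
    by rewrite zx subrr.
  by rewrite (ghom0 zA) (ghom0 fh) subrr.
- by rewrite (ghomB zA) (ghomM zA) !zx /bval /= gpart_mul_homog (ghomM fh) subrr.
- by rewrite (ghomB zA) zx (ghom1 zA) /bval /= gpart_one (ghom1 fh) subrr.
- by rewrite (ghomB zA) zx Strd_map // zx -ft /bval /= tau_part subrr.
Qed.

Definition rel_term (t : sterm K (var * 'I_h)) : Prop :=
  exists r i, relator r /\ cls gdeg (fun=> False) t = r i.

Definition Xi0 : gradedAlgType K := @presented K _ gdeg rel_term.

Definition xi (v : var) : tensor A Xi0 := [ffun i => cls gdeg rel_term (TGen K (v, i))].

Definition rho0 (b : B) : tensor A Xi0 := xi (false, b) + xi (true, b).

Lemma xi_homog v : gpart v.1 (xi v) = xi v.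
Proof. by apply/ffunP => i; rewrite !ffunE -[RHS]cls_gen_homog. Qed.

Lemma Xi0_superring : superring Xi0.
Proof. exact: presented_superring. Qed.

Lemma sterm_eval_cls t :
  sterm_eval (fun x => cls gdeg rel_term (TGen K x) : Xi0) t = cls gdeg rel_term t.
Proof.
elim: t => //= [a -> b ->|c a ->|a -> b ->|d a ->].
- exact: presentedD.
- exact: presentedZ.
- exact: presentedM.
- exact: presented_part.
Qed.

Lemma Omega_to_Xi0 : exists2 z : Omega -> Xi0, graded_hom z &
  (forall v, tensor_map z (xgen v) = xi v) /\ (forall r, relator r -> tensor_map z r = 0).
Proof.
pose f (x : var * 'I_h) : Xi0 := cls gdeg rel_term (TGen K x).
have fd x : gpart (gdeg x) (f x) = f x by apply: cls_gen_homog.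
have f0 t : False -> sterm_eval f t = 0 by [].
have zE t : presented_lift f (cls gdeg (fun=> False) t) = cls gdeg rel_term t.
  by rewrite (presented_liftE Xi0_superring fd f0) sterm_eval_cls.
exists (presented_lift f); first exact: presented_lift_hom Xi0_superring fd f0.
split=> [v|r rP]; apply/ffunP => i; rewrite !ffunE ?zE //.
rewrite -[r i]repK zE; apply/clsP; apply: ERel.
by exists r, i; split=> //; apply: repK.
Qed.

Lemma xi_lin d c b b' : xi (d, c *: b + b') = c *: xi (d, b) + xi (d, b').
Proof.
have [z zh [zx zr]] := Omega_to_Xi0; have zA := tensor_map_hom A zh.
have := zr _ (RelLin d c b b'); rewrite (ghomB zA) (ghomP zA) !zx => /eqP.
by rewrite subr_eq0 => /eqP.
Qed.

Lemma xi_part d e b : xi (d, gpart e b) = if d == e then xi (d, b) else 0.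
Proof.
have [z zh [zx zr]] := Omega_to_Xi0; have zA := tensor_map_hom A zh.
have := zr _ (RelPart d e b); rewrite (ghomB zA) zx => /eqP; rewrite subr_eq0 => /eqP ->.
by case: ifP; rewrite ?zx ?(ghom0 zA).
Qed.

Lemma xi_mul d e b b' : xi (d, b) ** xi (e, b') = xi (d (+) e, gpart d b ** gpart e b').
Proof.
have [z zh [zx zr]] := Omega_to_Xi0; have zA := tensor_map_hom A zh.
have := zr _ (RelMul d e b b'); rewrite (ghomB zA) (ghomM zA) !zx => /eqP.
by rewrite subr_eq0 => /eqP.
Qed.

Lemma xi_one : xi (false, gone) = gone.
Proof.
have [z zh [zx zr]] := Omega_to_Xi0; have zA := tensor_map_hom A zh.
have := zr _ RelOne; rewrite (ghomB zA) (ghom1 zA) zx => /eqP.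
by rewrite subr_eq0 => /eqP.
Qed.

Lemma xi_trace d b : xi (d, tau b) = Strd Trd (xi (d, b)).
Proof.
have [z zh [zx zr]] := Omega_to_Xi0; have zA := tensor_map_hom A zh.
have := zr _ (RelTr d b); rewrite (ghomB zA) (Strd_map _ _ zh) !zx => /eqP.
by rewrite subr_eq0 => /eqP.
Qed.

Lemma rho0_part d b : rho0 (gpart d b) = xi (d, b).
Proof. by rewrite /rho0 !xi_part; case: d; rewrite /= ?add0r ?addr0. Qed.

Lemma gpart_rho0 d b : gpart d (rho0 b) = xi (d, b).
Proof.
rewrite /rho0 gpartD.
have xh e : gpart e (xi (e, b)) = xi (e, b) by apply: (xi_homog (e, b)).
case: d; first by rewrite (gpart_neq (xh false)) // add0r xh.
by rewrite (gpart_neq (xh true)) // addr0 xh.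
Qed.

Lemma rho0_hom : supertrace_hom Trd tau rho0.
Proof.
have rl c b b' : rho0 (c *: b + b') = c *: rho0 b + rho0 b'.
  by rewrite /rho0 !xi_lin scalerDr addrACA.
have rD b b' : rho0 (b + b') = rho0 b + rho0 b' by have := rl 1 b b'; rewrite !scale1r.
split; last by move=> b; rewrite /rho0 !xi_trace StrdD.
split=> [//||b b'|d b]; last by rewrite rho0_part gpart_rho0.
  by rewrite -{1}gpart_one rho0_part xi_one.
rewrite -{1}[b]gpart_sum -{1}[b']gpart_sum gmulDl !gmulDr !rD.
have rM d e : rho0 (gpart d b ** gpart e b') = xi (d, b) ** xi (e, b').
  by rewrite -gpart_mul_homog rho0_part xi_mul.
by rewrite !rM /rho0 !gmulDl addrACA.
Qed.

Lemma subalg_gen_sub (R : gradedAlgType K) (S T : R -> Prop) x :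
  (forall a, S a -> T a) -> subalg_gen S x -> subalg_gen T x.
Proof.
move=> ST; elim=> [a /ST Ta||c a b _ IHa _ IHb|a b _ IHa _ IHb].
- exact: SubalgIn.
- exact: SubalgOne.
- exact: SubalgLin.
- exact: SubalgMul.
Qed.

(** A supertrace homomorphism kappa specialises the generic elements and thereby sends all relators
    to 0 ([relator_hom]), so the homomorphism on [Omega] descends to [Xi0]. *)
Lemma rho0_universal : universal_supermap Trd tau rho0.
Proof.
split; [exact: Xi0_superring|exact: rho0_hom| |].
  move=> x; apply: subalg_gen_sub (cls_gen_generate x) => _ [[[d b] i] ->].
  by exists (gpart d b), i; rewrite rho0_part ffunE.
move=> F kappa Fs kh; have kd v : gpart v.1 (kappa (bval v)) = kappa (bval v).
  by rewrite -(ghom_part kh.1) /bval gpart_proj eqxx.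
have [z0 z0h z0x] := @Omega_free F (kappa \o bval) Fs kd.
pose f (x : var * 'I_h) : F := kappa (bval x.1) x.2.
have fd x : gpart (gdeg x) (f x) = f x.
  by apply: entry_homog.
have z0f t : z0 (cls gdeg (fun=> False) t) = sterm_eval f t.
  elim: t => [[v i]|||a IHa b IHb|c a IH|a IHa b IHb|d a IH] /=.
  - by rewrite /f -[kappa _]z0x !ffunE.
  - exact: ghom0 z0h.
  - exact: ghom1 z0h.
  - by rewrite -presentedD (ghomD z0h) IHa IHb.
  - by rewrite -presentedZ (ghomZ z0h) IH.
  - by rewrite -presentedM (ghomM z0h) IHa IHb.
  - by rewrite -presented_part (ghom_part z0h) IH.
have f0 t : rel_term t -> sterm_eval f t = 0.
  move=> [r [i [rP tE]]]; rewrite -z0f tE.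
  by have /ffunP/(_ i) := relator_hom rP kh z0h z0x; rewrite !ffunE.
have zh := presented_lift_hom Fs fd f0; exists (presented_lift f) => // b.
have zx v : tensor_map (presented_lift f) (xi v) = kappa (bval v).
  by apply/ffunP => i; rewrite !ffunE (presented_liftE Fs fd f0).
by rewrite (ghomD (tensor_map_hom A zh)) !zx -(ghomD kh.1) gpart_sum.
Qed.

(** What a factor must satisfy to enter the expansion: a counterpart in [B] compatible with traces,
    homogeneity, and equivariance under every z that realises g on generic elements. *)
Definition simple (y : tensor A Omega) (b : B) : Prop :=
  [/\ tr_ok y b, exists d, gpart d y = y &
    forall (g : 'End(A)) (z : Omega -> Omega), graded_aut g -> graded_hom z ->
      (forall v, tensor_map z (xgen v) = tensor_act g (xgen v)) ->
      tensor_map z y = tensor_act g y].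

Lemma simple_xgen v : simple (xgen v) (bval v).
Proof.
split; first exact: (tr_ok_word (WVar v)).
  by exists v.1; apply: xgen_homog.
by move=> g z _ _; apply.
Qed.

Lemma simple1 : simple gone gone.
Proof.
split; first exact: (tr_ok_word (WOne _)).
  by exists false; rewrite gpart_one.
move=> g z gP zh _; rewrite (ghom1 (tensor_map_hom A zh)).
by rewrite (ghom1 (tensor_act_hom Omega gP.1)).
Qed.

Lemma simple_relator r : relator r -> simple r 0.
Proof.
move=> rP; split; [exact: relator_tr_ok|exact: relator_homog|].
by move=> g z gP zh zx; apply: relator_equivariant.
Qed.

Definition simple_list (l : entries A Omega) : Prop :=
  forall p, p \in l -> exists b, simple p.1 b.

(** Membership in the ideal is remembered only through one factor whose counterpart in [B] is 0. *)
Definition relator_list (l : entries A Omega) : Prop :=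
  simple_list l /\ exists2 p, p \in l & simple p.1 0.

Lemma Omega_mspan (x : Omega) : mspan simple_list x.
Proof.
elim: (cls_gen_generate x) => [_ [[v i] ->]||c a b _ IHa _ IHb|a b _ IHa _ IHb].
- have -> : cls gdeg (fun=> False) (TGen K (v, i)) = mon [:: (xgen v, i)].
    by rewrite /mon gprod_cons /gprod /= gmul1r ffunE.
  by apply: mspan_mon => p; rewrite inE => /eqP ->; exists (bval v); apply: simple_xgen.
- exact: (@mspan_mon _ _ _ simple_list [::]).
- by apply: mspanD IHb; apply: mspanZ.
- apply: (mspanM Omega_superring _ IHa IHb) => l l' ll ll' p.
  by rewrite mem_cat => /orP[/ll|/ll'].
Qed.

(** Monomials with a factor standing for 0 span a graded ideal that contains the entries of all
    relators, so [seqv_ideal] applies. *)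
Lemma rel_ideal s t : seqv gdeg rel_term s t ->
  mspan relator_list (cls gdeg (fun=> False) s - cls gdeg (fun=> False) t : Omega).
Proof.
apply: (@seqv_ideal K _ gdeg rel_term (@mspan K A Omega relator_list)).
- exact: MSpan0.
- by move=> x y; apply: mspanD.
- by move=> c x; apply: mspanZ.
- move=> x y Jx; apply: (mspanM Omega_superring _ Jx (Omega_mspan y)).
  move=> l l' [ls [p pl p0]] l's; split; last by exists p; rewrite // mem_cat pl.
  by move=> q; rewrite mem_cat => /orP[/ls|/l's].
- move=> x y Jx; apply: (mspanM Omega_superring _ (Omega_mspan y) Jx).
  move=> l l' ls [l's [p pl p0]]; split; last by exists p; rewrite // mem_cat pl orbT.
  by move=> q; rewrite mem_cat => /orP[/ls|/l's].
- by move=> d x; apply: mspan_part => l [ls _] p /ls[b []].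
- move=> u [r [i [rP ->]]].
  have -> : r i = mon [:: (r, i)] by rewrite /mon gprod_cons /gprod /= gmul1r.
  apply: mspan_mon; split; last by exists (r, i); rewrite ?mem_head //; apply: simple_relator.
  by move=> p; rewrite inE => /eqP ->; exists 0; apply: simple_relator.
Qed.

(** The entries of the generic element lie in the ideal of relators, and the element is equivariant,
    so [invariant_expand] writes it as supertrace polynomials, each with an argument standing for 0.
    Every summand then corresponds to 0 in [B], while the generic element corresponds to
    [gpart d b]. *)
Lemma xi_inj d b : xi (d, b) = 0 -> gpart d b = 0.
Proof.
move=> x0; have Jx : vspan relator_list (xgen (d, b)).
  apply: vspan_entries => i; rewrite ffunE.
  have /clsP/rel_ideal : cls gdeg rel_term (TGen K ((d, b), i)) = cls gdeg rel_term (TZero K _).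
    by have /ffunP/(_ i) := x0; rewrite !ffunE.
  by rewrite (_ : cls gdeg (fun=> False) (TZero K _) = 0) ?subr0.
pose T y := exists b, simple y b.
have Th y : T y -> exists d, gpart d y = y by move=> [c []].
have LT l : relator_list l -> forall p, p \in l -> T p.1 by case.
have [|r [n [y [p [xE yP]]]]] := @invariant_expand _ charK _ _ Trd_lin Trd_trace
  A_neq0 P1 P2 P3 _ Omega_superring T relator_list (xgen (d, b)) LT (ex_intro _ _ simple1) Th _ Jx.
  move=> g gP; have gA := tensor_act_hom Omega gP.1.
  have [v|z zh zx] := @Omega_free Omega (fun v => tensor_act g (xgen v)) Omega_superring.
    by rewrite -(ghom_part gA) xgen_homog.
  by exists z; split=> // x [c [_ _]]; apply.
suff c0 s : corr (str_poly_eval str (y s) (p s)) 0.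
  apply: (corr_inj (corr_word (SVar (d, b)))); rewrite /= xE.
  elim/big_rec: _ => [|s u _ cu]; first exact: corr0.
  by rewrite -[0]addr0; apply: corrD.
have [[d' [phi [pt pl]]] [l [[ls [q ql q0]] ly lk]]] := yP s; have [k0 yk0] := lk q ql.
have [k|be beP] := @fin_all_exists _ _ (fun k b => simple (y s k) b).
  case: (ly k) => [->|[i il]]; first by exists gone; apply: simple1.
  exact: (ls _ il).
pose be' k := if k == k0 then 0 else be k.
have t k : tr_ok (y s k) (be' k).
  rewrite /be'; case: (k =P k0) => [->|_]; first by rewrite yk0; case: q0.
  by case: (beP k).
have c := corr_tame pt t; suff e0 : str_poly_eval tau be' (p s) = 0 by rewrite e0 in c.
(* Linearity of [p s] is known over superrings, not in [B]. So its value in [B] with [k0]-th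
   argument 0 is matched with the value in A (x) Omega with [k0]-th argument 0; the latter vanishes,
   and [corr_fun] concludes. *)
pose y' k := if k == k0 then 0 else y s k.
apply: corr_fun; rewrite -(multilinear0 (k := k0) (y := y') (pl Omega Omega_superring).1).
  apply: corr_tame => // k; rewrite /be' /y'; case: (k == k0); first exact: tr_ok0.
  by case: (beP k).
by rewrite /y' eqxx.
Qed.

Lemma rho0_inj b : rho0 b = 0 -> b = 0.
Proof.
move=> r0; rewrite -[b]gpart_sum !xi_inj ?addr0 // -gpart_rho0 r0 gpart0 //.
Qed.

(** * Arbitrary universal supermaps and their fixed points *)

Section Universal.
Variables (Xi : gradedAlgType K) (rho : B -> tensor A Xi).
Hypothesis rhoU : universal_supermap Trd tau rho.

(** The injective [rho0] factors through any universal [rho]. *)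
Lemma universal_inj : injective rho.
Proof.
case: rhoU => Xis [rh rt] gen univ b b' bb; have [z zh zx] := univ _ _ Xi0_superring rho0_hom.
apply/eqP; rewrite -subr_eq0; apply/eqP/rho0_inj.
by rewrite -zx (ghomB rh) bb subrr (ghom0 (tensor_map_hom A zh)).
Qed.

Lemma gen_hom_eq (F : gradedAlgType K) (z z' : Xi -> F) : graded_hom z -> graded_hom z' ->
  (forall b, tensor_map z (rho b) = tensor_map z' (rho b)) -> z =1 z'.
Proof.
case: rhoU => _ _ gen _ zh zh' zz x.
elim: (gen x) => [_ [b [i ->]]||c a a' _ IH _ IH'|a a' _ IH _ IH'].
- by have /ffunP/(_ i) := zz b; rewrite !ffunE.
- by rewrite (ghom1 zh) (ghom1 zh').
- by rewrite (ghomP zh) (ghomP zh') IH IH'.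
- by rewrite (ghomM zh) (ghomM zh') IH IH'.
Qed.

(** An automorphism preserves [Trd], so g after [rho] is again a supertrace homomorphism, and the
    universal property yields zeta^g. *)
Lemma universal_act (g : 'End(A)) : graded_aut g -> exists2 z : Xi -> Xi, graded_hom z &
  forall b, tensor_map z (rho b) = tensor_act g (rho b).
Proof.
move=> gP; have [Xis [rh rt] _ univ] := rhoU.
apply: (univ Xi (fun b => tensor_act g (rho b)) Xis); split.
  exact: (graded_hom_comp rh (tensor_act_hom Xi gP.1)).
move=> b; rewrite rt (Strd_act Trd_lin) //; first exact: ghom1 gP.1.
by move=> a; apply: Trd_aut.
Qed.

(** The inverse of zeta^g comes from the inverse of g: both composites fix the entries of [rho],
    which generate [Xi]. *)
Lemma rho_fixed b : fixed_point rho (rho b).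
Proof.
move=> g gP; have [z zh zx] := universal_act gP.
have [z' zh' zx'] := universal_act (graded_autV gP); exists z, z'.
have id_hom : graded_hom (@id Xi) by split.
have gVg : (g \o g^-1)%VF = \1%VF by apply/lfunP => a; rewrite lfunE id_lfunE /= graded_autVK.
have gVg' : (g^-1 \o g)%VF = \1%VF by apply/lfunP => a; rewrite lfunE id_lfunE /= graded_autK.
split=> //.
- apply: (gen_hom_eq (graded_hom_comp zh zh') id_hom) => c.
  by rewrite -tensor_map_comp zx -tensor_act_map // zx' tensor_act_comp gVg
    tensor_act_id tensor_map_id.
- apply: (gen_hom_eq (graded_hom_comp zh' zh) id_hom) => c.
  by rewrite -tensor_map_comp zx' -tensor_act_map // zx tensor_act_comp gVg'
    tensor_act_id tensor_map_id.
- by rewrite zx' tensor_act_comp gVg tensor_act_id.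
Qed.

Definition rho_homog (y : tensor A Xi) : Prop := exists d b, gpart d b = b /\ y = rho b.

(** The entries of [u] are combinations of monomials in entries of homogeneous values of [rho], so
    [u] is a supertrace polynomial in such values. As [rho] preserves products and supertraces, [u]
    is the image of the same polynomial evaluated in [B]. *)
Lemma fixed_rho u : fixed_point rho u -> exists b, rho b = u.
Proof.
move=> uP; have [Xis [rh rt] gen _] := rhoU.
pose Q (l : entries A Xi) := forall p, p \in l -> rho_homog p.1.
have Qx (x : Xi) : mspan Q x.
  elim: (gen x) => [_ [b [i ->]]||c a a' _ IH _ IH'|a a' _ IH _ IH'].
  - have rd d : mspan Q (rho (gpart d b) i).
      have -> : rho (gpart d b) i = mon [:: (rho (gpart d b), i)].
        by rewrite /mon gprod_cons /gprod /= gmul1r.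
      apply: mspan_mon => p; rewrite inE => /eqP ->; exists d, (gpart d b).
      by rewrite gpart_proj eqxx.
    rewrite -[b]gpart_sum (ghomD rh) ffunE; apply: mspanD; exact: rd.
  - exact: (@mspan_mon _ _ _ Q [::]).
  - by apply: mspanD IH'; apply: mspanZ.
  - apply: (mspanM Xis _ IH IH') => l l' ll ll' p.
    by rewrite mem_cat => /orP[/ll|/ll'].
have T1 : rho_homog gone by exists false, gone; rewrite gpart_one (ghom1 rh).
have Th y : rho_homog y -> exists d, gpart d y = y.
  by move=> [d [b [bd ->]]]; exists d; rewrite -(ghom_part rh) bd.
have [|r [n [y [p [-> yP]]]]] := @invariant_expand _ charK _ _ Trd_lin Trd_trace
  A_neq0 P1 P2 P3 _ Xis rho_homog Q u (fun l Ql => Ql) T1 Th _ (vspan_entries (fun i => Qx (u i))).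
  move=> g gP; have [z [z' [zh zx zK z'K gu]]] := uP g gP; exists z; split=> //.
    by move=> _ [d [b [_ ->]]]; rewrite zx.
  (* Applying z to g(z'(u)) = u turns the fixed point condition into z(u) = g(u). *)
  rewrite -{1}gu -tensor_act_map // tensor_map_comp.
  by rewrite (eq_tensor_map _ z'K) tensor_map_id.
have yr s k : exists b, y s k = rho b.
  have [_ [l [Ql ly _]]] := yP s; case: (ly k) => [->|[i il]].
    by exists gone; rewrite (ghom1 rh).
  by have [d [b [_ e]]] := Ql _ il; exists b.
have [f fP] := fin_all_exists (fun s => fin_all_exists (yr s)).
exists (\sum_s str_poly_eval tau (f s) (p s)); rewrite (ghom_sum rh); apply: eq_bigr => s _.
rewrite (@str_poly_eval_hom _ _ _ _ rho tau (@Strd K A Trd Xi)) //.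
by apply: eq_str_poly_eval => k; rewrite /= fP.
Qed.

End Universal.
End Embedding.

Theorem theorem4p13 (K : fieldType) (charK : [pchar K] =i pred0)
    (A : finGradedAlgType K) (Trd : A -> K)
    (A_pa : power_associative A) (A_gcs : graded_central_simple A)
    (Trd_generic : generic_trace Trd) (Trd_trace : is_trace Trd)
    (P1 : condP1 Trd) (P2 : condP2 Trd) (P3 : condP3 A)
    (B : gradedAlgType K) (tau : B -> B) (tau_str : supertrace tau)
    (B_var : in_variety_of (tensor A (grassmann K)) B)
    (B_str : forall p, supertrace_identity (@Strd K A Trd (grassmann K)) p ->
                       supertrace_identity tau p) :
  (exists (Xi : gradedAlgType K) (rho : B -> tensor A Xi),
      universal_supermap Trd tau rho /\ injective rho) /\
  (forall (Xi : gradedAlgType K) (rho : B -> tensor A Xi),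
      universal_supermap Trd tau rho ->
      injective rho /\
      (forall u : tensor A Xi, (exists b, rho b = u) <-> fixed_point rho u)).
Proof.
have Trd_lin := generic_trace_linear charK Trd_generic Trd_trace.
have A_neq0 := generic_trace_unit Trd_generic Trd_trace.
have inj Xi rho := @universal_inj K charK A Trd Trd_lin Trd_trace A_neq0 P1 P2 P3
  B tau tau_str B_str Xi rho.
split.
  exists (Xi0 Trd tau), (@rho0 K A Trd B tau).
  have U := @rho0_universal K A Trd B tau tau_str.
  by split; [apply: U|apply/inj/U].
move=> Xi rho rhoU; split; first exact: inj.
move=> u; split=> [[b <-]|].
  exact: (rho_fixed Trd_lin P1 rhoU).
exact: (fixed_rho charK Trd_lin Trd_trace A_neq0 P1 P2 P3 rhoU).
Qed.
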